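(* Let $\varsigma$ be a semi-norm on $E$ such that $|\sigma(f,g)|\le c\,\varsigma(f)\,\varsigma(g)$ for all $f,g\in E$, for some constant $c>0$. Then the following hold. (1) For all $\mu,\nu\in\mathcal{M}^1_\varsigma(E)$ the expression $$\{\mu,\nu\}_0(\Lambda):=\int_E d\mu(f)\int_E d\nu(g)\,\sigma(f,g)\,\mathbf 1_\Lambda(f+g),\qquad \Lambda\in\mathsf{B}^{\mathrm{il}}(E),$$ gives a well-defined measure $\{\mu,\nu\}_0\in\mathcal{M}(E)$. If $\mu,\nu\in\mathcal{M}^n_\varsigma(E)$ for some finite $n\in\mathbb{N}$, then $\{\mu,\nu\}_0\in\mathcal{M}^{n-1}_\varsigma(E)$ and $$\|\{\mu,\nu\}_0\|^{n-1}_\varsigma\le c\,c_{n-1}\,\|\mu\|^n_\varsigma\,\|\nu\|^n_\varsigma .$$ (2) For $\hbar\neq0$ put $\{\mu,\nu\}_\hbar:=\frac{i}{\hbar}(\mu\star_\hbar\nu-\nu\star_\hbar\mu)$, and for $\hbar=0$ take $\{\cdot,\cdot\}_0$ as in (1). For every $n\in\mathbb{N}\cup\{\infty\}$ the mapping $$\mathbb{R}\times\mathcal{M}^n_\varsigma(E)\times\mathcal{M}^n_\varsigma(E)\to\mathcal{M}^{n-1}_\varsigma(E),\qquad(\hbar,\mu,\nu)\mapsto\{\mu,\nu\}_\hbar,$$ is jointly continuous, where for $n<\infty$ the spaces $\mathcal{M}^n_\varsigma(E)$ and $\mathcal{M}^{n-1}_\varsigma(E)$ carry the norms $\|\cdot\|^n_\varsigma$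 and $\|\cdot\|^{n-1}_\varsigma$, and for $n=\infty$ (with $\infty-1:=\infty$) the Fréchet topology $\upsilon_\varsigma$. (3) The mapping $\{\cdot,\cdot\}_0:\mathcal{M}^\infty_\varsigma(E)\times\mathcal{M}^\infty_\varsigma(E)\to\mathcal{M}^\infty_\varsigma(E)$ is a Poisson bracket which is jointly continuous with respect to $\upsilon_\varsigma$, and it makes $(\mathcal{M}^\infty_\varsigma(E),\star_0,\{\cdot,\cdot\}_0)$ a Poisson algebra. (4) Let $\mathcal{P}$ be one of the following: (I) $\mathcal{P}=\mathcal{M}^\infty_\kappa(E)$ for a semi-norm $\kappa$ on $E$ stronger than, or equivalent to, $\varsigma$; (II) $\mathcal{P}=\bigcap_{\beta\in B}\mathcal{M}^\infty_{\kappa_\beta}(E)$ for a collection of semi-norms $\kappa_\beta$, $\beta\in B$, on $E$ satisfying $\varsigma\le\sum_{\beta\in\Gamma}c_\beta\kappa_\beta$ for some finite $\Gamma\subseteq B$ and some constants $c_\beta>0$; (III) the intersection of $\mathcal{M}(E)_d$, or of $\mathcal{M}(E)_c$, or of $\mathcal{M}(E_\alpha)_a$ for a finite dimensional subspace $E_\alpha$ of $E$, with one of the spaces in (I) or (II); (IV) $\mathcal{P}=\mathcal{M}(E)_{df}$. Then $\mathcal{P}\subseteq\mathcal{M}^\infty_\varsigma(E)$, and $(\mathcal{P},\star_0,\{\cdot,\cdot\}_0)$ is a Poisson algebra, which in addition is invariant under the product $\star_\hbar$ for each $\hbar\in\mathbb{R}$.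
   Context: Setting. $E$ is an infinite dimensional real vector space and $\sigma$ is a pre-symplectic form on $E$ (an $\mathbb{R}$-bilinear antisymmetric form, possibly degenerate, $\sigma\neq0$). All topologies are Hausdorff. $\{E_\alpha\mid\alpha\in I\}$ is the family of all finite dimensional subspaces of $E$, each with its unique vector space topology; $\mathcal{M}(E_\alpha)$ denotes the finite complex (regular) Borel measures on $E_\alpha$. $\tau_{\mathrm{il}}$ is the finest locally convex topology on $E$ and $\mathsf{B}^{\mathrm{il}}(E)$ its Borel $\sigma$-algebra. Finite complex measures $\mu$ on $\mathsf{B}^{\mathrm{il}}(E)$ are normed by total variation $\|\mu\|_1=|\mu|(E)$, where $|\mu|$ is the variation measure. Each $\mu\in\mathcal{M}(E_\alpha)$ is regarded as a measure on $E$ concentrated on $E_\alpha$, and $\mathcal{M}(E)$ is the $\|\cdot\|_1$-closure of $\bigcup_{\alpha\in I}\mathcal{M}(E_\alpha)$. $\mathbf 1_\Lambda$ is the characteristic function of $\Lambda$. For $\hbar\in\mathbb{R}$, $(\mathcal{M}(E),\star_\hbar)$ is the unital Banach-$*$-algebra with $*$-operation $\mu^*(\Lambda)=\overline{\mu(-\Lambda)}$ and product $\mu\star_\hbar\nu(\Lambda)=\int_E d\mu(f)\int_E d\nu(g)\,e^{-\frac i2\hbar\sigma(f,g)}\,\mathbf 1_\Lambda(f+g)$ (defined by this formula on each $\mathcal{M}(E_\alpha)$ and extended $\|\cdot\|_1$-continuously); it is commutative for $\hbar=0$. Subspaces. $\mathcal{M}(E)_d$ (discrete measures) and $\mathcal{M}(E)_c$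 (continuous measures) are the $\|\cdot\|_1$-closures of $\bigcup_\alpha\mathcal{M}(E_\alpha)_d$ and of $\bigcup_\alpha\mathcal{M}(E_\alpha)_c$, where $\mathcal{M}(E_\alpha)_d$ are the discrete measures and $\mathcal{M}(E_\alpha)_c$ the continuous (i.e. atomless) measures on $E_\alpha$; $\mathcal{M}(E_\alpha)_a$ are the measures on $E_\alpha$ absolutely continuous with respect to Haar (Lebesgue) measure on $E_\alpha$; $\mathcal{M}(E)_{df}$ is the set of finite complex linear combinations of point measures $\delta(f)$, $f\in E$. Moments. For a semi-norm $\kappa$ on $E$ and $n\in\mathbb{N}\cup\{0,\infty\}$, $\mathcal{M}^n_\kappa(E):=\{\mu\in\mathcal{M}(E)\mid\int_E\kappa(f)^m\,d|\mu|(f)<\infty\text{ for all finite }0\le m\le n\}$; $\mu^m_\kappa\in\mathcal{M}(E)$ is given by $d\mu^m_\kappa(f)=\kappa(f)^m d\mu(f)$. For finite $n$, $\mathcal{M}^n_\kappa(E)$ carries the complete norm $\|\mu\|^n_\kappa:=\|\mu\|_1+\sum_{m=1}^n\|\mu^m_\kappa\|_1$ (so $\|\cdot\|^0_\kappa=\|\cdot\|_1$); $\mathcal{M}^\infty_\kappa(E)$ carries the Fréchet topology $\upsilon_\kappa$ given by all norms $\|\cdot\|^n_\kappa$, $n\in\mathbb{N}$. The constants are $c_n:=\max\{\binom nk\mid k=0,\dots,n\}$. A semi-norm $\eta$ is stronger than $\kappa$ if $\kappa\le k\,\eta$ for some constant $k\ge0$; $\kappa$ and $\eta$ are equivalent if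 $k_1\eta\le\kappa\le k_2\eta$ for some constants $0<k_1\le k_2$. A Poisson algebra is a commutative complex $*$-algebra $\mathcal{P}$ with a Poisson bracket, i.e. a bilinear map $\{\cdot,\cdot\}:\mathcal{P}\times\mathcal{P}\to\mathcal{P}$ which is anticommutative, real ($\{A,B\}^*=\{A^*,B^*\}$), and satisfies the Jacobi identity and the Leibniz rule $\{A,BC\}=\{A,B\}C+B\{A,C\}$. *)

(* Defs.v *)
From HB Require Import structures.
From mathcomp Require Import all_boot all_order all_algebra finmap.
From mathcomp.real_closed Require Import complex.
From mathcomp Require Import all_classical all_reals all_analysis.

Set Implicit Arguments.
Unset Strict Implicit.
Unset Printing Implicit Defensive.

Import Order.TTheory GRing.Theory Num.Theory.
Import numFieldNormedType.Exports.

Local Open Scope classical_set_scope.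
Local Open Scope ring_scope.

Section seminorms.
Context {R : realType} {E : lmodType R}.
Implicit Types kappa eta : E -> R.

Definition seminorm kappa :=
  [/\ forall x, 0 <= kappa x,
      forall x y, kappa (x + y) <= kappa x + kappa y &
      forall (a : R) x, kappa (a *: x) = `|a| * kappa x].

Definition stronger kappa eta :=
  exists2 k : R, 0 <= k & forall x, eta x <= k * kappa x.

Definition equivalent kappa eta :=
  exists k1 k2 : R, [/\ 0 < k1, k1 <= k2 &
    forall x, k1 * eta x <= kappa x <= k2 * eta x].

Definition fin_dim_subspace (F : set E) :=
  exists (n : nat) (b : 'I_n -> E),
    F = range (fun a : 'I_n -> R => \sum_(i < n) a i *: b i).

Definition infinite_dimensional := ~ fin_dim_subspace [set: E].

Definition pre_symplectic (sigma : E -> E -> R) :=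
  [/\ forall f, scalar (sigma f), forall g, scalar (sigma ^~ g),
      forall f g, sigma f g = - sigma g f &
      exists f g, sigma f g != 0].

End seminorms.

(* The finest locally convex topology: it is the locally convex topology
   generated by all semi-norms. [il_add_continuous], [il_scale_continuous] and
   [il_locally_convex] make it a locally convex topology, and [il_finest] says
   that it is finer than every locally convex topology, in the form that all
   linear maps into locally convex spaces are continuous. *)
Definition il (R : realType) (E : lmodType R) : Type := E.


Section il_topology.
Context {R : realType} {E : lmodType R}.
Implicit Types (x y : E) (kappa : E -> R).

Definition il_open : set_system (il E) := [set U | forall x, U x ->
  exists2 kappa : E -> R, seminorm kappa &
    forall y, kappa (y - x) < 1 -> U y].

Lemma seminorm0 : seminorm (fun _ : E => 0 : R).
Proof.
by split=> [x|x y|a x]; rewrite ?lexx// ?addr0// mulr0.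
Qed.

Lemma seminorm_max (p q : E -> R) : seminorm p -> seminorm q ->
  seminorm (fun x => Num.max (p x) (q x)).
Proof.
move=> [p0 pD pZ] [q0 qD qZ]; split=> [x|x y|a x].
- by rewrite le_max p0.
- rewrite ge_max; apply/andP; split.
    by rewrite (le_trans (pD _ _))// lerD// le_max lexx.
  by rewrite (le_trans (qD _ _))// lerD// le_max lexx orbT.
- by rewrite pZ qZ maxr_pMr.
Qed.

Lemma seminormZ (r : R) kappa : 0 <= r -> seminorm kappa ->
  seminorm (fun x => r * kappa x).
Proof.
move=> r0 [p0 pD pZ]; split=> [x|x y|a x]; first by rewrite mulr_ge0.
  by rewrite -mulrDr ler_wpM2l.
by rewrite pZ mulrCA.
Qed.

Lemma seminorm_0 kappa : seminorm kappa -> kappa 0 = 0.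
Proof. by case=> _ _ pZ; rewrite -(scale0r (0 : E)) pZ normr0 mul0r. Qed.

Lemma seminormN kappa x : seminorm kappa -> kappa (- x) = kappa x.
Proof. by case=> _ _ pZ; rewrite -scaleN1r pZ normrN1 mul1r. Qed.

Lemma il_openT : il_open setT.
Proof. by move=> x _; exists (fun=> 0) => //; exact: seminorm0. Qed.

Lemma il_openI : setI_closed il_open.
Proof.
move=> A B oA oB x [Ax Bx].
have [p np pA] := oA _ Ax; have [q nq qB] := oB _ Bx.
exists (fun x => Num.max (p x) (q x)); first exact: seminorm_max.
by move=> y; rewrite gt_max => /andP[py qy]; split; [exact: pA|exact: qB].
Qed.

Lemma il_open_bigU (I : Type) (f : I -> set (il E)) :
  (forall i, il_open (f i)) -> il_open (\bigcup_i f i).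
Proof.
move=> fo x [i _ fix_]; have [p np pf] := fo i x fix_.
by exists p => // y /pf fy; exists i.
Qed.

HB.instance Definition _ := GRing.Lmodule.on (il E).
HB.instance Definition _ := isPointed.Build (il E) (0 : E).
HB.instance Definition _ :=
  isOpenTopological.Build (il E) il_openT il_openI il_open_bigU.

Lemma il_openE : (open : set_system (il E)) = il_open.
Proof. by []. Qed.

Lemma il_ball_open kappa x (r : R) : seminorm kappa -> 0 < r ->
  open ([set y : E | kappa (y - x) < r] : set (il E)).
Proof.
move=> nk r0; have [k0 kD kZ] := nk; rewrite il_openE => y /= yr.
have d0 : 0 < r - kappa (y - x) by rewrite subr_gt0.
exists (fun z => (r - kappa (y - x))^-1 * kappa z).
  by apply: seminormZ => //; rewrite invr_ge0 ltW.
move=> z /=; rewrite mulrC ltr_pdivrMr// mul1r => zy.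
rewrite -(subrK y z) -addrA (le_lt_trans (kD _ _))//.
by rewrite -ltrBrDr.
Qed.

Lemma nbhs_ilP x (U : set E) : nbhs (x : il E) (U : set (il E)) <->
  exists2 kappa, seminorm kappa & forall y, kappa (y - x) < 1 -> U y.
Proof.
rewrite nbhsE; split=> [[V [oV Vx] VU]|[p np pU]].
  by have [p np pV] := oV _ Vx; exists p => // y /pV /VU.
exists [set y : E | p (y - x) < 1] => //; split; first exact: il_ball_open.
by rewrite /= subrr seminorm_0.
Qed.

Lemma il_add_continuous : continuous (fun z : il E * il E => z.1 + z.2).
Proof.
move=> [x y] U /nbhs_ilP [p np pU] /=; have [p0 pD pZ] := np.
exists ([set z : E | p (z - x) < 2^-1], [set z : E | p (z - y) < 2^-1]).
  split; apply: open_nbhs_nbhs; (split; first exact: il_ball_open);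
  by rewrite /= subrr seminorm_0.
move=> [a b] /= [ax b_y]; apply: pU; rewrite opprD addrACA.
by rewrite (le_lt_trans (pD _ _))// [ltRHS](splitr 1) mul1r ltrD.
Qed.

Lemma il_scale_continuous :
  continuous (fun z : R^o * il E => (z.1 *: z.2 : il E)).
Proof.
move=> [r x] U /nbhs_ilP [p np pU] /=; have [p0 pD pZ] := np.
pose K := `|r| + 1; have K0 : 0 < K by rewrite ltr_wpDl.
pose e := Num.min 1 (2^-1 / (p x + 1)).
have px0 : 0 < p x + 1 by rewrite ltr_wpDl.
have e0 : 0 < e by rewrite lt_min ltr01 divr_gt0.
exists ([set s : R | `|r - s| < e], [set z : E | p (z - x) < 2^-1 / K]).
  split.
    by rewrite -nbhs_ballE/=; exists e.
  apply: open_nbhs_nbhs; split.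
    by apply: il_ball_open => //; rewrite divr_gt0.
  by rewrite /= subrr seminorm_0// divr_gt0.
move=> [s y] /= [rs xy]; apply: pU.
have -> : s *: y - r *: x = s *: (y - x) + (s - r) *: x.
  by rewrite scalerBr scalerBl addrA subrK.
rewrite (le_lt_trans (pD _ _))// [ltRHS](splitr 1) mul1r ltr_leD// !pZ.
  rewrite -[ltRHS](divfK (lt0r_neq0 K0)) mulrC.
  have sK : `|s| <= K.
    rewrite -(subrK r s) addrC (le_trans (ler_normD _ _))// lerD2l.
    by rewrite distrC (le_trans (ltW rs))// ge_min lexx.
  by rewrite (le_lt_trans (ler_wpM2l (p0 _) sK))// ltr_pM2r.
rewrite distrC (le_trans (ler_wpM2r (p0 _) (ltW rs)))//.
rewrite (@le_trans _ _ (2^-1 / (p x + 1) * p x))//.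
  by rewrite ler_wpM2r// ge_min lexx orbT.
by rewrite mulrAC ler_pdivrMr// ler_pM2l// lerDl.
Qed.

Lemma il_locally_convex : exists2 B : set_system (il E),
  (forall b, b \in B -> convex_set b) & basis B.
Proof.
exists [set B | exists2 kappa, seminorm kappa & exists2 r : R, 0 < r &
    exists x, B = [set y : E | kappa (y - x) < r]].
  move=> _ /[!inE]/= -[p [p0 pD pZ] [r r0 [x ->]]].
  apply/convex_setW => y z; rewrite !inE/= => yr zr l l0 l1.
  rewrite inE /= /conv /=.
  rewrite -[X in p (X - x)]/(l%:num *: (y : E) + (1 - l%:num) *: (z : E)).
  set a := l%:num; set b := 1 - a.
  have a0 : 0 < a by [].
  have b0 : 0 < b by rewrite subr_gt0.
  have -> : (a *: (y : E) + b *: (z : E)) - x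
      = a *: ((y : E) - x) + b *: ((z : E) - x).
    rewrite !scalerBr addrACA -opprD -scalerDl.
    by rewrite /b [a + _]addrC subrK scale1r.
  rewrite (le_lt_trans (pD _ _))// !pZ !gtr0_norm//.
  have -> : r = a * r + b * r by rewrite -mulrDl /b [a + _]addrC subrK mul1r.
  by rewrite ltrD// ltr_pM2l.
split; first by move=> _ [p np [r r0 [x ->]]]; exact: il_ball_open.
move=> x U /nbhs_ilP [p np pU].
exists [set y : E | p (y - x) < 1]; last exact: pU.
split; first by exists p => //; exists 1 => //; exists x.
by rewrite /= subrr seminorm_0.
Qed.

HB.instance Definition _ := PreTopologicalLmod_isTvs.Build R (il E)
  il_add_continuous il_scale_continuous il_locally_convex.


Section gauge.
Variable W : set E.
Hypothesis convW : forall (y z : E) (t : R), W y -> W z -> 0 <= t -> t <= 1 ->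
  W (t *: y + (1 - t) *: z).
Hypothesis W0 : W 0.
Hypothesis WN : forall z, W z -> W (- z).
Hypothesis absW : forall z, exists2 t : R, 0 < t & W (t^-1 *: z).

Let S z : set R := [set t : R | 0 < t /\ W (t^-1 *: z)].
Let gauge z := inf (S z).

Let S_inf z : has_inf (S z).
Proof.
split; last by exists 0 => t [/ltW].
by have [t t0 Wt] := absW z; exists t.
Qed.

Let gauge_ge0 z : 0 <= gauge z.
Proof. by apply: lb_le_inf; [case: (S_inf z)|move=> t [/ltW]]. Qed.

Let gauge_le z t : S z t -> gauge z <= t.
Proof. by move=> St; apply: ge_inf => //; case: (S_inf z). Qed.

Let gaugeD y z : gauge (y + z) <= gauge y + gauge z.
Proof.
apply/ler_addgt0Pr => e e0.
have e2 : 0 < e / 2 by rewrite divr_gt0.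
have [s [s0 Ws] sy] := inf_adherent e2 (S_inf y).
have [t [t0 Wt] tz] := inf_adherent e2 (S_inf z).
have st0 : 0 < s + t by rewrite addr_gt0.
rewrite (@le_trans _ _ (s + t))//; last first.
  by rewrite [e]splitr addrACA ltW// ltrD.
apply: gauge_le; split => //.
have -> : (s + t)^-1 *: (y + z) =
    (s / (s + t)) *: (s^-1 *: y) + (1 - s / (s + t)) *: (t^-1 *: z).
  rewrite !scalerA scalerDr; congr (_ *: _ + _ *: _).
    by rewrite mulrAC divff ?mul1r// gt_eqF.
  rewrite -[X in X - _](@divff _ (s + t)) ?gt_eqF// -mulrBl [s + t]addrC addrK.
  by rewrite mulrAC divff ?mul1r// gt_eqF.
apply: convW => //; first by rewrite divr_ge0// ltW.
by rewrite ler_pdivrMr// mul1r lerDl ltW.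
Qed.

Let gaugeZ_le (a : R) z : gauge (a *: z) <= `|a| * gauge z.
Proof.
have [->|a0] := eqVneq a 0.
  rewrite scale0r normr0 mul0r; apply/ler_addgt0Pr => t t0; rewrite add0r.
  by apply: gauge_le; split => //; rewrite scaler0.
have na0 : 0 < `|a| by rewrite normr_gt0.
rewrite -ler_pdivrMl//; apply: lb_le_inf; first by case: (S_inf z).
move=> t [t0 Wt]; rewrite ler_pdivrMl//; apply: gauge_le; split.
  by rewrite mulr_gt0.
rewrite scalerA invfM mulrAC; have [a_ge0|a_lt0] := lerP 0 a.
  by rewrite ger0_norm// mulVf// mul1r.
by rewrite ltr0_norm// invrN mulNr mulVf// mulN1r scaleNr; exact: WN.
Qed.

Lemma gauge_seminorm : exists2 kappa : E -> R, seminorm kappa &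
  forall z, kappa z < 1 -> W z.
Proof.
exists gauge.
  split => // a z; apply/eqP; rewrite eq_le gaugeZ_le/=.
  have [->|a0] := eqVneq a 0; first by rewrite normr0 mul0r.
  rewrite -ler_pdivlMl ?normr_gt0// -normfV.
  by rewrite -[X in gauge X](scalerK a0); exact: gaugeZ_le.
move=> z z1; have e0 : 0 < 1 - gauge z by rewrite subr_gt0.
have [t [t0 Wt]] := inf_adherent e0 (S_inf z).
rewrite addrC subrK => t1.
have -> : z = t *: (t^-1 *: z) + (1 - t) *: 0.
  by rewrite scaler0 addr0 scalerA divff ?scale1r// gt_eqF.
by apply: convW => //; exact: ltW.
Qed.

End gauge.

Lemma il_finest (V : tvsType R) (f : {linear il E -> V}) : continuous f.
Proof.
move=> x U /= fxU.
have [B convB [oB basisB]] := @locally_convex R V.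
have [b [Bb bfx] bU] := basisB (f x) U fxU.
pose W : set E := [set z : E | b (f x + f z) /\ b (f x - f z)].
have fD (y z : E) : f (y + z) = f y + f z by exact: linearD.
have fZ (a : R) (z : E) : f (a *: z) = a *: f z by exact: linearZ_LR.
have cb (y z : V) (t : R) : b y -> b z -> 0 <= t -> t <= 1 ->
    b (t *: y + (1 - t) *: z).
  move=> yb zb t0 t1.
  have t01 : Itv.spec (@Itv.num_sem R) (Itv.Real `[0%Z, 1%Z]) t.
    by rewrite /= /Itv.num_sem/= in_itv/= t0 t1 realE t0.
  have bB : b \in B by rewrite inE.
  have := convB b bB y z (Itv.mk t01).
  by rewrite !inE; exact.
have absb (v : V) : exists2 t : R, 0 < t & b (f x + t *: v) /\ b (f x - t *: v).
  have nb : nbhs (f x) b.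
    by rewrite nbhsE; exists b => //; split => //; exact: oB.
  have cvgs (w : V) : (fun t : R^o => f x + t *: w) @ (0 : R^o) --> f x.
    have c1 : (fun t : R^o => t *: w) @ (0 : R^o) --> (0 : R^o) *: w.
      apply: (@cvg_comp _ _ _ (fun t : R^o => (t, w))
        (fun z : R^o * V => z.1 *: z.2) _ (nbhs ((0, w) : R^o * V))).
        by apply: (@cvg_pair _ _ _ _ (nbhs (0 : R^o)) (nbhs w));
          [exact: cvg_id|exact: cvg_cst].
      exact: (@scale_continuous R V (0, w)).
    rewrite -[X in _ --> X]addr0 -(scale0r w).
    apply: (@cvg_comp _ _ _ (fun t : R^o => (f x, t *: w))
      (fun z : V * V => z.1 + z.2) _ (nbhs ((f x, 0 *: w) : V * V))).
      by apply: (@cvg_pair _ _ _ _ (nbhs (f x)) (nbhs (0 *: w)));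
        [exact: cvg_cst|exact: c1].
    exact: (@add_continuous V (f x, 0 *: w)).
  have n1 := cvgs v _ nb; have n2 := cvgs (- v) _ nb.
  have : nbhs (0 : R^o) [set t : R^o | b (f x + t *: v) /\ b (f x + t *: - v)].
    exact: (@filterI _ (nbhs (0 : R^o)) _ [set t | b (f x + t *: v)]
      [set t | b (f x + t *: - v)] n1 n2).
  rewrite -nbhs_ballE => -[e /= e0 eb].
  have := eb (e / 2); rewrite /ball/= sub0r normrN gtr0_norm ?divr_gt0//.
  rewrite ltr_pdivrMr// ltr_pMr// ltr1n => /(_ isT)[b1 b2].
  by exists (e / 2); rewrite ?divr_gt0//; split => //; rewrite -scalerN.
have [|||z|kappa nk kW] := @gauge_seminorm W.
- move=> y z t [y1 y2] [z1 z2] t0 t1; rewrite /W/= fD !fZ.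
  have -> : f x = t *: f x + (1 - t) *: f x.
    by rewrite -scalerDl [t + _]addrC subrK scale1r.
  rewrite opprD addrACA [X in _ /\ b X]addrACA -!scalerBr -!scalerDr.
  by split; exact: cb.
- by rewrite /W/= -(scale0r (0 : E)) fZ scale0r addr0 subr0.
- by move=> z [z1 z2]; rewrite /W/= -scaleN1r fZ scaleN1r opprK.
- have [t t0 [b1 b2]] := absb (f z).
  by exists t^-1; rewrite ?invr_gt0// invrK /W/= fZ.
apply/nbhs_ilP; exists kappa => // y /kW [+ _] /=.
by rewrite -fD (addrC x) subrK => /bU.
Qed.

End il_topology.

Notation borel E := (g_sigma_algebraType (@open (il E))).

Section complex_measures.
Context {R : realType} {E : lmodType R}.
Implicit Types (mu nu : set (borel E) -> R[i]) (A L : set (borel E)).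

(* Countable additivity of a complex function amounts to that of its real and
   imaginary parts. A complex measure is extended by 0 to non-measurable sets,
   so that equality of complex measures is equality of functions. *)
Definition complex_measure mu :=
  [/\ forall A, ~ measurable A -> mu A = 0,
      mu set0 = 0,
      semi_sigma_additive (fun A => (complex.Re (mu A))%:E) &
      semi_sigma_additive (fun A => (complex.Im (mu A))%:E)].

Definition on_measurable mu : set (borel E) -> R[i] :=
  fun A => if `[< measurable A >] then mu A else 0.

Definition cvariation mu A : \bar R :=
  ereal_sup [set x | exists (n : nat) (F : 'I_n -> set (borel E)),
    [/\ forall i, measurable (F i), trivIset setT F, \bigcup_i F i = A &
        x = (\sum_(i < n) complex.Re `|mu (F i)|)%:E]].

Definition norm1 mu : \bar R := cvariation mu setT.

(* the upper variation of a signed measure, i.e. its positive part in the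
   Jordan decomposition *)
Definition upper_variation (nu : set (borel E) -> R) A : \bar R :=
  ereal_sup [set (nu B)%:E | B in [set B | measurable B /\ B `<=` A]].

Definition signed_integral (nu : set (borel E) -> R) (h : borel E -> R) : R :=
  fine (\int[upper_variation nu]_x (h x)%:E) -
  fine (\int[upper_variation (- nu)%R]_x (h x)%:E).

Definition cintegral mu (h : borel E -> R[i]) : R[i] :=
  let re_mu A := complex.Re (mu A) in let im_mu A := complex.Im (mu A) in
  let re_h x := complex.Re (h x) in let im_h x := complex.Im (h x) in
  ((signed_integral re_mu re_h - signed_integral im_mu im_h) +i*
   (signed_integral re_mu im_h + signed_integral im_mu re_h))%C.

(* integrability with respect to |mu|, for functions defined |mu|-almost
   everywhere *)
Definition cintegrable mu (h : borel E -> R[i]) :=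
  exists D : set (borel E), [/\ measurable D, cvariation mu (~` D) = 0%E,
    (cvariation mu).-integrable D (fun x => (complex.Re (h x))%:E) &
    (cvariation mu).-integrable D (fun x => (complex.Im (h x))%:E)].

Definition concentrated_on (F : set E) mu :=
  forall A, measurable A -> A `&` F = set0 -> mu A = 0.

(* The measures on the finite dimensional subspace [F], regarded as measures on
   [E]: [F] is closed in [il E], with its unique vector space topology as the
   subspace topology, so that the Borel sets of [F] are the traces of those of
   [E]. *)
Definition M_fin (F : set E) : set (set (borel E) -> R[i]) :=
  [set mu | complex_measure mu /\ concentrated_on F mu].

Definition M_fin_d (F : set E) : set (set (borel E) -> R[i]) :=
  [set mu | M_fin F mu /\ exists D : set E, [/\ countable D, D `<=` F &
    concentrated_on D mu]].

(* continuous measures are those without point masses *)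
Definition M_fin_c (F : set E) : set (set (borel E) -> R[i]) :=
  [set mu | M_fin F mu /\ forall x, mu [set x] = 0].

(* [lambda] is a Haar measure on [F], again regarded as a measure on [E] *)
Definition haar_measure (F : set E)
    (lambda : {measure set (borel E) -> \bar R}) :=
  [/\ forall A, measurable A -> A `&` F = set0 -> lambda A = 0%E,
      forall (x : E) A, F x -> measurable A ->
        lambda [set x + y | y in A] = lambda A,
      forall K : set (il E), compact K -> K `<=` F -> (lambda K < +oo)%E &
      (0 < lambda setT)%E].

Definition M_fin_a (F : set E) : set (set (borel E) -> R[i]) :=
  [set mu | M_fin F mu /\
    exists2 lambda : {measure set (borel E) -> \bar R}, haar_measure F lambda &
      forall A, measurable A -> lambda A = 0%E -> mu A = 0].

(* the [norm1]-closure, in the space of complex measures, of the union over the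
   finite dimensional subspaces [F] of the [X F] *)
Definition norm1_closure (X : set E -> set (set (borel E) -> R[i])) :
    set (set (borel E) -> R[i]) :=
  [set mu | complex_measure mu /\ forall e : R, 0 < e ->
    exists F nu, [/\ fin_dim_subspace F, X F nu & (norm1 (mu - nu)%R < e%:E)%E]].

Definition M_E := norm1_closure M_fin.
Definition M_E_d := norm1_closure M_fin_d.
Definition M_E_c := norm1_closure M_fin_c.

Definition M_E_df : set (set (borel E) -> R[i]) :=
  [set mu | exists s : seq (R[i] * E),
    mu = on_measurable (fun A => \sum_(p <- s) p.1 * \1_A p.2)].

Definition adjoint mu : set (borel E) -> R[i] :=
  fun A => ((mu [set - x | x in A])^*)%C.

End complex_measures.

Section moments.
Context {R : realType} {E : lmodType R}.
Implicit Types (mu nu : set (borel E) -> R[i]) (kappa : E -> R).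

(* In the sequel [Some n] stands for the natural number n and [None] for oo. *)
Definition M_moment kappa (n : option nat) : set (set (borel E) -> R[i]) :=
  [set mu | M_E mu /\ forall m : nat,
    (if n is Some n' then (m <= n')%N else true) ->
    (\int[cvariation mu]_f (kappa f ^+ m)%:E < +oo)%E].

Definition moment_measure kappa (m : nat) mu : set (borel E) -> R[i] :=
  on_measurable (fun A =>
    cintegral mu (fun f => (kappa f ^+ m)%:C%C * \1_A f)).

Definition norm_moment kappa (n : nat) mu : \bar R :=
  (norm1 mu + \sum_(1 <= m < n.+1) norm1 (moment_measure kappa m mu))%E.

(* The neighbourhoods of [mu] in [M_moment kappa n]: for finite n, those of the
   norm [norm_moment kappa n]; for n = oo, those of the topology of all norms
   [norm_moment kappa m] (these norms increase with m, hence the balls form a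
   base of neighbourhoods). *)
Definition moment_nbhs kappa (n : option nat) mu :
    set_system (set (borel E) -> R[i]) :=
  [set U | exists (m : nat) (e : R),
    [/\ (if n is Some n' then m = n' else True), 0 < e &
      forall nu, M_moment kappa n nu ->
        (norm_moment kappa m (nu - mu)%R < e%:E)%E -> U nu]].

End moments.

Section products.
Context {R : realType} {E : lmodType R} (sigma : E -> E -> R).
Implicit Types (mu nu rho : set (borel E) -> R[i]) (h : R).

Definition expi (t : R) : R[i] := (cos t +i* sin t)%C.

(* L |-> \int dmu(f) \int dnu(g) k(f, g) 1_L(f + g). For uncountable dimension
   of [E] the outer integrand need only be measurable |mu|-almost everywhere.
   This is harmless: the integral of a nonnegative function is the supremum of
   the integrals of the simple functions below it, which ignores null sets. *)
Definition twisted_convolution (k : E -> E -> R[i]) mu nu :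
    set (borel E) -> R[i] :=
  on_measurable (fun L =>
    cintegral mu (fun f => cintegral nu (fun g => k f g * \1_L (f + g : E)))).

Definition star_fin h := twisted_convolution
  (fun f g => expi (- (2^-1 * h * sigma f g))).

(* [rho] is the value at [(mu, nu)] of the norm1-continuous extension to [M_E]
   of [star_fin h] *)
Definition star_spec h mu nu rho :=
  M_E rho /\
  forall (F : nat -> set E) (mu_ nu_ : nat -> set (borel E) -> R[i]),
    (forall k, [/\ fin_dim_subspace (F k), M_fin (F k) (mu_ k) &
      M_fin (F k) (nu_ k)]) ->
    norm1 (mu_ k - mu) @[k --> \oo] --> 0%E ->
    norm1 (nu_ k - nu) @[k --> \oo] --> 0%E ->
    norm1 (star_fin h (mu_ k) (nu_ k) - rho) @[k --> \oo] --> 0%E.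

Definition star h mu nu : set (borel E) -> R[i] :=
  xget 0 [set rho | star_spec h mu nu rho].

Definition bracket0 := twisted_convolution (fun f g => (sigma f g)%:C%C).

Definition bracket0_integrable mu nu :=
  forall L : set (borel E), measurable L ->
    (forall f : E,
       cintegrable nu (fun g => (sigma f g)%:C%C * \1_L (f + g : E))) /\
    cintegrable mu (fun f =>
      cintegral nu (fun g => (sigma f g)%:C%C * \1_L (f + g : E))).

Definition bracket h mu nu : set (borel E) -> R[i] :=
  if h == 0 then bracket0 mu nu
  else ('i / h%:C)%C *: (star h mu nu - star h nu mu).

End products.

(* [(P, mul, br)] is a Poisson algebra, with *-operation [adj], where [P] is a
   subset of the complex vector space [V] *)
Definition poisson_algebra (R : rcfType) (V : lmodType R[i]) (P : set V)
    (mul : V -> V -> V) (adj : V -> V) (br : V -> V -> V) :=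
  [/\ [/\ P 0,
          forall (a : R[i]) x y, P x -> P y -> P (a *: x + y),
          forall x y, P x -> P y -> P (mul x y),
          forall x, P x -> P (adj x) &
          forall x y, P x -> P y -> P (br x y)],
      [/\ forall x y, P x -> P y -> mul x y = mul y x,
          forall x y z, P x -> P y -> P z ->
            mul x (mul y z) = mul (mul x y) z,
          forall (a : R[i]) x y z, P x -> P y -> P z ->
            mul (a *: x + y) z = a *: mul x z + mul y z &
          forall (a : R[i]) x y z, P x -> P y -> P z ->
            mul z (a *: x + y) = a *: mul z x + mul z y],
      [/\ forall (a : R[i]) x y, P x -> P y ->
            adj (a *: x + y) = a^*%C *: adj x + adj y,
          forall x, P x -> adj (adj x) = x &
          forall x y, P x -> P y -> adj (mul x y) = mul (adj y) (adj x)] &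
      [/\ (forall (a : R[i]) x y z, P x -> P y -> P z ->
             br (a *: x + y) z = a *: br x z + br y z) /\
          (forall (a : R[i]) x y z, P x -> P y -> P z ->
             br z (a *: x + y) = a *: br z x + br z y),
          forall x y, P x -> P y -> br x y = - br y x,
          forall x y, P x -> P y -> adj (br x y) = br (adj x) (adj y),
          forall x y z, P x -> P y -> P z ->
            br x (br y z) + br y (br z x) + br z (br x y) = 0 &
          forall x y z, P x -> P y -> P z ->
            br x (mul y z) = mul (br x y) z + mul y (br x z)]].

Section statement.
Context {R : realType} {E : lmodType R}.

Definition max_bin (n : nat) : nat := \max_(k < n.+1) 'C(n, k).

(* [(h, mu, nu) |-> bracket h mu nu] is a jointly continuous mapping
   R x M^n x M^n -> M^n' *)
Definition bracket_jointly_continuous (sigma : E -> E -> R) (kappa : E -> R)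
    (n n' : option nat) :=
  forall (h : R) mu nu, M_moment kappa n mu -> M_moment kappa n nu ->
    M_moment kappa n' (bracket sigma h mu nu) /\
    bracket sigma p.1 p.2.1 p.2.2
      @[p --> filter_prod (nbhs h)
                (filter_prod (moment_nbhs kappa n mu) (moment_nbhs kappa n nu))]
      --> moment_nbhs kappa n' (bracket sigma h mu nu).

Definition bracket0_jointly_continuous (sigma : E -> E -> R) (kappa : E -> R)
    (n n' : option nat) :=
  forall mu nu, M_moment kappa n mu -> M_moment kappa n nu ->
    M_moment kappa n' (bracket0 sigma mu nu) /\
    bracket0 sigma p.1 p.2
      @[p --> filter_prod (moment_nbhs kappa n mu) (moment_nbhs kappa n nu)]
      --> moment_nbhs kappa n' (bracket0 sigma mu nu).

Definition family_I (s : E -> R) (P : set (set (borel E) -> R[i])) :=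
  exists kappa : E -> R, [/\ seminorm kappa,
    stronger kappa s \/ equivalent kappa s & P = M_moment kappa None].

Definition family_II (s : E -> R) (P : set (set (borel E) -> R[i])) :=
  exists (B : choiceType) (kappa : B -> E -> R) (G : {fset B}) (c : B -> R),
    [/\ forall b, seminorm (kappa b), forall b, b \in G -> 0 < c b,
        forall f, s f <= \sum_(b <- G) c b * kappa b f &
        P = \bigcap_b M_moment (kappa b) None].

Definition family_III (s : E -> R) (P : set (set (borel E) -> R[i])) :=
  exists Q P' : set (set (borel E) -> R[i]),
    [/\ Q = M_E_d \/ Q = M_E_c \/
          (exists2 F : set E, fin_dim_subspace F & Q = M_fin_a F),
        family_I s P' \/ family_II s P' & P = Q `&` P'].

Definition family_IV (P : set (set (borel E) -> R[i])) := P = M_E_df.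

End statement.

(* Main.v *)
From HB Require Import structures.
Require Import Defs.
From mathcomp Require Import all_boot all_order all_algebra finmap.
From mathcomp.real_closed Require Import complex.
From mathcomp Require Import all_classical all_reals all_analysis.
From mathcomp Require Import measurable_realfun ring lra.

Set Implicit Arguments.
Unset Strict Implicit.
Unset Printing Implicit Defensive.

Import Order.TTheory GRing.Theory Num.Theory.
Import numFieldNormedType.Exports.

Local Open Scope classical_set_scope.
Local Open Scope ring_scope.

(* Every measure of [M_E] is carried by a countable increasing union of finite
   dimensional subspaces, on which addition and [sigma] are jointly measurable
   although they need not be so on [E * E].  Finitely many such measures have
   densities with respect to one finite measure [m], so iterated products become
   integrals over [m \x m] or [m \x (m \x m)], and the algebraic identities reduce
   by Fubini to pointwise identities of kernels in [sigma].  The bracket for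
   [hbar = h] has the kernel [2 / h * sin (h * sigma f g / 2)], which is bounded
   by [|sigma f g|] and tends to [sigma f g] as [h --> 0]: the moment bounds follow
   from the binomial formula, and joint continuity from bilinearity, these bounds
   and dominated convergence.  Products of discrete measures live on sums of
   countable supports; products of continuous or absolutely continuous measures
   inherit their null sets from translation invariance.  A Haar measure is
   constructed by induction on the dimension, as an iterated Lebesgue integral. *)

(** * Complex-valued integrals *)

(** Two choices shape the proof. First, every kernel is a function of [sigma f g]: the star product
    and all brackets are convolutions with kernels [psi (sigma f g)] of modulus at most
    [K * (s f ^+ j * s g ^+ j)], with [j = 0] for phases and [j = 1] for brackets, so that one
    theory of [conv psi] serves both. Second, exceptional null sets are avoided: points outside a
    carrier [V], where densities vanish, are sent to 0, so that representing maps take values in [V]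
    everywhere, and integrands are dominated at every point by products of integrable functions. A
    measure is represented as the image of a complex density under a map [X], rather than by a
    density on [E] itself, because a convolution is by nature the image of a product under addition.
    The price is that such a representation only bounds the total variation from above, since [X]
    may merge points and let phases cancel; as the moment estimates are upper bounds, this
    suffices. *)

Section complex_numbers.
Context {R : realType}.
Implicit Types z w : R[i].

(** The modulus as a real number: the norm of [R[i]] takes its values in [R[i]], while integrands
    must be real. *)
Definition nrm z : R := complex.Re `|z|.

Lemma nrmE z : `|z| = (nrm z)%:C%C.
Proof. by rewrite /nrm normc_def. Qed.

Lemma nrm_ge0 z : 0 <= nrm z.
Proof. by rewrite -lecR -nrmE; exact: normr_ge0. Qed.

Lemma nrm0 : nrm 0 = 0.
Proof. by rewrite /nrm normr0. Qed.

Lemma nrmM z w : nrm (z * w) = nrm z * nrm w.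
Proof. by apply: (@complexI R); rewrite rmorphM/= -!nrmE normrM. Qed.

Lemma nrmD z w : nrm (z + w) <= nrm z + nrm w.
Proof. by rewrite -lecR rmorphD/= -!nrmE ler_normD. Qed.

Lemma nrmN z : nrm (- z) = nrm z.
Proof. by rewrite /nrm normrN. Qed.

Lemma nrmJ z : nrm z^*%C = nrm z.
Proof. by rewrite /nrm normcJ. Qed.

Lemma nrm_real (x : R) : nrm x%:C%C = `|x|.
Proof. by rewrite /nrm normc_def/= expr0n addr0 sqrtr_sqr. Qed.

Lemma nrm_eq0 z : nrm z = 0 -> z = 0.
Proof. by move=> z0; apply/eqP; rewrite -normr_eq0 nrmE z0. Qed.

Lemma ler_Re z : `|complex.Re z| <= nrm z.
Proof. by rewrite -lecR -nrmE normc_ge_Re. Qed.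

Lemma nrm_sqr z : nrm z ^+ 2 = complex.Re z ^+ 2 + complex.Im z ^+ 2.
Proof. by rewrite /nrm normc_def/= sqr_sqrtr// addr_ge0// sqr_ge0. Qed.

Lemma ler_Im z : `|complex.Im z| <= nrm z.
Proof.
rewrite -(@ler_pXn2r _ 2)// ?nnegrE ?nrm_ge0//.
by rewrite nrm_sqr real_normK ?num_real// lerDr sqr_ge0.
Qed.

Lemma ler_nrm z : nrm z <= `|complex.Re z| + `|complex.Im z|.
Proof.
rewrite -(@ler_pXn2r _ 2)// ?nnegrE ?nrm_ge0// ?addr_ge0//.
rewrite nrm_sqr -(real_normK (num_real (complex.Re z))).
rewrite -(real_normK (num_real (complex.Im z))).
have := normr_ge0 (complex.Re z); have := normr_ge0 (complex.Im z); nra.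
Qed.

Lemma ReM z w : complex.Re (z * w) =
  complex.Re z * complex.Re w - complex.Im z * complex.Im w.
Proof. by case: z w => [? ?] [? ?]. Qed.

Lemma ImM z w : complex.Im (z * w) =
  complex.Re z * complex.Im w + complex.Im z * complex.Re w.
Proof. by case: z w => [? ?] [? ?]. Qed.

Lemma ReD z w : complex.Re (z + w) = complex.Re z + complex.Re w.
Proof. by case: z w => [? ?] [? ?]. Qed.

Lemma ImD z w : complex.Im (z + w) = complex.Im z + complex.Im w.
Proof. by case: z w => [? ?] [? ?]. Qed.

Lemma ReN z : complex.Re (- z) = - complex.Re z.
Proof. by case: z. Qed.

Lemma ImN z : complex.Im (- z) = - complex.Im z.
Proof. by case: z. Qed.

Lemma ReJ z : complex.Re z^*%C = complex.Re z.
Proof. by case: z. Qed.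

Lemma ImJ z : complex.Im z^*%C = - complex.Im z.
Proof. by case: z. Qed.

Lemma complex_eqP z w :
  complex.Re z = complex.Re w -> complex.Im z = complex.Im w -> z = w.
Proof. by case: z w => [? ?] [? ?] /= -> ->. Qed.

Lemma nrm1 : nrm 1 = 1.
Proof. by rewrite /nrm normr1. Qed.

Lemma nrm_indic (T : Type) (A : set T) (x : T) : nrm (\1_A x : R[i]) = \1_A x.
Proof. by rewrite !indicE; case: (_ \in _); rewrite ?nrm1 ?nrm0. Qed.

Lemma Re_indic (T : Type) (A : set T) (x : T) :
  complex.Re (\1_A x : R[i]) = \1_A x.
Proof. by rewrite !indicE; case: (_ \in _). Qed.

Lemma Im_indic (T : Type) (A : set T) (x : T) :
  complex.Im (\1_A x : R[i]) = 0.
Proof. by rewrite !indicE; case: (_ \in _). Qed.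

End complex_numbers.

Section complex_integral.
Context d (T : measurableType d) {R : realType}.
Implicit Types (P : {measure set T -> \bar R}) (f g : T -> R[i]).

Definition cmeasurable f :=
  measurable_fun setT (fun x => complex.Re (f x)) /\
  measurable_fun setT (fun x => complex.Im (f x)).

Definition cL1 P f :=
  cmeasurable f /\ P.-integrable setT (EFin \o (fun x => nrm (f x))).

Definition cint P f : R[i] :=
  ((\int[P]_x complex.Re (f x)) +i* (\int[P]_x complex.Im (f x)))%C.

Lemma cmeasurable_cst (c : R[i]) : cmeasurable (fun _ => c).
Proof. by split; exact: measurable_cst. Qed.

Lemma cmeasurableD f g : cmeasurable f -> cmeasurable g ->
  cmeasurable (fun x => f x + g x).
Proof.
move=> [f1 f2] [g1 g2]; split.
  by under eq_fun do rewrite ReD; exact: measurable_funD.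
by under eq_fun do rewrite ImD; exact: measurable_funD.
Qed.

Lemma cmeasurableM f g : cmeasurable f -> cmeasurable g ->
  cmeasurable (fun x => f x * g x).
Proof.
move=> [f1 f2] [g1 g2]; split.
  under eq_fun do rewrite ReM.
  by apply: measurable_funB; exact: measurable_funM.
under eq_fun do rewrite ImM.
by apply: measurable_funD; exact: measurable_funM.
Qed.

Lemma cmeasurableJ f : cmeasurable f -> cmeasurable (fun x => (f x)^*%C).
Proof.
move=> [f1 f2]; split; first by under eq_fun do rewrite ReJ.
by under eq_fun do rewrite ImJ; exact: measurableT_comp.
Qed.

Lemma cmeasurable_real (f : T -> R) : measurable_fun setT f ->
  cmeasurable (fun x => (f x)%:C%C).
Proof. by move=> mf; split => //; exact: measurable_cst. Qed.

Lemma cmeasurable_indic (A : set T) : measurable A ->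
  cmeasurable (\1_A : T -> R[i]).
Proof.
move=> mA; split.
  by under eq_fun do rewrite Re_indic; exact: measurable_indic.
by under eq_fun do rewrite Im_indic; exact: measurable_cst.
Qed.

Lemma measurable_nrm f : cmeasurable f -> measurable_fun setT (fun x => nrm (f x)).
Proof.
move=> [f1 f2].
rewrite (_ : (fun x => nrm (f x)) = (fun x =>
   Num.sqrt (complex.Re (f x) ^+ 2 + complex.Im (f x) ^+ 2))); last first.
  by apply/funext => x; rewrite /nrm normc_def.
apply: (@measurableT_comp _ _ _ _ _ _ (@Num.sqrt R)) => //.
  by apply: continuous_measurable_fun; exact: sqrt_continuous.
by apply: measurable_funD; exact: measurable_funX.
Qed.

Lemma cL1_dom P f (g : T -> R) : cmeasurable f ->
  P.-integrable setT (EFin \o g) -> (forall x, nrm (f x) <= g x) -> cL1 P f.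
Proof.
move=> mf ig fg; split => //.
apply: le_integrable ig => //.
  by apply/measurable_EFinP; exact: measurable_nrm.
move=> x _ /=; rewrite lee_fin ger0_norm ?nrm_ge0//.
by rewrite (le_trans (fg x))// ler_norm.
Qed.

Lemma cL1_Re P f : cL1 P f ->
  P.-integrable setT (EFin \o (fun x => complex.Re (f x))).
Proof.
move=> [[f1 _] nf]; apply: le_integrable nf => //; first exact/measurable_EFinP.
by move=> x _ /=; rewrite lee_fin [leRHS]ger0_norm ?nrm_ge0// ler_Re.
Qed.

Lemma cL1_Im P f : cL1 P f ->
  P.-integrable setT (EFin \o (fun x => complex.Im (f x))).
Proof.
move=> [[_ f1] nf]; apply: le_integrable nf => //; first exact/measurable_EFinP.
by move=> x _ /=; rewrite lee_fin [leRHS]ger0_norm ?nrm_ge0// ler_Im.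
Qed.

Lemma cL1D P f g : cL1 P f -> cL1 P g -> cL1 P (fun x => f x + g x).
Proof.
move=> [mf nf] [mg ng].
apply: (@cL1_dom _ _ (fun x => nrm (f x) + nrm (g x))).
- exact: cmeasurableD.
- exact: (integrableD _ nf ng).
- by move=> x; exact: nrmD.
Qed.

Lemma cL1Z P f (c : R[i]) : cL1 P f -> cL1 P (fun x => c * f x).
Proof.
move=> [mf nf].
apply: (@cL1_dom _ _ (fun x => nrm c * nrm (f x))).
- by apply: cmeasurableM => //; exact: cmeasurable_cst.
- exact: (integrableZl _ (nrm c) nf).
- by move=> x; rewrite nrmM.
Qed.

Lemma cL1M P f g (C : R) : cL1 P f -> cmeasurable g ->
  (forall x, nrm (g x) <= C) -> cL1 P (fun x => g x * f x).
Proof.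
move=> [mf nf] mg gC; apply: (@cL1_dom _ _ (fun x => C * nrm (f x))).
- exact: cmeasurableM.
- exact: (integrableZl _ C nf).
- by move=> x; rewrite nrmM ler_wpM2r// nrm_ge0.
Qed.

Lemma cL1_indic P f (A : set T) : cL1 P f -> measurable A ->
  cL1 P (fun x => \1_A x * f x).
Proof.
move=> Lf mA; apply: (@cL1M _ _ _ 1) => //; first exact: cmeasurable_indic.
by move=> x; rewrite nrm_indic indicE; case: (_ \in _).
Qed.

Lemma cintD P f g : cL1 P f -> cL1 P g ->
  cint P (fun x => f x + g x) = cint P f + cint P g.
Proof.
move=> Lf Lg; apply: complex_eqP; rewrite ?ReD ?ImD /=.
  under eq_Rintegral do rewrite ReD.
  by rewrite RintegralD//; exact: cL1_Re.
under eq_Rintegral do rewrite ImD.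
by rewrite RintegralD//; exact: cL1_Im.
Qed.

Lemma integrableZr_EFin P (k : R) (h : T -> R) :
  P.-integrable setT (EFin \o h) -> P.-integrable setT (EFin \o (fun x => k * h x)).
Proof. by move=> ih; exact: (integrableZl _ k ih). Qed.

Lemma cintZ P f (c : R[i]) : cL1 P f -> cint P (fun x => c * f x) = c * cint P f.
Proof.
move=> Lf; have [r i] := (cL1_Re Lf, cL1_Im Lf).
apply: complex_eqP; rewrite ?ReM ?ImM /=.
  under eq_Rintegral do rewrite ReM.
  by rewrite RintegralB ?RintegralZl//; exact: integrableZr_EFin.
under eq_Rintegral do rewrite ImM.
by rewrite RintegralD ?RintegralZl//; exact: integrableZr_EFin.
Qed.

Lemma eq_cint P f g : f =1 g -> cint P f = cint P g.
Proof. by move=> /funext ->. Qed.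

Lemma cint0 P : cint P (fun _ => 0) = 0.
Proof. by rewrite /cint /= Rintegral_cst//= mul0r. Qed.

Lemma cintJ P f : cL1 P f -> cint P (fun x => (f x)^*%C) = ((cint P f)^*)%C.
Proof.
move=> Lf; apply: complex_eqP; rewrite ?ReJ ?ImJ /=.
  by under eq_Rintegral do rewrite ReJ.
under eq_Rintegral do rewrite ImJ -mulN1r.
by rewrite RintegralZl ?mulN1r//; exact: cL1_Im.
Qed.

(** With [z] the integral, multiplying by its conjugate turns [nrm z ^+ 2] into the integral of a
    real part, which is bounded pointwise by [nrm z * nrm (f x)]; dividing by [nrm z] gives the
    claim. *)
Lemma ler_nrm_cint P f : cL1 P f -> nrm (cint P f) <= \int[P]_x nrm (f x).
Proof.
move=> Lf; set z := cint P f.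
have [z0|z0] := eqVneq (nrm z) 0.
  by rewrite z0 Rintegral_ge0// => x _; exact: nrm_ge0.
have zgt0 : 0 < nrm z by rewrite lt_neqAle eq_sym z0 nrm_ge0.
rewrite -(ler_pM2l zgt0).
have -> : nrm z * nrm z = complex.Re (z^*%C * z).
  by rewrite -expr2 nrm_sqr ReM ReJ ImJ mulNr opprK !expr2.
rewrite -RintegralZl//; last by case: Lf.
rewrite /z -cintZ// -/z /=; apply: le_Rintegral => //.
- exact/cL1_Re/cL1Z.
- by apply: integrableZr_EFin; case: Lf.
- move=> x _; rewrite (le_trans (ler_norm _))// (le_trans (ler_Re _))//.
  by rewrite nrmM -[X in _ <= X * _](nrmJ z).
Qed.

End complex_integral.

Section integral_set_functions.
Context d (T : measurableType d) {R : realType}.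
Local Open Scope ereal_scope.
Import HBNNSimple.

(* [integral] is meaningful for arbitrary set functions, and it only sees their
   values on measurable sets. *)
Lemma eq_setfun_integral (m1 m2 : set T -> \bar R) D (f : T -> \bar R) :
  (forall A, measurable A -> m1 A = m2 A) ->
  \int[m1]_(x in D) f x = \int[m2]_(x in D) f x.
Proof.
move=> m12; have sE (h : {nnsfun T >-> R}) : sintegral m1 h = sintegral m2 h.
  by rewrite /sintegral; apply: eq_fsbigr => x _; rewrite m12.
rewrite /integral; congr (ereal_sup _ - ereal_sup _); apply/seteqP.
  by split=> _ /= [h hf <-]; exists h.
by split=> _ /= [h hf <-]; exists h.
Qed.

(** The function [f] may fail to be measurable. The integral of a nonnegative function is a supremum
    over the simple functions below it, and cutting such a simple function off outside [D] does not
    change its integral. *)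
Lemma conull_integral (N : {measure set T -> \bar R}) (D : set T)
    (f : T -> \bar R) : measurable D -> N (~` D) = 0 ->
  \int[N]_x f x = \int[N]_x (f \_ D) x.
Proof.
move=> mD D0.
suff key (g : T -> \bar R) : (forall x, 0 <= g x) ->
    \int[N]_x g x = \int[N]_x (g \_ D) x.
  rewrite integralE [RHS]integralE; congr (_ - _); rewrite key ?funepos_restrict//.
  by rewrite funeneg_restrict.
move=> g0; rewrite !ge0_integralTE//; last first.
  by move=> x; exact: erestrict_ge0.
apply/eqP; rewrite eq_le; apply/andP; split; last first.
  apply: ge_ereal_sup => _ /= [h hg <-].
  apply: ereal_sup_ubound; exists h => // x.
  by rewrite (le_trans (hg x))// /patch; case: ifPn.
apply: ge_ereal_sup => _ /= [h hg <-].
apply: ereal_sup_ubound => /=; exists (proj_nnsfun h mD) => [x|].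
  rewrite /patch /= /mindic indicE; case: ifPn => xD; first by rewrite mulr1.
  by rewrite mulr0.
have mh : measurable_fun setT (EFin \o h) by exact/measurable_EFinP.
rewrite -!integralT_nnsfun.
rewrite (@ge0_negligible_integral _ _ _ N setT (~` D) (EFin \o h))//.
- rewrite setTD setCK [RHS]integral_mkcond; apply: eq_integral => x _ /=.
  rewrite /patch /= /mindic indicE; case: ifPn => xD; first by rewrite mulr1.
  by rewrite mulr0.
- exact: measurableC.
- by move=> x _ /=; rewrite lee_fin.
Qed.

End integral_set_functions.

(** * Image measures with a density *)

Section density.
Context d1 d2 (O : measurableType d1) (T : measurableType d2) {R : realType}.
Variables (P : {measure set O -> \bar R}) (X : O -> T) (g : O -> R).
Hypotheses (mX : measurable_fun setT X) (mg : measurable_fun setT g).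
Hypothesis g0 : forall w, (0 <= g w)%R.
Local Open Scope ereal_scope.
Import HBNNSimple.

Let mXA A : measurable A -> measurable (X @^-1` A).
Proof. by move=> mA; rewrite -[X in measurable X]setTI; exact: mX. Qed.

(** The image under [X] of the measure with density [g]. Total variations turn out to be measures of
    this kind, and Jordan parts are compared with them. *)
Lemma density_measure : exists N : {measure set T -> \bar R},
  forall A, N A = \int[P]_(w in X @^-1` A) (g w)%:E.
Proof.
pose N (A : set T) : \bar R := \int[P]_(w in X @^-1` A) (g w)%:E.
have N0 : N set0 = 0 by rewrite /N preimage_set0 integral_set0.
have Nge0 A : 0 <= N A by apply: integral_ge0 => w _; rewrite lee_fin.
have Nsa : semi_sigma_additive N.
  move=> F mF tF mUF; rewrite /N preimage_bigcup.
  apply: (@semi_sigma_additive_nng_induced _ _ _ P (EFin \o g)) => //.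
  - exact/measurable_EFinP.
  - by move=> n; exact: mXA.
  - apply/trivIsetP => i j _ _ ij; rewrite -preimage_setI.
    by move/trivIsetP : tF => ->//; rewrite preimage_set0.
  - by rewrite -preimage_bigcup; exact: mXA.
pose mN := isMeasure.Build _ _ _ N N0 Nge0 Nsa.
by exists (HB.pack_for {measure set T -> \bar R} N mN).
Qed.

(** Monotone convergence along simple approximations of [f] reduces the change of variables to the
    indicators of the fibres of a simple function. *)
Lemma density_integral (N : {measure set T -> \bar R}) (f : T -> \bar R) :
  (forall A, measurable A -> N A = \int[P]_(w in X @^-1` A) (g w)%:E) ->
  measurable_fun setT f -> (forall x, 0 <= f x) ->
  \int[N]_x f x = \int[P]_w (f (X w) * (g w)%:E).
Proof.
move=> NE mf f0; pose h := nnsfun_approx measurableT mf.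
have mgE : measurable_fun setT (EFin \o g) by exact/measurable_EFinP.
have hX n : measurable_fun setT (fun w => (h n (X w))%:E * (g w)%:E).
  apply: emeasurable_funM => //; apply/measurable_EFinP.
  exact: measurableT_comp.
have -> : \int[N]_x f x = limn (fun n => \int[N]_x (EFin \o h n) x).
  rewrite -monotone_convergence//.
  - apply: eq_integral => x _; apply/esym/cvg_lim => //.
    exact: cvg_nnsfun_approx.
  - by move=> n; exact/measurable_EFinP.
  - by move=> n x _ /=; rewrite lee_fin.
  - by move=> x _ a b ab; rewrite lee_fin; exact/lefP/nd_nnsfun_approx.
have -> : \int[P]_w (f (X w) * (g w)%:E) =
    limn (fun n => \int[P]_w ((h n (X w))%:E * (g w)%:E)).
  rewrite -monotone_convergence//.
  - apply: eq_integral => w _; apply/esym/cvg_lim => //; apply: cvgeZr => //.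
    exact: (@cvg_nnsfun_approx _ _ _ _ measurableT f mf).
  - by move=> n w _; rewrite mule_ge0// lee_fin.
  - move=> w _ a b ab; rewrite lee_wpmul2r ?lee_fin//.
    exact/lefP/nd_nnsfun_approx.
apply: congr_lim; apply/funext => n.
rewrite integralT_nnsfun sintegralE.
under [RHS]eq_integral => w _.
  rewrite fimfunE -EFinM mulrC mulr_fsumr -fsumEFin//; over.
rewrite ge0_integral_fsum//; first last.
- move=> y w _; rewrite lee_fin mulr_ge0//.
  by have := nnfun_muleindic_ge0 (h n) y (X w); rewrite lee_fin.
- move=> y; apply/measurable_EFinP; apply: measurable_funM => //.
  apply: measurable_funM => //.
  by apply: (@measurableT_comp _ _ _ _ _ _ (\1_(h n @^-1` [set y]) : T -> R)).
apply: eq_fsbigr => y /set_mem[x _ <-]; rewrite NE//.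
rewrite integral_mkcond -ge0_integralZl_EFin//.
- apply: eq_integral => w _; rewrite /patch /= indicE.
  rewrite [w \in _](_ : _ = (X w \in h n @^-1` [set h n x])) //.
  by case: ifPn => _; rewrite ?(mulr1, mulr0, mule0)// -EFinM mulrC.
- by move=> w _; apply: erestrict_ge0 => v _; rewrite lee_fin.
- by apply/(measurable_restrictT _ _).1; [exact/mXA|exact: measurable_funTS].
Qed.

End density.

(** * Fubini's theorem for complex functions dominated by products *)

Section complex_fubini.
Context d1 d2 (T1 : measurableType d1) (T2 : measurableType d2) {R : realType}.
Variables (P : {sigma_finite_measure set T1 -> \bar R})
  (Q : {sigma_finite_measure set T2 -> \bar R}).
Local Open Scope ereal_scope.

(** Tonelli's theorem gives measurability in the parameter for nonnegative integrands, hence the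
    split into positive and negative parts; infinite values are removed by [fine], which is
    measurable. *)
Lemma measurable_Rintegral_param (f : T1 * T2 -> R) : measurable_fun setT f ->
  measurable_fun setT (fun x => \int[Q]_y f (x, y))%R.
Proof.
move=> mf; apply: measurableT_comp => //.
have mF : measurable_fun setT (EFin \o f) by exact/measurable_EFinP.
rewrite [X in measurable_fun _ X](_ : _ =
    (fun x => \int[Q]_y (EFin \o f)^\+ (x, y) - \int[Q]_y (EFin \o f)^\- (x, y))).
  apply: emeasurable_funB.
  - apply: (measurable_fun_fubini_tonelli_F (EFin \o f)^\+) => //.
    exact: measurable_funepos.
  - apply: (measurable_fun_fubini_tonelli_F (EFin \o f)^\-) => //.
    exact: measurable_funeneg.
apply/funext => x.
by rewrite integralE; congr (_ - _); apply: eq_integral => y _;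
  rewrite ?funeposE ?funenegE.
Qed.

Lemma cmeasurable_cint_param (f : T1 * T2 -> R[i]) : cmeasurable f ->
  cmeasurable (fun x => cint Q (fun y => f (x, y))).
Proof.
move=> [f1 f2]; split.
  exact: (@measurable_Rintegral_param (fun z => complex.Re (f z))).
exact: (@measurable_Rintegral_param (fun z => complex.Im (f z))).
Qed.

Lemma integrable_prod (a : T1 -> R) (b : T2 -> R) :
  P.-integrable setT (EFin \o a) -> Q.-integrable setT (EFin \o b) ->
  (P \x Q).-integrable setT (EFin \o (fun z => a z.1 * b z.2)%R).
Proof.
move=> /integrableP[/measurable_EFinP ma ia] /integrableP[/measurable_EFinP mb ib].
apply/integrable12ltyP.
  apply/measurable_EFinP; apply: measurable_funM.
    exact: measurableT_comp.
  exact: measurableT_comp.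
have E x : \int[Q]_y `|(a x * b y)%:E| = `|a x|%:E * \int[Q]_y `|b y|%:E.
  under eq_integral do rewrite /= normrM EFinM.
  rewrite ge0_integralZl//.
  by apply/measurable_EFinP; exact: measurableT_comp.
under eq_integral do rewrite E.
rewrite ge0_integralZr//.
- by rewrite lte_mul_pinfty// ?integral_ge0// ge0_fin_numE// integral_ge0.
- by apply/measurable_EFinP; exact: measurableT_comp.
- exact: integral_ge0.
Qed.

Variables (a : T1 -> R) (b : T2 -> R) (f : T1 * T2 -> R[i]).
Hypothesis ia : P.-integrable setT (EFin \o a).
Hypothesis ib : Q.-integrable setT (EFin \o b).
Hypothesis mf : cmeasurable f.
Hypothesis fab : forall x y, (nrm (f (x, y)) <= a x * b y)%R.

Lemma cL1_prod : cL1 (P \x Q) f.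
Proof. by apply: (cL1_dom mf (integrable_prod ia ib)) => -[x y]; exact: fab. Qed.

Lemma cmeasurable_pair1 x : cmeasurable (fun y => f (x, y)).
Proof.
have [f1 f2] := mf.
by split; apply: (measurableT_comp (f := _ \o f)) => //; exact: measurable_pair1.
Qed.

Lemma cmeasurable_pair2 y : cmeasurable (fun x => f (x, y)).
Proof.
have [f1 f2] := mf.
by split; apply: (measurableT_comp (f := _ \o f)) => //; exact: measurable_pair2.
Qed.

(** The bound by [a x * b y] holds at every point, so every slice is integrable and not merely
    almost every one. *)
Lemma cL1_prod1 x : cL1 Q (fun y => f (x, y)).
Proof.
apply: (cL1_dom (cmeasurable_pair1 x) (integrableZr_EFin (a x) ib)).
exact: fab.
Qed.

Lemma cL1_prod2 y : cL1 P (fun x => f (x, y)).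
Proof.
apply: (cL1_dom (cmeasurable_pair2 y) (integrableZr_EFin (b y) ia)) => x.
by rewrite mulrC.
Qed.

Lemma cint_fubini1 :
  cint P (fun x => cint Q (fun y => f (x, y))) = cint (P \x Q) f.
Proof.
apply: complex_eqP => /=; congr fine.
  rewrite -integral12_prod_meas1; last exact/cL1_Re/cL1_prod.
  apply: eq_integral => x _ /=; rewrite /Rintegral fineK//.
  exact/integrable_fin_num/cL1_Re/cL1_prod1.
rewrite -integral12_prod_meas1; last exact/cL1_Im/cL1_prod.
apply: eq_integral => x _ /=; rewrite /Rintegral fineK//.
exact/integrable_fin_num/cL1_Im/cL1_prod1.
Qed.

Lemma cint_fubini2 :
  cint Q (fun y => cint P (fun x => f (x, y))) = cint (P \x Q) f.
Proof.
apply: complex_eqP => /=; congr fine.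
  rewrite -integral21_prod_meas1; last exact/cL1_Re/cL1_prod.
  apply: eq_integral => x _ /=; rewrite /Rintegral fineK//.
  exact/integrable_fin_num/cL1_Re/cL1_prod2.
rewrite -integral21_prod_meas1; last exact/cL1_Im/cL1_prod.
apply: eq_integral => x _ /=; rewrite /Rintegral fineK//.
exact/integrable_fin_num/cL1_Im/cL1_prod2.
Qed.

End complex_fubini.

(** * Complex Borel measures and their densities *)

Section jordan.
Context d (T : measurableType d) {R : realType}.
Local Open Scope ereal_scope.

Lemma jordan_measures (nu : {charge set T -> \bar R}) :
  exists (Up Um : {finite_measure set T -> \bar R}) (P N : set T),
  [/\ measurable P, measurable N,
      forall A, measurable A -> nu A = Up A - Um A,
      forall A, measurable A -> Up A = nu (A `&` P) &
      forall A, measurable A -> Um A = - nu (A `&` N)].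
Proof.
have [P [N nuPN]] := Hahn_decomposition nu.
have [[mP _] [mN _] _ _] := nuPN.
exists (jordan_pos nuPN), (jordan_neg nuPN), P, N; split => //.
- by move=> A mA; rewrite (jordan_decomp nuPN mA) /cadd/= cscaleN1.
- by move=> A mA; apply: (etrans (jordan_posE nuPN A));
  rewrite cjordan_posE /crestr0 mem_set.
- by move=> A mA; apply: (etrans (jordan_negE nuPN A));
  rewrite cjordan_negE /crestr0 mem_set.
Qed.

Definition charge_of (nu : set T -> R) :=
  (nu set0 = 0)%R /\ semi_sigma_additive (fun A => (nu A)%:E).

Lemma charge_ofP (nu : set T -> R) : charge_of nu ->
  exists nuc : {charge set T -> \bar R}, forall A, nuc A = (nu A)%:E.
Proof.
move=> [nu0 nus]; pose N A := (nu A)%:E.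
have N0 : N set0 = 0 by rewrite /N nu0.
have Nf : fin_num_fun N by [].
pose mN := isCharge.Build _ _ _ N N0 Nf nus.
by exists (HB.pack_for (charge T R) N mN).
Qed.

Lemma finite_measure_add (m1 m2 : {finite_measure set T -> \bar R}) :
  exists m : {finite_measure set T -> \bar R}, forall A, m A = m1 A + m2 A.
Proof.
have mf : fin_num_fun (measure_add m1 m2).
  by move=> A mA; rewrite measure_addE fin_numD !fin_num_measure.
pose mN := Measure_isFinite.Build _ _ _ _ mf.
exists (HB.pack_for {finite_measure set T -> \bar R}
  (measure_add m1 m2 : set T -> \bar R) (Measure.on (measure_add m1 m2)) mN).
by move=> A; exact: measure_addE.
Qed.

End jordan.

Section upper_variation.
Context {R : realType} {E : lmodType R}.
Local Open Scope ereal_scope.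

(** The supremum defining [upper_variation nu A] is attained at the intersection of [A] with the
    positive set [P] of a Hahn decomposition, and the one for [- nu] at the intersection with [N];
    on measurable sets both are therefore the Jordan parts. *)
Lemma upper_variation_jordan (nu : set (borel E) -> R) : charge_of nu ->
  exists (Up Um : {finite_measure set (borel E) -> \bar R}) (P N : set (borel E)),
  [/\ measurable P /\ measurable N,
      forall A, measurable A -> (nu A)%:E = Up A - Um A,
      forall A, measurable A ->
        Up A = (nu (A `&` P))%:E /\ Um A = - (nu (A `&` N))%:E,
      forall A, measurable A -> upper_variation nu A = Up A &
      forall A, measurable A -> upper_variation (- nu)%R A = Um A].
Proof.
move=> /charge_ofP[nuc nucE].
have [Up [Um [P [N [mP mN nuE UpE UmE]]]]] := jordan_measures nuc.
have fp A : measurable A -> Up A \is a fin_num by exact: fin_num_measure.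
have fm A : measurable A -> Um A \is a fin_num by exact: fin_num_measure.
exists Up, Um, P, N; split => //.
- by move=> A mA; rewrite -nucE nuE.
- by move=> A mA; rewrite -!nucE UpE// UmE.
- move=> A mA; apply/eqP; rewrite eq_le; apply/andP; split.
    apply: ge_ereal_sup => _ /= [B [mB BA] <-]; rewrite -nucE nuE//.
    rewrite (@le_trans _ _ (Up B))//.
      by rewrite leeBlDr ?fm// leeDl.
    by rewrite le_measure// inE.
  apply: ereal_sup_ubound; exists (A `&` P); last by rewrite UpE ?nucE.
  by split; [exact: measurableI|exact: subIsetl].
- move=> A mA; apply/eqP; rewrite eq_le; apply/andP; split.
    apply: ge_ereal_sup => _ /= [B [mB BA] <-].
    rewrite [(- nu)%R B](_ : _ = - nu B)%R// EFinN -nucE nuE//.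
    rewrite (@le_trans _ _ (Um B))//.
      by rewrite oppeB ?fin_num_adde_defr ?fp// addeC leeBlDr ?fp// leeDl.
    by rewrite le_measure// inE.
  apply: ereal_sup_ubound; exists (A `&` N); last by rewrite UmE// nucE.
  by split; [exact: measurableI|exact: subIsetl].
Qed.

End upper_variation.

Section signed_integral.
Context {R : realType} {E : lmodType R} d (O : measurableType d).
Variables (P : {measure set O -> \bar R}) (X : O -> borel E) (r : O -> R).
Hypothesis mX : measurable_fun setT X.
Hypothesis ir : P.-integrable setT (EFin \o r).
Variable nu : set (borel E) -> R.
Hypothesis nuE : forall A, measurable A -> nu A = \int[P]_w (\1_A (X w) * r w).
Hypothesis nuN : forall A, ~ measurable A -> nu A = 0.

Let mXA A : measurable A -> measurable (X @^-1` A).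
Proof. by move=> mA; rewrite -[X in measurable X]setTI; exact: mX. Qed.

Let mr : measurable_fun setT r.
Proof. by have /measurable_int/measurable_EFinP := ir. Qed.

Lemma Rintegral_indicM (f : O -> R) A : measurable A ->
  P.-integrable setT (EFin \o f) ->
  (\int[P]_w (\1_A (X w) * f w))%:E = (\int[P]_(w in X @^-1` A) (f w)%:E)%E.
Proof.
move=> mA iF; rewrite /Rintegral fineK.
  rewrite [RHS]integral_mkcond; apply: eq_integral => w _.
  rewrite /patch indicE [w \in _](_ : _ = (X w \in A))//.
  by case: ifPn => _; rewrite ?(mul1r, mul0r).
apply/integrable_fin_num => //.
apply: (le_integrable _ _ _ iF) => //.
  apply/measurable_EFinP; apply: measurable_funM.
    by apply: (measurableT_comp (f := \1_A : borel E -> R)) => //.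
  by have /measurable_int/measurable_EFinP := iF.
move=> w _ /=; rewrite lee_fin normrM indicE; case: (_ \in _).
  by rewrite normr1 mul1r.
by rewrite normr0 mul0r.
Qed.

Lemma charge_of_rep : charge_of nu.
Proof.
split; first by rewrite nuE// /Rintegral integral0_eq// => w _;
  rewrite indic0 mul0r.
move=> F mF tF mUF.
have -> : (fun n => \sum_(0 <= i < n) (nu (F i))%:E)%E =
    (fun n => \sum_(0 <= i < n) induced_charge ir (X @^-1` (F i)))%E.
  by apply/funext => n; apply: eq_bigr => i _; rewrite nuE// Rintegral_indicM.
rewrite nuE// Rintegral_indicM// preimage_bigcup.
apply: (charge_semi_sigma_additive (s := induced_charge ir)).
- by move=> n; exact: mXA.
- apply/trivIsetP => i j _ _ ij; rewrite -preimage_setI.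
  by move/trivIsetP : tF => ->//; rewrite preimage_set0.
- by rewrite -preimage_bigcup; exact: mXA.
Qed.

Let rp w := Num.max (r w) 0.
Let rm w := Num.max (- r w) 0.

Let mrp : measurable_fun setT rp.
Proof. by apply: measurable_maxr => //; exact: measurable_cst. Qed.

Let mrm : measurable_fun setT rm.
Proof.
apply: measurable_maxr; last exact: measurable_cst.
exact: measurable_funN.
Qed.

Let rE w : r w = rp w - rm w.
Proof. by rewrite /rp /rm; case: (lerP (r w) 0); case: (lerP (- r w) 0); lra. Qed.

Let rp0 w : 0 <= rp w. Proof. by rewrite /rp le_max lexx orbT. Qed.
Let rm0 w : 0 <= rm w. Proof. by rewrite /rm le_max lexx orbT. Qed.

Let rp_le w : rp w <= `|r w|.
Proof. by rewrite /rp ge_max ler_norm normr_ge0. Qed.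
Let rm_le w : rm w <= `|r w|.
Proof. by rewrite /rm ge_max -normrN ler_norm normr_ge0. Qed.

Let ibound (g h : O -> R) : measurable_fun setT g ->
  P.-integrable setT (EFin \o h) ->
  (forall w, `|g w| <= `|h w|) -> P.-integrable setT (EFin \o g).
Proof.
move=> mg ih gh; apply: le_integrable ih => //; first exact/measurable_EFinP.
by move=> w _ /=; rewrite lee_fin.
Qed.

(** The parts [rp] and [rm] of the density split [nu] into image measures [Np] and [Nm], which need
    not be the Jordan parts because [X] may send points of opposite sign to the same place. Both
    decompositions have the same difference, and the Jordan one is minimal, which makes its
    integrals finite. The set [D] contains the range of [X]; only on [D] is [phi] known to be
    measurable. *)
Lemma signed_integral_rep (phi : borel E -> R) (D : set (borel E)) :
  measurable D -> (forall w, D (X w)) ->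
  measurable_fun setT (fun x => \1_D x * phi x) ->
  P.-integrable setT (EFin \o (fun w => phi (X w) * r w)) ->
  signed_integral nu phi = \int[P]_w (phi (X w) * r w).
Proof.
move=> mD DX mphi iphi.
have [Up [Um [PP [NN [[mP mN] nuU UE upE umE]]]]] :=
  upper_variation_jordan charge_of_rep.
rewrite /signed_integral (eq_setfun_integral _ _ upE) (eq_setfun_integral _ _ umE).
(* Only [g] is Borel. Both Jordan parts vanish outside [D], so the integrals of [phi] and of [g]
   coincide. *)
pose g x := \1_D x * phi x.
have gX w : g (X w) = phi (X w) by rewrite /g indicE mem_set// mul1r.
have UD0 A : measurable A -> A `<=` ~` D -> nu A = 0.
  move=> mA AD; rewrite nuE// /Rintegral integral0_eq// => w _.
  rewrite indicE memNset ?mul0r// => /AD; apply; exact: DX.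
have mCD : measurable (~` D) by exact: measurableC.
have conull (U : {finite_measure set (borel E) -> \bar R}) :
    U (~` D) = 0%E -> (\int[U]_x (phi x)%:E = \int[U]_x (g x)%:E)%E.
  move=> U0; rewrite (conull_integral _ mD U0); apply: eq_integral => x _.
  rewrite /patch /g indicE; case: (x \in D); by rewrite ?(mul1r, mul0r).
rewrite !conull; last 2 first.
- rewrite (UE _ mCD).2 UD0 ?oppe0//; exact: measurableI.
- rewrite (UE _ mCD).1 UD0//; exact: measurableI.
have [Np NpE] := density_measure P mX mrp rp0.
have [Nm NmE] := density_measure P mX mrm rm0.
have irp : P.-integrable setT (EFin \o rp).
  by apply: (ibound mrp ir) => w; rewrite ger0_norm.
have irm : P.-integrable setT (EFin \o rm).
  by apply: (ibound mrm ir) => w; rewrite ger0_norm.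
(* The equality of differences is written with sums, which stay meaningful for the integrals against
   these measures before finiteness is known. *)
have measE A : measurable A -> (Up A + Nm A = Um A + Np A)%E.
  move=> mA; have : (nu A)%:E = (Np A - Nm A)%E.
    rewrite nuE// Rintegral_indicM// NpE NmE -integralB//=.
    - by apply: eq_integral => w _; rewrite -EFinB rE.
    - exact: mXA.
    - exact: (integrableS measurableT (mXA mA)).
    - exact: (integrableS measurableT (mXA mA)).
  have fU : Up A \is a fin_num by exact: fin_num_measure.
  have fV : Um A \is a fin_num by exact: fin_num_measure.
  have fNp : Np A \is a fin_num.
    rewrite NpE; apply: integrable_fin_num; first exact: mXA.
    exact: (integrableS measurableT (mXA mA)).
  have fNm : Nm A \is a fin_num.
    rewrite NmE; apply: integrable_fin_num; first exact: mXA.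
    exact: (integrableS measurableT (mXA mA)).
  rewrite nuU// -(fineK fU) -(fineK fV) -(fineK fNp) -(fineK fNm).
  rewrite -!EFinB -!EFinD => -[] h; congr EFin.
  lra.
have UpN A : measurable A -> (Up A <= Np A)%E.
  move=> mA; rewrite (UE _ mA).1 nuE ?Rintegral_indicM//; last 2 first.
  - exact: measurableI.
  - exact: measurableI.
  rewrite NpE (@le_trans _ _ (\int[P]_(w in X @^-1` (A `&` PP)) (rp w)%:E)%E)//.
    apply: le_integral => //.
    - by apply: mXA; exact: measurableI.
    - by apply: (integrableS measurableT) => //; apply: mXA; exact: measurableI.
    - by apply: (integrableS measurableT) => //; apply: mXA; exact: measurableI.
    - by move=> w _; rewrite lee_fin /rp le_max lexx.
  apply: ge0_subset_integral => //.
  - by apply: mXA; exact: measurableI.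
  - exact: mXA.
  - exact/measurable_EFinP/measurable_funTS.
  - by move=> w _; rewrite lee_fin.
  - by move=> w [].
have key (f : borel E -> R) : measurable_fun setT f -> (forall x, 0 <= f x) ->
    P.-integrable setT (EFin \o (fun w => f (X w) * r w)) ->
    [/\ (\int[Up]_x (f x)%:E)%E \is a fin_num,
        (\int[Um]_x (f x)%:E)%E \is a fin_num &
        fine (\int[Up]_x (f x)%:E)%E - fine (\int[Um]_x (f x)%:E)%E
          = \int[P]_w (f (X w) * r w)].
  move=> mf f0 ifr.
  have mfE : measurable_fun setT (EFin \o f) by exact/measurable_EFinP.
  have f0E x : (0%R <= (f x)%:E)%E by rewrite lee_fin.
  have mfX : measurable_fun setT (f \o X) by exact: measurableT_comp.
  have ip : P.-integrable setT (EFin \o (fun w => f (X w) * rp w)).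
    apply: (ibound _ ifr); first exact: measurable_funM.
    by move=> w; rewrite !normrM ler_wpM2l// (ger0_norm (rp0 _)).
  have im : P.-integrable setT (EFin \o (fun w => f (X w) * rm w)).
    apply: (ibound _ ifr); first exact: measurable_funM.
    by move=> w; rewrite !normrM ler_wpM2l// (ger0_norm (rm0 _)).
  have Ip : (\int[Np]_x (f x)%:E = \int[P]_w (f (X w) * rp w)%:E)%E.
    by rewrite (density_integral mX mrp rp0 (fun A _ => NpE A)).
  have Im : (\int[Nm]_x (f x)%:E = \int[P]_w (f (X w) * rm w)%:E)%E.
    by rewrite (density_integral mX mrm rm0 (fun A _ => NmE A)).
  have Ipf := integrable_fin_num measurableT ip.
  have Imf := integrable_fin_num measurableT im.
  have tot : (\int[Up]_x (f x)%:E + \int[Nm]_x (f x)%:E =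
      \int[Um]_x (f x)%:E + \int[Np]_x (f x)%:E)%E.
    rewrite -!ge0_integral_measure_add//; apply: eq_measure_integral => A mA _.
    exact: (etrans (measure_addE _ _ A)
      (etrans (measE A mA) (esym (measure_addE _ _ A)))).
  (* Finiteness passes from [Np] to [Up] by minimality, and then to [Um] through the equality of
     sums. *)
  have Upf : (\int[Up]_x (f x)%:E)%E \is a fin_num.
    rewrite ge0_fin_numE ?integral_ge0//.
    rewrite (@le_lt_trans _ _ (\int[Np]_x (f x)%:E)%E)//.
      exact: ge0_le_measure_integral.
    by rewrite Ip -ge0_fin_numE// integral_ge0// => w _; rewrite lee_fin mulr_ge0.
  have Umf : (\int[Um]_x (f x)%:E)%E \is a fin_num.
    have : (\int[Up]_x (f x)%:E + \int[Nm]_x (f x)%:E)%E \is a fin_num.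
      by rewrite fin_numD Upf Im.
    by rewrite tot fin_numD => /andP[].
  split => //; under eq_Rintegral do rewrite rE mulrBr.
  rewrite RintegralB// /Rintegral.
  move: tot; rewrite Ip Im -(fineK Upf) -(fineK Umf).
  move: (fine (integral Up _ _)) (fine (integral Um _ _)) => a b.
  rewrite -(fineK Ipf) -(fineK Imf) -!EFinD => -[] h.
  rewrite /= in h *; lra.
pose gp x := Num.max (g x) 0; pose gm x := Num.max (- g x) 0.
have mgp : measurable_fun setT gp by apply: measurable_maxr => //; exact: measurable_cst.
have mgm : measurable_fun setT gm.
  by apply: measurable_maxr; [exact: measurable_funN|exact: measurable_cst].
have gE x : g x = gp x - gm x.
  by rewrite /gp /gm; case: (lerP (g x) 0); case: (lerP (- g x) 0); lra.
have gp0 x : 0 <= gp x by rewrite /gp le_max lexx orbT.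
have gm0 x : 0 <= gm x by rewrite /gm le_max lexx orbT.
have igp : P.-integrable setT (EFin \o (fun w => gp (X w) * r w)).
  apply: (ibound _ iphi); first by apply: measurable_funM => //; exact: measurableT_comp.
  move=> w; rewrite !normrM ler_wpM2r// (ger0_norm (gp0 _)) -gX.
  by rewrite /gp ge_max ler_norm normr_ge0.
have igm : P.-integrable setT (EFin \o (fun w => gm (X w) * r w)).
  apply: (ibound _ iphi); first by apply: measurable_funM => //; exact: measurableT_comp.
  move=> w; rewrite !normrM ler_wpM2r// (ger0_norm (gm0 _)) -gX.
  by rewrite /gm ge_max -normrN ler_norm normr_ge0.
have [pp pm pE] := key gp mgp gp0 igp.
have [np nm nE] := key gm mgm gm0 igm.
have split (U : {finite_measure set (borel E) -> \bar R}) :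
    (\int[U]_x (gp x)%:E)%E \is a fin_num ->
    (\int[U]_x (gm x)%:E)%E \is a fin_num ->
    fine (\int[U]_x (g x)%:E)%E =
      fine (\int[U]_x (gp x)%:E)%E - fine (\int[U]_x (gm x)%:E)%E.
  move=> fp fm; rewrite integralE -fineB//; congr (fine (_ - _)%E).
    apply: eq_integral => x _; rewrite funeposE /gp.
    by rewrite -EFin_max.
  apply: eq_integral => x _; rewrite funenegE /gm.
  by rewrite -EFinN -EFin_max.
rewrite !split//.
under eq_Rintegral do rewrite -gX gE mulrBl.
rewrite RintegralB// -pE -nE; lra.
Qed.

End signed_integral.

Lemma cL1_cst d (T : measurableType d) (R : realType)
    (m : {finite_measure set T -> \bar R}) (c : R[i]) : cL1 m (fun _ => c).
Proof.
by split; [exact: cmeasurable_cst|exact: finite_measure_integrable_cst].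
Qed.

Section representation.
Context {R : realType} {E : lmodType R}.
Implicit Types (mu nu : set (borel E) -> R[i]).

(** [mu] is the image under [X] of the complex measure with density [u]. The last clause is the
    convention of extension by 0, thanks to which a representation determines [mu] as a function. *)
Definition rep d (O : measurableType d) (P : {measure set O -> \bar R})
    (X : O -> borel E) (u : O -> R[i]) mu :=
  [/\ measurable_fun setT X, cL1 P u,
      forall A, measurable A -> mu A = cint P (fun w => \1_A (X w) * u w) &
      forall A, ~ measurable A -> mu A = 0].

Lemma rep_preimage d (O : measurableType d) (P : {measure set O -> \bar R}) X u mu A :
  rep P X u mu -> measurable A -> measurable (X @^-1` A).
Proof. by move=> [mX _ _ _] mA; rewrite -[X in measurable X]setTI; exact: mX. Qed.

Lemma rep_Re d (O : measurableType d) (P : {measure set O -> \bar R}) X u mu :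
  rep P X u mu -> forall A, measurable A ->
  complex.Re (mu A) = \int[P]_w (\1_A (X w) * complex.Re (u w)).
Proof.
move=> [_ _ muE _] A mA; rewrite muE//=; apply: eq_Rintegral => w _.
by rewrite ReM Re_indic Im_indic mul0r subr0.
Qed.

Lemma rep_Im d (O : measurableType d) (P : {measure set O -> \bar R}) X u mu :
  rep P X u mu -> forall A, measurable A ->
  complex.Im (mu A) = \int[P]_w (\1_A (X w) * complex.Im (u w)).
Proof.
move=> [_ _ muE _] A mA; rewrite muE//=; apply: eq_Rintegral => w _.
by rewrite ImM Re_indic Im_indic mul0r addr0.
Qed.

Lemma rep_complex_measure d (O : measurableType d)
    (P : {measure set O -> \bar R}) X u mu :
  rep P X u mu -> complex_measure mu.
Proof.
move=> r; have [mX Lu muE mu0] := r.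
have [R0 Rs] := charge_of_rep mX (cL1_Re Lu) (rep_Re r).
have [I0 Is] := charge_of_rep mX (cL1_Im Lu) (rep_Im r).
by split => //; exact: complex_eqP.
Qed.

(** Identities between convolutions rest on this: once both sides are represented over the same
    space by the same map, only their densities have to be compared. *)
Lemma rep_uniq d (O : measurableType d) (P : {measure set O -> \bar R}) X u mu nu :
  rep P X u mu -> rep P X u nu -> mu = nu.
Proof.
move=> [_ _ muE mu0] [_ _ nuE nu0]; apply/funext => A.
by have [mA|mA] := pselect (measurable A); [rewrite muE// nuE|rewrite mu0// nu0].
Qed.

(** The complex integral consists of four signed real ones, each handled by [signed_integral_rep].
    The set [D] again admits functions [phi] that are Borel only on a set containing the range of
    [X]. *)
Lemma rep_cintegral d (O : measurableType d) (P : {measure set O -> \bar R})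
    X u mu (phi : borel E -> R[i]) (D : set (borel E)) :
  rep P X u mu -> measurable D -> (forall w, D (X w)) ->
  cmeasurable (fun x => \1_D x * phi x) ->
  cL1 P (fun w => phi (X w) * u w) ->
  cintegral mu phi = cint P (fun w => phi (X w) * u w).
Proof.
move=> r mD DX [mRe mIm] [[_ _] iN]; have [mX Lu _ _] := r.
have mRe' : measurable_fun setT (fun x => \1_D x * complex.Re (phi x)).
  apply: eq_measurable_fun mRe => x _ /=.
  by rewrite ReM Re_indic Im_indic mul0r subr0.
have mIm' : measurable_fun setT (fun x => \1_D x * complex.Im (phi x)).
  apply: eq_measurable_fun mIm => x _ /=.
  by rewrite ImM Re_indic Im_indic mul0r addr0.
have restr (g : borel E -> R) : measurable_fun setT (fun x => \1_D x * g x) ->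
    measurable_fun setT (fun w => g (X w)).
  move=> mg; rewrite (_ : (fun w => g (X w)) =
    (fun x => \1_D x * g x) \o X); first exact: measurableT_comp.
  by apply/funext => w /=; rewrite indicE mem_set// mul1r.
have bound (a b : R[i] -> R) :
    measurable_fun setT (fun w => a (phi (X w)) * b (u w)) ->
    (forall z, `|a z| <= nrm z) -> (forall z, `|b z| <= nrm z) ->
    P.-integrable setT (EFin \o (fun w => a (phi (X w)) * b (u w))).
  move=> mab aN bN; apply: le_integrable iN => //; first exact/measurable_EFinP.
  move=> w _ /=; rewrite lee_fin [leRHS]ger0_norm ?nrm_ge0// nrmM normrM.
  by rewrite ler_pM.
have [mu1 mu2] : measurable_fun setT (fun w => complex.Re (u w)) /\
    measurable_fun setT (fun w => complex.Im (u w)) by case: Lu.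
have irr : P.-integrable setT
    (EFin \o (fun w => complex.Re (phi (X w)) * complex.Re (u w))).
  exact: (bound (fun z => complex.Re z) (fun z => complex.Re z)
    (measurable_funM (restr _ mRe') mu1) (@ler_Re R) (@ler_Re R)).
have iri : P.-integrable setT
    (EFin \o (fun w => complex.Re (phi (X w)) * complex.Im (u w))).
  exact: (bound (fun z => complex.Re z) (fun z => complex.Im z)
    (measurable_funM (restr _ mRe') mu2) (@ler_Re R) (@ler_Im R)).
have iir : P.-integrable setT
    (EFin \o (fun w => complex.Im (phi (X w)) * complex.Re (u w))).
  exact: (bound (fun z => complex.Im z) (fun z => complex.Re z)
    (measurable_funM (restr _ mIm') mu1) (@ler_Im R) (@ler_Re R)).
have iii : P.-integrable setT
    (EFin \o (fun w => complex.Im (phi (X w)) * complex.Im (u w))).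
  exact: (bound (fun z => complex.Im z) (fun z => complex.Im z)
    (measurable_funM (restr _ mIm') mu2) (@ler_Im R) (@ler_Im R)).
rewrite /cintegral /=.
rewrite (signed_integral_rep mX (cL1_Re Lu) (rep_Re r) mD DX mRe' irr).
rewrite (signed_integral_rep mX (cL1_Im Lu) (rep_Im r) mD DX mIm' iii).
rewrite (signed_integral_rep mX (cL1_Re Lu) (rep_Re r) mD DX mIm' iir).
rewrite (signed_integral_rep mX (cL1_Im Lu) (rep_Im r) mD DX mRe' iri).
apply: complex_eqP => /=.
  by under [RHS]eq_Rintegral do rewrite ReM; rewrite RintegralB.
by under [RHS]eq_Rintegral do rewrite ImM; rewrite RintegralD// addrC.
Qed.

(** Absolute continuity of [mu] with respect to [m]. *)
Definition null_for (m : set (borel E) -> \bar R) mu :=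
  forall A, measurable A -> m A = 0%E -> mu A = 0.

Lemma complex_measure_dominated mu : complex_measure mu ->
  exists m : {finite_measure set (borel E) -> \bar R}, null_for m mu.
Proof.
move=> [_ mu0 Rs Is].
have R0 : complex.Re (mu set0) = 0 by rewrite mu0.
have I0 : complex.Im (mu set0) = 0 by rewrite mu0.
have [U1 [U2 [_ [_ [_ RE _ _ _]]]]] := upper_variation_jordan (conj R0 Rs).
have [U3 [U4 [_ [_ [_ IE _ _ _]]]]] := upper_variation_jordan (conj I0 Is).
have [m1 m1E] := finite_measure_add U1 U2.
have [m2 m2E] := finite_measure_add U3 U4.
have [m mE] := finite_measure_add m1 m2.
exists m => A mA /eqP; rewrite mE m1E m2E !padde_eq0 ?adde_ge0//.
move=> /andP[/andP[/eqP A1 /eqP A2] /andP[/eqP A3 /eqP A4]].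
apply: complex_eqP; first by have := RE A mA; rewrite A1 A2 subee// => -[].
by have := IE A mA; rewrite A3 A4 subee// => -[].
Qed.

Lemma charge_density (m : {finite_measure set (borel E) -> \bar R})
    (nu : set (borel E) -> R) : charge_of nu ->
  (forall A, measurable A -> m A = 0%E -> nu A = 0) ->
  exists2 r : borel E -> R, m.-integrable setT (EFin \o r) &
    forall A, measurable A -> (nu A)%:E = (\int[m]_(x in A) (r x)%:E)%E.
Proof.
move=> /charge_ofP[nuc nucE] mnu.
have dom : nuc `<< m.
  by apply/null_content_dominatesP => A mA A0; rewrite nucE mnu.
exists (fun x => fine (Radon_Nikodym nuc m x)).
  apply: eq_integrable (Radon_Nikodym_integrable dom) => // x _ /=.
  by rewrite fineK// Radon_Nikodym_fin_num.
move=> A mA; rewrite -nucE (Radon_Nikodym_integral dom mA).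
by apply: eq_integral => x _; rewrite fineK// Radon_Nikodym_fin_num.
Qed.

Lemma complex_measure_density (m : {finite_measure set (borel E) -> \bar R}) mu :
  complex_measure mu -> null_for m mu ->
  exists u, rep m (fun x => x) u mu.
Proof.
move=> [mu_n mu0 Rs Is] mmu.
have R0 : complex.Re (mu set0) = 0 by rewrite mu0.
have I0 : complex.Im (mu set0) = 0 by rewrite mu0.
have [|p ip pE] := charge_density (conj R0 Rs) (m := m).
  by move=> A mA A0; rewrite mmu.
have [|q iq qE] := charge_density (conj I0 Is) (m := m).
  by move=> A mA A0; rewrite mmu.
have mp : measurable_fun setT p by have /measurable_int/measurable_EFinP := ip.
have mq : measurable_fun setT q by have /measurable_int/measurable_EFinP := iq.
exists (fun x => (p x +i* q x)%C); split => //.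
  apply: (@cL1_dom _ _ _ _ _ (fun x => `|p x| + `|q x|)) => //.
    exact: (integrableD _ (integrable_norm ip) (integrable_norm iq)).
  by move=> x; exact: ler_nrm.
move=> A mA; apply: complex_eqP => /=.
  apply: EFin_inj; rewrite pE//; under eq_Rintegral do
    rewrite ReM Re_indic Im_indic mul0r subr0.
  by rewrite (Rintegral_indicM (X := fun x => x))//; exact: measurable_id.
apply: EFin_inj; rewrite qE//; under eq_Rintegral do
  rewrite ImM Re_indic Im_indic mul0r addr0.
by rewrite (Rintegral_indicM (X := fun x => x))//; exact: measurable_id.
Qed.

(** Multiplying by the indicator of [D] makes the density vanish at every point outside [D], so that
    those points can afterwards be moved at will. *)
Lemma rep_concentrated (m : {measure set (borel E) -> \bar R}) u mu
    (D : set (borel E)) :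
  rep m (fun x => x) u mu -> measurable D -> concentrated_on D mu ->
  rep m (fun x => x) (fun x => \1_D x * u x) mu.
Proof.
move=> [mX Lu muE mu0] mD cD; split => //; first exact: cL1_indic.
move=> A mA.
have mAD : measurable (A `&` D) by exact: measurableI.
have mAC : measurable (A `\` D) by exact: measurableD.
have indE (B : set (borel E)) : measurable B -> cL1 m (fun x => \1_B x * u x).
  by move=> mB; exact: cL1_indic.
rewrite muE//.
transitivity (cint m (fun w => \1_(A `&` D) w * u w + \1_(A `\` D) w * u w)).
  apply: eq_cint => w; rewrite -mulrDl; congr (_ * _).
  rewrite !indicE in_setI in_setD; case: (w \in A) => /=; last by rewrite addr0.
  by case: (w \in D); rewrite ?addr0 ?add0r.
rewrite cintD; [|exact: indE|exact: indE].
rewrite -[X in _ + X]muE// cD// ?addr0; last by rewrite setDE -setIA setICl setI0.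
apply: eq_cint => w; rewrite mulrA; congr (_ * _).
by rewrite !indicE in_setI; case: (w \in A); case: (w \in D); rewrite ?mulr1 ?mulr0 ?mul0r.
Qed.

(** Forces values into [D] at every point: composed with this map, functions that are Borel only on
    [D] become Borel on all of [E]. Integrals do not change as long as densities vanish off [D]. *)
Definition retract_to (D : set E) (x0 x : E) : E := if x \in D then x else x0.

Lemma retract_toP (D : set E) x0 : D x0 -> forall x, D (retract_to D x0 x).
Proof.
by move=> Dx0 x; rewrite /retract_to; case: ifPn => //; rewrite inE.
Qed.

Lemma measurable_retract_to (D : set (borel E)) x0 : measurable D ->
  measurable_fun setT (retract_to D x0 : borel E -> borel E).
Proof.
move=> mD; apply: (measurable_fun_if (D := setT)) => //.
apply: (measurable_fun_bool true); rewrite setTI (_ : _ @^-1` _ = D)//.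
by apply/seteqP; split => x /=; [move/set_mem|move/mem_set].
Qed.

Lemma rep_retract (m : {measure set (borel E) -> \bar R}) u mu (D : set (borel E)) x0 :
  rep m (fun x => x) u mu -> measurable D ->
  (forall x, ~ D x -> u x = 0) ->
  rep m (retract_to D x0) u mu.
Proof.
move=> [mX Lu muE mu0] mD uD; split => //; first exact: measurable_retract_to.
move=> A mA; rewrite muE//; apply: eq_cint => w.
rewrite /retract_to; case: ifPn => // /negP wD.
by rewrite uD ?mulr0// => Dw; apply: wD; exact: mem_set.
Qed.

Lemma complex_measure_rep (m : {finite_measure set (borel E) -> \bar R}) mu
    (D : set (borel E)) (x0 : E) :
  complex_measure mu -> null_for m mu -> measurable D -> concentrated_on D mu ->
  exists u, [/\ forall x, ~ D x -> u x = 0, rep m (fun x => x) u mu &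
    rep m (retract_to D x0) u mu].
Proof.
move=> cmu mmu mD cD; have [u ru] := complex_measure_density cmu mmu.
have u0 x : ~ D x -> \1_D x * u x = 0.
  by move=> nD; rewrite indicE memNset// mul0r.
exists (fun x => \1_D x * u x); split => //; first exact: rep_concentrated.
by apply: rep_retract => //; exact: rep_concentrated.
Qed.

End representation.

(** * Total variation and moments *)

Section variation.
Context {R : realType} {E : lmodType R}.
Implicit Types (mu nu : set (borel E) -> R[i]).
Local Open Scope ereal_scope.

(** Only exact finite partitions of [A] enter [cvariation], so the part of [A] missed by the given
    sets is added as one more cell. *)
Lemma cvariation_ub mu (F : nat -> set (borel E)) (A : set (borel E)) n :
  (forall i, measurable (F i)) -> measurable A -> (forall i, F i `<=` A) ->
  trivIset setT F ->
  (\sum_(i < n) nrm (mu (F i)))%:E <= cvariation mu A.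
Proof.
move=> mF mA FA tF.
pose B := A `\` \big[setU/set0]_(j < n) F j.
have mB : measurable B by apply: measurableD => //; exact: bigsetU_measurable.
pose G (i : 'I_n.+1) := if (i < n)%N then F i else B.
apply: (@le_trans _ _ (\sum_(i < n.+1) nrm (mu (G i)))%:E).
  rewrite lee_fin big_ord_recr/=.
  have -> : (\sum_(i < n) nrm (mu (F i)) =
      \sum_(i < n) nrm (mu (G (widen_ord (leqnSn n) i))))%R.
    by apply: eq_bigr => i _; rewrite /G/= ltn_ord.
  by rewrite lerDl nrm_ge0.
apply: ereal_sup_ubound; exists n.+1, G; split => //.
- by move=> i; rewrite /G; case: ifPn.
- apply/trivIsetP => i j _ _ ij; rewrite /G.
  have FB k : (k < n)%N -> F k `&` B = set0.
    move=> kn; rewrite /B setIDA; apply/seteqP; split=> [x [[Fx _]]|//].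
    by apply; rewrite -bigcup_mkord; exists k.
  have [ii|ii] := ltnP i n; have [jj|jj] := ltnP j n.
  + by move/trivIsetP : tF; apply.
  + exact: FB.
  + by rewrite setIC; exact: FB.
  + have := ltn_ord i; have := ltn_ord j; rewrite !ltnS => jn iin.
    by case/negP : ij; apply/eqP/val_inj/eqP; rewrite /= eqn_leq !(leq_trans _ ii, leq_trans _ jj)//.
- apply/seteqP; split=> [x [i _]|x Ax]; rewrite /G.
    by case: ifPn => _; [exact: FA|case].
  have [[i /= ni Fix_]|nF] := pselect ((\bigcup_(i < n) F i) x).
    by exists (widen_ord (leqnSn n) (Ordinal ni)) => //=; rewrite /G/= ni.
  exists ord_max => //; rewrite /G/= ltnn; split => //.
  by rewrite -bigcup_mkord.
Qed.

Lemma nrm_rep_le d (O : measurableType d) (P : {measure set O -> \bar R})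
    X u mu A : rep P X u mu -> measurable A ->
  (nrm (mu A))%:E <= \int[P]_(w in X @^-1` A) (nrm (u w))%:E.
Proof.
move=> r mA; have [mX Lu muE _] := r; have [_ iN] := Lu.
rewrite muE//.
have L1 : cL1 P (fun w => \1_A (X w) * u w)%R.
  apply: (cL1_indic Lu (A := X @^-1` A)); exact: (rep_preimage r).
apply: (@le_trans _ _ (\int[P]_w nrm (\1_A (X w) * u w))%:E).
  by rewrite lee_fin ler_nrm_cint.
rewrite -(Rintegral_indicM mX mA iN) lee_fin.
by under eq_Rintegral do rewrite nrmM nrm_indic.
Qed.

(** Equality can fail here, since [X] may identify points at which [u] has different phases. *)
Lemma cvariation_rep_le d (O : measurableType d) (P : {measure set O -> \bar R})
    X u mu A : rep P X u mu -> measurable A ->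
  cvariation mu A <= \int[P]_(w in X @^-1` A) (nrm (u w))%:E.
Proof.
move=> r mA; have [mX Lu muE _] := r.
have mN := measurable_nrm Lu.1.
have [N NE] := density_measure P mX mN (fun w => nrm_ge0 _).
apply: ge_ereal_sup => _ /= [n [F [mF tF FA ->]]].
rewrite -NE.
pose G i := if insub i is Some j then F j else set0 : set (borel E).
have GF (i : 'I_n) : G i = F i by rewrite /G valK.
have mG i : measurable (G i) by rewrite /G; case: insub.
have tG : trivIset setT G.
  apply/trivIsetP => i j _ _ ij; rewrite /G.
  case: insubP => [i' _ ii|_]; last by rewrite set0I.
  case: insubP => [j' _ jj|_]; last by rewrite setI0.
  by move/trivIsetP : tF; apply => //; apply: contra ij => /eqP e; rewrite -ii -jj e.
apply: (@le_trans _ _ (N (\big[setU/set0]_(i < n) G i))).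
  rewrite measure_bigsetU// -sumEFin; apply: lee_sum => i _.
  rewrite -GF; apply: (le_trans (nrm_rep_le r (mG i))).
  by rewrite le_eqVlt; apply/orP; left; apply/eqP; exact/esym/NE.
apply: le_measure; rewrite ?inE//; first exact: bigsetU_measurable.
by rewrite -FA -bigcup_mkord => x [i /= ni]; rewrite /G insubT => Fx; exists (Sub i ni).
Qed.

(** For the lower bound [A] is cut into countably many disjoint cells on which [u] stays within
    [2 * e] of a constant [c]. On a cell [D j], the value [mu (D j)] differs from [c] times
    [m (D j)] by at most [2 * e] times [m (D j)], so the integral of [nrm (u x)] exceeds
    [nrm (mu (D j))] by at most [4 * e] times [m (D j)]. In total this costs [4 * e * M]. *)
Lemma cvariation_density (m : {finite_measure set (borel E) -> \bar R}) u mu A :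
  rep m (fun x => x) u mu -> measurable A ->
  cvariation mu A = \int[m]_(x in A) (nrm (u x))%:E.
Proof.
move=> r mA; have [mX Lu muE _] := r; have [[mR mI] iN] := Lu.
have mN := measurable_nrm Lu.1.
apply/eqP; rewrite eq_le; apply/andP; split; first exact: cvariation_rep_le.
pose M := fine (m setT); have ME : m setT = M%:E by rewrite fineK// fin_num_measure.
have M0 : (0 <= M)%R by rewrite fine_ge0.
(* Chosen so that the total error [4 * e * M] is at most [e']; the summand 1 covers the case
   [M = 0]. *)
apply/lee_addgt0Pr => e' e'0; pose e := (e' / (4 * (M + 1)))%R.
have e0 : (0 < e)%R by rewrite divr_gt0// mulr_gt0// ltr_wpDl.
(* An enumeration of the points with rational coordinates; the default value of [odflt] is just one
   more such point. *)
pose pt (j : nat) : (rat * rat)%type :=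
  odflt (0%R, 0%R) (choice.unpickle j : option (rat * rat)%type).
pose B j : set (borel E) := A `&`
  ([set x | `|complex.Re (u x) - ratr (pt j).1| < e]%R `&`
   [set x | `|complex.Im (u x) - ratr (pt j).2| < e]%R).
have mB j : measurable (B j).
  have aux (f : borel E -> R) c : measurable_fun setT f ->
      measurable [set x | `|f x - c| < e]%R.
    move=> mf; rewrite -[X in measurable X]setTI.
    have : measurable_fun setT (fun x => `|f x - c|%R).
      by apply: measurableT_comp => //; apply: measurable_funB => //; exact: measurable_cst.
    move=> /(_ measurableT `]-oo, e[%classic (measurable_itv _)).
    by congr (measurable (_ `&` _)); apply/seteqP; split => x /=; rewrite in_itv.
  by apply: measurableI => //; apply: measurableI; exact: aux.
have BA : \bigcup_j B j = A.
  apply/seteqP; split=> [x [j _ []//]|x Ax].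
  have rat_near (y : R) : exists q : rat, (`|y - ratr q| < e)%R.
    have [|q] := @rat_in_itvoo R (y - e) (y + e); first by rewrite ltrBlDr -addrA ltrDl addr_gt0.
    by rewrite in_itv/= => qe; exists q; rewrite distrC ltr_distl.
  have [p pe] := rat_near (complex.Re (u x)).
  have [q qe] := rat_near (complex.Im (u x)).
  by exists (choice.pickle (p, q)) => //; split => //; rewrite /pt choice.pickleK.
pose D := seqDU B.
have mD j : measurable (D j).
  by apply: measurableD => //; exact: bigsetU_measurable.
have DB j : D j `<=` B j by move=> x [].
have tD : trivIset setT D by exact: trivIset_seqDU.
have DA : \bigcup_j D j = A by rewrite -seqDU_bigcup_eq.
have mNA (S : set (borel E)) : measurable_fun S (fun x => (nrm (u x))%:E).
  exact/measurable_funTS/measurable_EFinP.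
have piece j : \int[m]_(x in D j) (nrm (u x))%:E <=
    (nrm (mu (D j)))%:E + (4 * e)%:E * m (D j).
  pose c : R[i] := (ratr (pt j).1 +i* ratr (pt j).2)%C.
  have uc x : D j x -> (nrm (u x - c) <= 2 * e)%R.
    move=> /DB[_ [h1 h2]]; rewrite (le_trans (ler_nrm _))//.
    rewrite ReD ReN ImD ImN /= mulr_natl mulr2n.
    by apply: lerD; exact: ltW.
  pose M' := fine (m (D j)).
  have M'E : m (D j) = M'%:E by rewrite fineK// fin_num_measure.
  have Lc : cL1 m (fun _ => c).
    exact: cL1_cst.
  have cE : (cint m (fun x => \1_(D j) x * c) = M'%:C%C * c)%R.
    under eq_cint do rewrite mulrC.
    rewrite mulrC cintZ; last first.
      rewrite (_ : \1_(D j) = (fun x => \1_(D j) x * 1)%R).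
        by apply: cL1_indic => //; exact: cL1_cst.
      by apply/funext => x; rewrite mulr1.
    congr (_ * _)%R; apply: complex_eqP => /=.
      under eq_Rintegral do rewrite Re_indic.
      by rewrite /Rintegral integral_indic// setIT.
    by under eq_Rintegral do rewrite Im_indic; rewrite Rintegral_cst//= mul0r.
  have Lu1 : cL1 m (fun x => \1_(D j) x * u x)%R by exact: cL1_indic.
  have Lc1 : cL1 m (fun x => \1_(D j) x * c)%R by exact: cL1_indic.
  have h1 : (nrm (M'%:C%C * c - mu (D j)) <= 2 * e * M')%R.
    rewrite -cE muE// -mulN1r -cintZ// -cintD//; last exact: cL1Z.
    have L := cL1D Lc1 (cL1Z (-1)%R Lu1).
    rewrite (le_trans (ler_nrm_cint L))// -lee_fin.
    rewrite /Rintegral fineK; last by apply: integrable_fin_num => //; case: L.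
    apply: (@le_trans _ _ (\int[m]_x ((2 * e)%:E * (\1_(D j) x)%:E))).
      apply: ge0_le_integral => //.
      - by move=> x _; rewrite lee_fin nrm_ge0.
      - by apply/measurable_EFinP; apply: measurable_nrm; case: L.
      - by apply: measurable_funeM; exact/measurable_EFinP.
      move=> x _; rewrite -EFinM lee_fin mulN1r -mulrBr nrmM nrm_indic.
      rewrite indicE; have [xD|xD] := boolP (x \in D j); last by rewrite mul0r mulr0.
      rewrite mul1r mulr1 -nrmN opprB; apply: uc; exact: set_mem.
    rewrite ge0_integralZl_EFin//; last 2 first.
    - exact/measurable_EFinP.
    - by rewrite mulr_ge0// ltW.
    rewrite integral_indic// setIT.
    by have -> : (2 * e * M')%:E = (2 * e)%:E * m (D j) by rewrite M'E.
  have h2 : (nrm c * M' <= nrm (mu (D j)) + 2 * e * M')%R.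
    have -> : (nrm c * M' = nrm (M'%:C%C * c))%R.
      by rewrite nrmM nrm_real ger0_norm ?fine_ge0// mulrC.
    rewrite -[X in nrm X](subrK (mu (D j))) (le_trans (nrmD _ _))//.
    by rewrite addrC lerD2l.
  apply: (@le_trans _ _ (\int[m]_(x in D j) (cst (nrm c + 2 * e)%:E x))).
    apply: ge0_le_integral => //.
    - by move=> x _; rewrite lee_fin nrm_ge0.
    - move=> x Dx; rewrite lee_fin -[u x](subrK c) (le_trans (nrmD _ _))//.
      by rewrite addrC lerD2l uc.
  have -> : \int[m]_(x in D j) cst (nrm c + 2 * e)%:E x = ((nrm c + 2 * e) * M')%:E.
    by rewrite integral_cst// EFinM -M'E.
  rewrite M'E -EFinM -EFinD lee_fin.
  lra.
(* The series over the cells is bounded through its partial sums, because [cvariation] only sees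
   finite partitions. *)
rewrite -[in leLHS]DA ge0_integral_bigcup//; last first.
- by move=> x _; rewrite lee_fin nrm_ge0.
apply: lime_le.
  by apply: is_cvg_nneseries => n _ _; apply: integral_ge0 => x _; rewrite lee_fin nrm_ge0.
apply: nearW => n; rewrite big_mkord.
apply: (@le_trans _ _ (\sum_(i < n) ((nrm (mu (D i)))%:E + (4 * e)%:E * m (D i)))).
  by apply: lee_sum => i _; exact: piece.
rewrite big_split/= sumEFin; apply: leeD.
  by apply: cvariation_ub => // i x /DB[].
rewrite -ge0_sume_distrr//.
apply: (@le_trans _ _ ((4 * e)%:E * M%:E)).
  have e40 : (0 < (4 * e)%:E)%E by rewrite lte_fin; apply: mulr_gt0.
  rewrite lee_pmul2l//.
  by rewrite -measure_bigsetU// -ME; apply: le_measure; rewrite ?inE//; exact: bigsetU_measurable.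
rewrite -EFinM lee_fin /e (_ : _ * M = e' * (M / (M + 1)))%R; last first.
  by field; rewrite gt_eqF// ltr_wpDl.
by rewrite ger_pMr// ler_pdivrMr ?ltr_wpDl// mul1r lerDl.
Qed.

Lemma cvariation_integral (m : {finite_measure set (borel E) -> \bar R}) u mu
    (phi : borel E -> \bar R) :
  rep m (fun x => x) u mu -> measurable_fun setT phi -> (forall x, 0 <= phi x) ->
  \int[cvariation mu]_x phi x = \int[m]_x (phi x * (nrm (u x))%:E).
Proof.
move=> r mphi phi0; have [mX Lu _ _] := r.
have [N NE] := density_measure m mX (measurable_nrm Lu.1) (fun w => nrm_ge0 _).
have vN A : measurable A -> cvariation mu A = N A.
  by move=> mA; rewrite (cvariation_density r mA); exact/esym/NE.
rewrite (eq_setfun_integral _ _ vN).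
exact: (density_integral mX (measurable_nrm Lu.1) (fun w => nrm_ge0 _)
  (fun A _ => NE A)).
Qed.

(** The variation is recognised as a measure through a density of [mu] over a measure on [E] itself.
    With such a density [v] it becomes [V], which lies below the image measure [N] on every
    measurable set. *)
Lemma cvariation_integral_le d (O : measurableType d)
    (P : {measure set O -> \bar R}) X u mu (phi : borel E -> \bar R) :
  rep P X u mu -> measurable_fun setT phi -> (forall x, 0 <= phi x) ->
  \int[cvariation mu]_x phi x <= \int[P]_w (phi (X w) * (nrm (u w))%:E).
Proof.
move=> r mphi phi0; have [mX Lu _ _] := r.
have cmu := rep_complex_measure r.
have [m mmu] := complex_measure_dominated cmu.
have [v rv] := complex_measure_density cmu mmu; have [mI Lv _ _] := rv.
have [N NE] := density_measure P mX (measurable_nrm Lu.1) (fun w => nrm_ge0 _).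
have [V VE] := density_measure m mI (measurable_nrm Lv.1) (fun w => nrm_ge0 _).
have vV A : measurable A -> cvariation mu A = V A.
  by move=> mA; rewrite (cvariation_density rv mA); exact/esym/VE.
have VN A : measurable A -> V A <= N A.
  move=> mA; rewrite -vV//; apply: (le_trans (cvariation_rep_le r mA)).
  by rewrite le_eqVlt; apply/orP; left; apply/eqP; exact/esym/NE.
rewrite (eq_setfun_integral _ _ vV).
rewrite -(density_integral mX (measurable_nrm Lu.1) (fun w => nrm_ge0 _)
  (fun A _ => NE A) mphi phi0).
exact: ge0_le_measure_integral.
Qed.

Lemma cvariation_concentrated mu (D : set (borel E)) : complex_measure mu ->
  measurable D -> concentrated_on D mu -> cvariation mu (~` D) = 0.
Proof.
move=> cmu mD cD; have [m mmu] := complex_measure_dominated cmu.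
have [u [u0 r _]] := complex_measure_rep 0%R cmu mmu mD cD.
rewrite (cvariation_density r); last exact: measurableC.
by apply: integral0_eq => x nD; rewrite u0// nrm0.
Qed.

Lemma nrm_cvariation mu A : measurable A -> (nrm (mu A))%:E <= cvariation mu A.
Proof.
move=> mA; apply: ereal_sup_ubound; exists 1%N, (fun _ => A); split => //.
- by apply/trivIsetP => i j _ _; rewrite !ord1 eqxx.
- by apply/seteqP; split=> [x [i _]//|x Ax]; exists ord0.
- by rewrite big_ord1.
Qed.

Lemma le_cvariation mu (A B : set (borel E)) : measurable A -> measurable B -> A `<=` B ->
  cvariation mu A <= cvariation mu B.
Proof.
move=> mA mB AB; apply: ge_ereal_sup => _ /= [n [F [mF tF FA ->]]].
pose G i := if insub i is Some j then F j else set0 : set (borel E).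
have -> : (\sum_(i < n) complex.Re `|mu (F i)| = \sum_(i < n) nrm (mu (G i)))%R.
  by apply: eq_bigr => i _; rewrite /G valK.
apply: cvariation_ub => //.
- by move=> i; rewrite /G; case: insub.
- move=> i x; rewrite /G; case: insub => // j Fx; apply: AB; rewrite -FA.
  by exists j.
apply/trivIsetP => i j _ _ ij; rewrite /G.
case: insubP => [i' _ ii|_]; last by rewrite set0I.
case: insubP => [j' _ jj|_]; last by rewrite setI0.
by move/trivIsetP : tF; apply => //; apply: contra ij => /eqP e; rewrite -ii -jj e.
Qed.

Lemma moment_measure_rep (kappa : E -> R) k mu
    (m : {finite_measure set (borel E) -> \bar R}) u :
  measurable_fun setT (kappa : borel E -> R) ->
  (forall x, 0 <= kappa x)%R -> rep m (fun x => x) u mu ->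
  \int[cvariation mu]_x (kappa x ^+ k)%:E < +oo ->
  rep m (fun x => x) (fun x => (kappa x ^+ k)%:C%C * u x)%R (moment_measure kappa k mu).
Proof.
move=> mk k0 r fin; have [mX Lu muE mu0] := r.
have mkk : measurable_fun setT (fun x : borel E => kappa x ^+ k)%R.
  exact: measurable_funX.
have ckk : cmeasurable (fun x : borel E => (kappa x ^+ k)%:C%C : R[i]).
  exact: cmeasurable_real.
have Lk : cL1 m (fun x => (kappa x ^+ k)%:C%C * u x)%R.
  split; first by apply: cmeasurableM => //; case: Lu.
  apply/integrableP; split.
    apply/measurable_EFinP; apply: measurable_nrm; apply: cmeasurableM => //.
    by case: Lu.
  rewrite (cvariation_integral r) in fin; last 2 first.
  - exact/measurable_EFinP.
  - by move=> x; rewrite lee_fin exprn_ge0.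
  apply: le_lt_trans fin; rewrite le_eqVlt; apply/orP; left; apply/eqP.
  apply: eq_integral => x _ /=; rewrite ger0_norm ?nrm_ge0// nrmM nrm_real.
  by rewrite ger0_norm ?exprn_ge0.
split => // A mA; rewrite /moment_measure /on_measurable; last by rewrite asboolF.
rewrite asboolT//.
rewrite (rep_cintegral (D := setT) r) //.
- by apply: eq_cint => x; rewrite [RHS]mulrCA mulrA.
- under eq_fun do rewrite indicE in_setT mul1r.
  by apply: cmeasurableM => //; exact: cmeasurable_indic.
- under eq_fun do rewrite mulrAC mulrC.
  exact: cL1_indic.
Qed.

Lemma norm1_moment_measure (kappa : E -> R) k mu :
  measurable_fun setT (kappa : borel E -> R) ->
  (forall x, 0 <= kappa x)%R -> complex_measure mu ->
  \int[cvariation mu]_x (kappa x ^+ k)%:E < +oo ->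
  norm1 (moment_measure kappa k mu) = \int[cvariation mu]_x (kappa x ^+ k)%:E.
Proof.
move=> mk k0 cmu fin.
have [m mmu] := complex_measure_dominated cmu.
have [u r] := complex_measure_density cmu mmu.
have mkk : measurable_fun setT (fun x : borel E => kappa x ^+ k)%R.
  exact: measurable_funX.
rewrite /norm1 (cvariation_density (moment_measure_rep mk k0 r fin))//.
rewrite (cvariation_integral r)//; last 2 first.
- exact/measurable_EFinP.
- by move=> x; rewrite lee_fin exprn_ge0.
by apply: eq_integral => x _; rewrite nrmM nrm_real ger0_norm ?exprn_ge0.
Qed.

Lemma norm1_integral mu : complex_measure mu ->
  norm1 mu = \int[cvariation mu]_x (cst 1%R x)%:E.
Proof.
move=> cmu; have [m mmu] := complex_measure_dominated cmu.
have [u r] := complex_measure_density cmu mmu.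
rewrite (cvariation_integral r)//; last exact/measurable_EFinP.
by rewrite /norm1 (cvariation_density r)//; apply: eq_integral => x _; rewrite mul1e.
Qed.

Lemma norm1_lty mu : complex_measure mu -> norm1 mu < +oo.
Proof.
move=> cmu; have [m mmu] := complex_measure_dominated cmu.
have [u r] := complex_measure_density cmu mmu.
rewrite /norm1 (cvariation_density r)//; have [_ [_ i] _ _] := r.
move/integrableP : i => [_]; apply: le_lt_trans.
rewrite le_eqVlt; apply/orP; left; apply/eqP.
by apply: eq_integral => x _ /=; rewrite ger0_norm// nrm_ge0.
Qed.

End variation.

(** * Finite dimensional subspaces *)

Section linear_functionals.
Context {R : realType} {E : lmodType R}.
Implicit Types (x y z : E) (F G V W : set E).

Lemma scalar0 (phi : E -> R) : scalar phi -> phi 0 = 0.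
Proof. by move=> lp; have := lp (-1) 0 0; rewrite scaler0 addr0 mulN1r addNr. Qed.

Lemma scalarD (phi : E -> R) x y : scalar phi -> phi (x + y) = phi x + phi y.
Proof. by move=> lp; have := lp 1 x y; rewrite scale1r mul1r. Qed.

Lemma scalarZ (phi : E -> R) a x : scalar phi -> phi (a *: x) = a * phi x.
Proof. by move=> lp; have := lp a x 0; rewrite addr0 scalar0// addr0. Qed.

Lemma scalarB (phi : E -> R) x y : scalar phi -> phi (x - y) = phi x - phi y.
Proof. by move=> lp; rewrite scalarD// -scaleN1r scalarZ// mulN1r. Qed.

Lemma scalar_sum (phi : E -> R) n (a : nat -> R) (b : nat -> E) :
  scalar phi -> phi (\sum_(i < n) a i *: b i) = \sum_(i < n) a i * phi (b i).
Proof.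
move=> lp; elim: n => [|n IH]; first by rewrite !big_ord0 scalar0.
by rewrite !big_ord_recr/= scalarD// IH scalarZ.
Qed.

(* A maximal subspace avoiding [b] is a hyperplane not containing [b]. *)
Lemma separating_functional (b : E) : b != 0 ->
  exists2 psi : E -> R, scalar psi & psi b = 1.
Proof.
move=> b0.
pose P := [set M : set E | (forall a x y, M x -> M y -> M (a *: x + y)) /\ ~ M b].
have [|A [[Alin Ab] Amax]] := @Zorn_bigcup E P.
  move=> F FP tF; split=> [a x y [M FM Mx] [N FN Ny]|[M FM Mb]]; last first.
    by have [_] := FP _ FM; exact.
  have [MN|NM] := tF _ _ FM FN.
    by exists N => //; have [Nl _] := FP _ FN; apply: Nl => //; exact: MN.
  by exists M => //; have [Ml _] := FP _ FM; apply: Ml => //; exact: NM.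
(* The empty set also belongs to [P], so 0 lies in [A] only by maximality: otherwise [A] would be
   empty and properly contained in the admissible set consisting of 0. *)
have A0 : A 0.
  apply: contrapT => nA0; apply: (Amax [set 0]).
    split=> [x Ax|]; last by move=> /(_ 0 erefl).
    by exfalso; apply: nA0; rewrite -(addNr x) -scaleN1r; exact: Alin.
  split=> [a x y -> ->|/=]; first by rewrite scaler0 addr0.
  exact/eqP.
have AD x y : A x -> A y -> A (x + y).
  by move=> Ax Ay; rewrite -[x]scale1r; exact: Alin.
have AZ a x : A x -> A (a *: x).
  by move=> Ax; rewrite -[_ *: _]addr0; exact: Alin.
have AB x y : A x -> A y -> A (x - y).
  by move=> Ax Ay; apply: AD => //; rewrite -scaleN1r; exact: AZ.
have coord x : exists t : R, A (x - t *: b).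
  have [Ax|nAx] := pselect (A x); first by exists 0; rewrite scale0r subr0.
  (* If [x] is outside [A], enlarging [A] by [x] must catch [b]; solving the resulting equation for
     [x] gives its coordinate along [b]. *)
  pose B := [set z | exists2 y, A y & exists t : R, z = y + t *: x].
  have [y Ay [t bE]] : B b.
    apply: contrapT => nBb; apply: (Amax B).
      split=> [y Ay|BA]; first by exists y => //; exists 0; rewrite scale0r addr0.
      by apply: nAx; apply: BA; exists 0 => //; exists 1; rewrite scale1r add0r.
    split=> // a z w [y Ay [t ->]] [y' Ay' [t' ->]].
    exists (a *: y + y'); first exact: Alin.
    exists (a * t + t').
    by rewrite scalerDr scalerA scalerDl addrACA.
  have t0 : t != 0.
    by apply/eqP => t0; apply: Ab; rewrite bE t0 scale0r addr0.
  exists t^-1; rewrite bE scalerDr scalerA mulVf// scale1r opprD addrC.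
  by rewrite subrK -scaleNr; exact: AZ.
have /choice[psi psiP] := coord.
have uniq x s t : A (x - s *: b) -> A (x - t *: b) -> s = t.
  move=> As At; apply: contrapT => st.
  have ts0 : t - s != 0 by rewrite subr_eq0; apply/eqP => ts; exact: st.
  apply: Ab; rewrite -[b](scalerK ts0); apply: AZ.
  have := AB _ _ As At.
  by rewrite opprB addrC addrA subrK scalerBl.
exists psi => [a x y|].
  apply: (uniq (a *: x + y)); first exact: psiP.
  have -> : a *: x + y - (a * psi x + psi y) *: b =
      a *: (x - psi x *: b) + (y - psi y *: b).
    by rewrite scalerDl opprD scalerBr scalerA addrACA.
  by apply: Alin; exact: psiP.
by apply: (uniq b) => //; rewrite scale1r subrr.
Qed.

(** The functionals live on all of [E] and not only on the span, so that coordinates are Borel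
    functions on [E]. *)
Definition biorthogonal n (b : nat -> E) (phi : nat -> E -> R) :=
  (forall i, scalar (phi i)) /\
  (forall i j, (i < n)%N -> (j < n)%N -> phi i (b j) = (i == j)%:R).

(** Families are indexed by [nat] and truncated at [n], which keeps inductions on [n] free of casts
    between ordinal types. *)
Definition lincomb n (b : nat -> E) (a : nat -> R) : E := \sum_(i < n) a i *: b i.

Definition span n (b : nat -> E) : set E := range (lincomb n b).

Lemma coord_lincomb n b phi a i : biorthogonal n b phi -> (i < n)%N ->
  phi i (lincomb n b a) = a i.
Proof.
move=> [lphi bphi] ni; rewrite /lincomb scalar_sum//.
rewrite (bigD1 (Ordinal ni))//= bphi// eqxx mulr1 big1 ?addr0// => j ji.
rewrite bphi//; case: eqP => [ij|_]; last by rewrite mulr0.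
by move: ji; rewrite -val_eqE/= ij eqxx.
Qed.

Lemma spanP n b phi x : biorthogonal n b phi ->
  span n b x <-> x = lincomb n b (phi ^~ x).
Proof.
move=> bphi; split=> [[a _ <-]|->]; last by exists (phi ^~ x).
by apply: eq_bigr => i _; rewrite (coord_lincomb a bphi).
Qed.

Lemma lincombD n b (a a' : nat -> R) :
  lincomb n b (fun i => a i + a' i) = lincomb n b a + lincomb n b a'.
Proof. by rewrite /lincomb -big_split/=; apply: eq_bigr => i _; rewrite scalerDl. Qed.

Lemma lincombZ n b t (a : nat -> R) :
  lincomb n b (fun i => t * a i) = t *: lincomb n b a.
Proof. by rewrite /lincomb scaler_sumr; apply: eq_bigr => i _; rewrite scalerA. Qed.

(** Induction in the manner of Gram and Schmidt, where [p] removes the part already described by the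
    coordinates. If [p (b n)] is zero, the span has not grown. Otherwise [p (b n)] joins the basis
    with [psi \o p] as its coordinate, which kills the earlier basis vectors because [p] does. *)
Lemma span_biorthogonal n b : exists n' b' phi,
  biorthogonal n' b' phi /\ span n b = span n' b'.
Proof.
elim: n => [|n [k [b' [phi [bphi spE]]]]].
  exists 0, (fun _ => 0), (fun _ _ => 0); split; last first.
    by apply/seteqP; split=> _ [a _ <-]; exists a => //; rewrite /lincomb !big_ord0.
  by split => // i a x y; rewrite mulr0 addr0.
have [lphi dual] := bphi.
have spS : span n.+1 b = [set y + t *: b n | y in span k b' & t in setT].
  apply/seteqP; split=> [_ [a _ <-]|_ [y + [t _ <-]]].
    rewrite /lincomb big_ord_recr/=; exists (lincomb n b a).
      by rewrite -spE; exists a.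
    by exists (a n).
  rewrite -spE => -[a _ <-].
  exists (fun i => if (i < n)%N then a i else t) => //.
  rewrite /lincomb big_ord_recr/= ltnn; congr (_ + _).
  by apply: eq_bigr => i _; rewrite ltn_ord.
pose p x := x - lincomb k b' (phi ^~ x).
have pD a x y : p (a *: x + y) = a *: p x + p y.
  rewrite /p (_ : phi ^~ _ = (fun i => a * phi i x + phi i y)).
    by rewrite lincombD lincombZ scalerBr opprD addrACA.
  by apply/funext => i; rewrite lphi.
have [b0|b0] := eqVneq (p (b n)) 0.
  exists k, b', phi; split => //; rewrite spS.
  have bn : b n = lincomb k b' (phi ^~ (b n)) by apply/eqP; rewrite -subr_eq0 -/(p _) b0.
  apply/seteqP; split=> [_ [_ [a _ <-] [t _ <-]]|y yk].
    rewrite bn -lincombZ -lincombD.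
    by exists (fun i => a i + t * phi i (b n)).
  by exists y => //; exists 0 => //; rewrite scale0r addr0.
have [psi lpsi psi1] := separating_functional b0.
pose b'' i := if i == k then p (b n) else b' i.
pose phi' i := if i == k then psi \o p else phi i.
have b''E i : (i < k)%N -> b'' i = b' i by move=> ik; rewrite /b'' ltn_eqF.
have phi'E i : (i < k)%N -> phi' i = phi i by move=> ik; rewrite /phi' ltn_eqF.
have lc a : lincomb k.+1 b'' a = lincomb k b' a + a k *: p (b n).
  rewrite /lincomb big_ord_recr/= /b'' eqxx; congr (_ + _).
  by apply: eq_bigr => i _; rewrite ltn_eqF.
have phip i x : (i < k)%N -> phi i (p x) = 0.
  by move=> ik; rewrite /p scalarB// (coord_lincomb _ bphi)// subrr.
have pb i : (i < k)%N -> p (b' i) = 0.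
  move=> ik; rewrite /p; apply/eqP; rewrite subr_eq0; apply/eqP.
  apply/(spanP _ bphi); exists (fun j => (j == i)%:R) => //.
  rewrite /lincomb (bigD1 (Ordinal ik))//= eqxx scale1r big1 ?addr0// => j.
  by rewrite -val_eqE /= => /negbTE ->; rewrite scale0r.
have pp x : p (p x) = p x.
  rewrite {1}/p (_ : lincomb _ _ _ = 0) ?subr0//.
  by rewrite /lincomb big1// => i _; rewrite phip// scale0r.
have bphi' : biorthogonal k.+1 b'' phi'.
  split=> [i a x y|i j].
    by rewrite /phi'; case: ifP => _; [rewrite /= pD lpsi|rewrite lphi].
  rewrite !ltnS (leq_eqVlt i) (leq_eqVlt j) => /predU1P[->|ik] /predU1P[->|jk].
  - by rewrite /phi' /b'' eqxx/= pp.
  - by rewrite /phi' eqxx/= b''E// pb// scalar0// gtn_eqF.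
  - by rewrite phi'E// /b'' eqxx phip// ltn_eqF.
  - by rewrite phi'E// b''E// dual.
exists k.+1, b'', phi'; split => //; rewrite spS.
have bnE : b n = lincomb k b' (phi ^~ (b n)) + p (b n) by rewrite addrC subrK.
apply/seteqP; split=> [_ [_ [a _ <-] [t _ <-]]|_ [a _ <-]].
  exists (fun i => if i == k then t else a i + t * phi i (b n)) => //.
  rewrite lc eqxx [in RHS]bnE [in RHS]scalerDr addrA -lincombZ -lincombD; congr (_ + _).
  by apply: eq_bigr => i _; rewrite ltn_eqF.
rewrite lc; exists (lincomb k b' (fun i => a i + (- a k) * phi i (b n))).
  by eexists.
have abn : a k *: b n = a k *: lincomb k b' (phi ^~ (b n)) + a k *: p (b n).
  by rewrite -scalerDr -bnE.
exists (a k) => //; rewrite abn lincombD lincombZ scaleNr.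
by rewrite addrA subrK.
Qed.

Lemma fin_dim_spanP F : fin_dim_subspace F <-> exists n b, F = span n b.
Proof.
split=> [[n [b ->]]|[n [b ->]]].
  exists n, (fun i => if insub i is Some j then b j else 0).
  apply/seteqP; split=> [_ [a _ <-]|_ [a _ <-]].
    exists (fun i => if insub i is Some j then a j else 0) => //.
    by apply: eq_bigr => i _; rewrite valK.
  exists (fun i => a i) => //.
  by apply: eq_bigr => i _; rewrite valK.
exists n, (fun i => b i); apply/seteqP; split=> [_ [a _ <-]|_ [a _ <-]].
  by exists (fun i => a i).
exists (fun i => if insub i is Some j then a j else 0) => //.
by apply: eq_bigr => i _; rewrite valK.
Qed.

Lemma fin_dimP F : fin_dim_subspace F ->
  exists n b phi, biorthogonal n b phi /\ F = span n b.
Proof.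
move=> /fin_dim_spanP[n [b ->]].
by have [n' [b' [phi [bphi ->]]]] := span_biorthogonal n b; exists n', b', phi.
Qed.

Lemma fin_dim_add F G : fin_dim_subspace F -> fin_dim_subspace G ->
  fin_dim_subspace [set x + y | x in F & y in G].
Proof.
move=> [n [b ->]] [m [c ->]].
exists (n + m)%N, (fun i => match fintype.split i with inl j => b j | inr j => c j end).
apply/seteqP; split=> [_ [_ [a _ <-] [_ [a' _ <-] <-]]|_ [a _ <-]].
  exists (fun i => match fintype.split i with inl j => a j | inr j => a' j end) => //.
  rewrite big_split_ord/=; congr (_ + _); apply: eq_bigr => i _.
    by rewrite (unsplitK (inl i)).
  by rewrite (unsplitK (inr i)).
exists (\sum_i a (lshift m i) *: b i); first by exists (fun i => a (lshift m i)).
exists (\sum_i a (rshift n i) *: c i); first by exists (fun i => a (rshift n i)).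
rewrite big_split_ord/=; congr (_ + _); apply: eq_bigr => i _.
  by rewrite (unsplitK (inl i)).
by rewrite (unsplitK (inr i)).
Qed.

Lemma fin_dim_subP F : fin_dim_subspace F ->
  F 0 /\ forall a x y, F x -> F y -> F (a *: x + y).
Proof.
move=> /fin_dim_spanP[n [b ->]]; split.
  by exists (fun _ => 0) => //; rewrite /lincomb big1// => i _; rewrite scale0r.
move=> t _ _ [a _ <-] [a' _ <-].
by exists (fun i => t * a i + a' i) => //; rewrite lincombD lincombZ.
Qed.

(* The countable increasing unions of finite dimensional subspaces: every
   measure in [M_E] lives on one of them. *)
Definition tame V := exists F : nat -> set E,
  [/\ forall n, fin_dim_subspace (F n),
      forall m n, (m <= n)%N -> F m `<=` F n & V = \bigcup_n F n].

Lemma tame_fin_dim F : fin_dim_subspace F -> tame F.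
Proof.
move=> fF; exists (fun _ => F); split=> [//|m n _ x //|].
by apply/seteqP; split=> [x Fx|x [n _ Fx]//]; exists 0%N.
Qed.

Lemma tame_subP V : tame V -> V 0 /\ forall a x y, V x -> V y -> V (a *: x + y).
Proof.
move=> [F [fF ndF ->]]; split.
  by exists 0 => //; have [] := fin_dim_subP (fF 0).
move=> a x y [m _ Fx] [n _ Fy].
exists (maxn m n) => //; have [_] := fin_dim_subP (fF (maxn m n)); apply.
  exact: ndF (leq_maxl m n) _ Fx.
exact: ndF (leq_maxr m n) _ Fy.
Qed.

Lemma tame0 V : tame V -> V 0. Proof. by move=> /tame_subP[]. Qed.

Lemma tameD V x y : tame V -> V x -> V y -> V (x + y).
Proof. by move=> /tame_subP[_ VD] Vx Vy; rewrite -[x]scale1r; exact: VD. Qed.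

Lemma tameN V x : tame V -> V x -> V (- x).
Proof.
move=> tV Vx; have [V0 VD] := tame_subP tV.
by rewrite -scaleN1r -[_ *: _]addr0; exact: VD.
Qed.

(** The given subspaces need not be nested, so they are replaced by their partial sums, which
    are. *)
Lemma tame_bigcup_add (F : nat -> set E) : (forall n, fin_dim_subspace (F n)) ->
  exists2 V, tame V & forall n, F n `<=` V.
Proof.
move=> fF; pose G := fix G n := if n is m.+1 then
  [set x + y | x in G m & y in F m] else F 0.
have fG n : fin_dim_subspace (G n).
  by elim: n => [|n IH]; [exact: fF|exact: fin_dim_add].
have GS n : G n `<=` G n.+1.
  move=> x Gx; exists x => //; exists 0; last by rewrite addr0.
  by have [] := fin_dim_subP (fF n).
exists (\bigcup_n G n).
  exists G; split => // m n; elim: n => [|n IH].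
    by rewrite leqn0 => /eqP ->.
  rewrite leq_eqVlt => /predU1P[->//|]; rewrite ltnS => /IH mn.
  exact: subset_trans mn (GS n).
move=> n x Fx; exists n.+1 => //; exists 0; last by exists x; rewrite ?add0r.
by have [] := fin_dim_subP (fG n).
Qed.

Lemma tame_join V W : tame V -> tame W ->
  exists U, [/\ tame U, V `<=` U & W `<=` U].
Proof.
move=> [F [fF _ ->]] [G [fG _ ->]].
have [U tU FU] := tame_bigcup_add (fun n => fin_dim_add (fF n) (fG n)).
exists U; split => //.
  move=> x [n _ Fx]; apply: (FU n); exists x => //; exists 0; last by rewrite addr0.
  by have [] := fin_dim_subP (fG n).
move=> x [n _ Gx]; apply: (FU n); exists 0; last by exists x; rewrite ?add0r.
by have [] := fin_dim_subP (fF n).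
Qed.

Lemma fin_dim_line x : fin_dim_subspace (range (fun t : R => t *: x)).
Proof.
exists 1%N, (fun _ => x); apply/seteqP; split=> [_ [t _ <-]|_ [a _ <-]].
  by exists (fun _ => t) => //; rewrite big_ord1.
by exists (a ord0) => //; rewrite big_ord1.
Qed.

Lemma tame_countable (D : set E) : countable D -> exists2 V, tame V & D `<=` V.
Proof.
move=> cD; have /pcard_surjP[g gs] : ((D : set (il E)) #<= [set: nat])%card := cD.
have [V tV LV] := tame_bigcup_add (fun n => fin_dim_line (g n)).
exists V => // x /gs[n _ <-]; apply: (LV n); exists 1; rewrite ?scale1r//.
Qed.

End linear_functionals.

(** * Borel measurability on finite dimensional and tame subspaces *)

Section borel_measurability.
Context {R : realType} {E : lmodType R}.
Implicit Types (x y z : E) (F G V W : set E).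

Lemma measurable_open (U : set (il E)) : open U -> measurable (U : set (borel E)).
Proof. by move=> oU; apply: sub_gen_smallest. Qed.

Lemma measurable_to_borel d (O : measurableType d) (X : O -> borel E) :
  (forall U : set (il E), open U -> measurable (X @^-1` U)) ->
  measurable_fun setT X.
Proof.
move=> h; apply: (measurability (@open (il E) : set (set (borel E)))) => //.
by move=> _ [U oU <-]; rewrite setTI; exact: h.
Qed.

Lemma measurable_real_of_open (f : E -> R) :
  (forall r, open ([set x | r < f x] : set (il E))) ->
  measurable_fun setT (f : borel E -> R).
Proof.
move=> h; apply: (measurability (RGenOInfty.G (R := R))).
  exact: RGenOInfty.measurableE.
move=> _ [_ [r ->] <-]; rewrite setTI; apply: measurable_open.
by rewrite (_ : _ @^-1` _ = [set x | r < f x])//; apply/seteqP; split => x /=;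
  rewrite in_itv/= andbT.
Qed.

Lemma seminorm_measurable (kappa : E -> R) : seminorm kappa ->
  measurable_fun setT (kappa : borel E -> R).
Proof.
move=> nk; have [k0 kD kZ] := nk; apply: measurable_real_of_open => r.
rewrite il_openE => x /= rx; have d0 : 0 < kappa x - r by rewrite subr_gt0.
exists (fun z => (kappa x - r)^-1 * kappa z).
  by apply: seminormZ => //; rewrite invr_ge0 ltW.
move=> y; rewrite mulrC ltr_pdivrMr// mul1r => yx.
have : kappa x <= kappa y + kappa (y - x).
  by rewrite -(seminormN (y - x) nk) opprB -{1}(subrK y x) addrC kD.
by move=> h; lra.
Qed.

Lemma seminorm_functional (phi : E -> R) : scalar phi ->
  seminorm (fun x => `|phi x|).
Proof.
move=> lp; split=> [x|x y|a x]; first exact: normr_ge0.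
  by rewrite scalarD// ler_normD.
by rewrite scalarZ// normrM.
Qed.

Lemma functional_measurable (phi : E -> R) : scalar phi ->
  measurable_fun setT (phi : borel E -> R).
Proof.
move=> lp; apply: measurable_real_of_open => r.
rewrite il_openE => x /= rx; have d0 : 0 < phi x - r by rewrite subr_gt0.
exists (fun z => (phi x - r)^-1 * `|phi z|).
  by apply: seminormZ; [rewrite invr_ge0 ltW|exact: seminorm_functional].
move=> y; rewrite mulrC ltr_pdivrMr// mul1r scalarB// ltr_norml => /andP[h _].
by lra.
Qed.

(** A point [x] outside the span has nonzero image under the projection [p], which annihilates the
    span. If [psi (p x) = 1], the seminorm [|psi (p z)|] keeps every point of the span at distance 1
    from [x]. *)
Lemma span_closed n b : closed (span n b : set (il E)).
Proof.
have [k [c [phi [bphi ->]]]] := span_biorthogonal n b; have [lphi _] := bphi.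
rewrite -openC il_openE => x nx.
pose p z := z - lincomb k c (phi ^~ z).
have pD a z w : p (a *: z + w) = a *: p z + p w.
  rewrite /p (_ : phi ^~ _ = (fun i => a * phi i z + phi i w)).
    by rewrite lincombD lincombZ scalerBr opprD addrACA.
  by apply/funext => i; rewrite lphi.
have px0 : p x != 0.
  by rewrite subr_eq0; apply/eqP => xE; apply: nx; apply/(spanP _ bphi).
have [psi lpsi psi1] := separating_functional px0.
have lpp : scalar (psi \o p) by move=> a z w /=; rewrite pD lpsi.
exists (fun z => `|psi (p z)|); first exact: (seminorm_functional lpp).
move=> y yx /(spanP _ bphi) yE; move: yx.
rewrite [psi _](scalarB (phi := psi \o p))//= psi1 {1}/p -yE subrr scalar0//.
by rewrite sub0r normrN normr1 ltxx.
Qed.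

Lemma fin_dim_measurable F : fin_dim_subspace F -> measurable (F : set (borel E)).
Proof.
move=> /fin_dim_spanP[n [b ->]]; rewrite -[span n b]setCK.
apply: measurableC; apply: measurable_open; rewrite openC; exact: span_closed.
Qed.

Lemma tame_measurable V : tame V -> measurable (V : set (borel E)).
Proof.
move=> [F [fF _ ->]]; apply: bigcupT_measurable => n; exact: fin_dim_measurable.
Qed.

(** Continuity in the coefficients is not enough by itself, because these are merely measurable
    functions on [O]: the preimage of an open set is exhausted by countably many boxes with rational
    centres, each of which pulls back to a measurable set. *)
Lemma measurable_lincomb d (O : measurableType d) n (b : nat -> E)
    (a : nat -> O -> R) : (forall i, (i < n)%N -> measurable_fun setT (a i)) ->
  measurable_fun setT (fun w => lincomb n b (a ^~ w) : borel E).
Proof.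
move=> ma; apply: measurable_to_borel => U oU.
pose I := ({ffun 'I_n -> rat} * nat)%type.
pose box (j : I) (c : nat -> R) := forall i : 'I_n, `|c i - ratr (j.1 i)| < j.2.+1%:R^-1.
(* Goodness of a box need not be decidable; what matters is that there are only countably many
   boxes. *)
pose good (j : I) := forall c, box j c -> U (lincomb n b c).
pose S (k : nat) : set O := if (choice.unpickle k : option I) is Some j then
  [set w | good j /\ box j (a ^~ w)] else set0.
rewrite (_ : _ @^-1` U = \bigcup_k S k).
  apply: bigcupT_measurable => k; rewrite /S; case: choice.unpickle => // j.
  have [gj|ngj] := pselect (good j); last first.
    by rewrite (_ : [set _ | _] = set0)//; apply/seteqP; split => w // [].
  rewrite (_ : [set _ | _] = \bigcap_(i in [set: 'I_n])
      [set w | `|a i w - ratr (j.1 i)| < j.2.+1%:R^-1]); last first.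
    by apply/seteqP; split=> [w [_ h] i _|w h]; [exact: h|split=> // i; exact: h].
  apply: fin_bigcap_measurable => // i _.
  have mf : measurable_fun setT (fun w => `|a i w - ratr (j.1 i)|).
    apply: measurableT_comp => //; apply: measurable_funB; first exact: ma.
    exact: measurable_cst.
  have := mf measurableT `]-oo, j.2.+1%:R^-1[%classic (measurable_itv _).
  by rewrite setTI; congr measurable; apply/seteqP; split => w /=; rewrite in_itv.
apply/seteqP; split=> [w Uw|w [k _]]; last first.
  by rewrite /S; case: choice.unpickle => // j [gj bj]; exact: gj.
move: oU; rewrite il_openE => /(_ _ Uw)[kappa nk kU].
have [k0 kD kZ] := nk.
(* Two points of a box of radius [N.+1%:R^-1] differ by less than [2 / N.+1%:R] in each coordinate,
   hence by at most [2 * K / N.+1%:R < 1] in the seminorm [kappa]. *)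
pose K := \sum_(i < n) kappa (b i).
have K0 : 0 <= K by apply: sumr_ge0.
pose N := Num.truncn (2 * K).
have NK : 2 * K < N.+1%:R by exact: truncnS_gt.
have N0 : (0 : R) < N.+1%:R by [].
have iN0 : (0 : R) < N.+1%:R^-1 by rewrite invr_gt0.
have rat_near (y : R) : exists q : rat, `|y - ratr q| < N.+1%:R^-1.
  have [|q] := @rat_in_itvoo R (y - N.+1%:R^-1) (y + N.+1%:R^-1).
    by rewrite ltrBlDr -addrA ltrDl addr_gt0.
  by rewrite in_itv/= => qe; exists q; rewrite distrC ltr_distl.
have /choice[q qP] : forall i : 'I_n, exists q : rat,
    `|a i w - ratr q| < N.+1%:R^-1 by move=> i; exact: rat_near.
exists (choice.pickle (([ffun i => q i], N) : I)) => //.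
rewrite /S choice.pickleK; split; last by move=> i; rewrite /= ffunE.
move=> c bc; apply: kU.
have -> : lincomb n b c - lincomb n b (a ^~ w) = lincomb n b (fun i => c i - a i w).
  by rewrite lincombD -[X in _ - X]scale1r -scaleNr -lincombZ; congr (_ + _);
    apply: eq_bigr => i _; rewrite mulN1r.
have ksum m (t : nat -> R) : kappa (lincomb m b t) <= \sum_(i < m) `|t i| * kappa (b i).
  elim: m => [|m IH]; first by rewrite /lincomb !big_ord0 seminorm_0.
  rewrite /lincomb !big_ord_recr/= (le_trans (kD _ _))// lerD// ?IH//.
  by rewrite kZ.
apply: (le_lt_trans (ksum _ _)).
apply: (@le_lt_trans _ _ (\sum_(i < n) (2 * N.+1%:R^-1) * kappa (b i))).
  apply: ler_sum => i _; apply: ler_wpM2r => //.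
  have h1 := bc i; have h2 := qP i; rewrite /= ffunE in h1.
  have -> : c i - a i w = (c i - ratr (q i)) - (a i w - ratr (q i)).
    by rewrite opprB addrA subrK.
  rewrite (le_trans (ler_normB _ _))// mulr_natl mulr2n.
  by apply: lerD; exact: ltW.
by rewrite -mulr_sumr -/K mulrAC ltr_pdivrMr// mul1r.
Qed.

Lemma measurable_cover d d' (O : measurableType d) (T : measurableType d')
    (f : O -> T) (A : nat -> set O) (g : nat -> O -> T) :
  (forall n, measurable (A n)) -> \bigcup_n A n = setT ->
  (forall n, measurable_fun setT (g n)) -> (forall n w, A n w -> f w = g n w) ->
  measurable_fun setT f.
Proof.
move=> mA cA mg fg _ B mB; rewrite setTI.
rewrite (_ : f @^-1` B = \bigcup_n (A n `&` (g n @^-1` B))).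
  apply: bigcupT_measurable => n; apply: measurableI => //.
  by rewrite -[_ @^-1` _]setTI; exact: mg.
apply/seteqP; split=> [w Bw|w [n _ [An]]]; last by rewrite /= -(fg n).
have : (\bigcup_n A n) w by rewrite cA.
by move=> [n _ An]; exists n => //; split => //=; rewrite -(fg n).
Qed.

Section tame_maps.
Context d (O : measurableType d) (V : set E).
Hypothesis tV : tame V.
Variables X Y : O -> borel E.
Hypotheses (mX : measurable_fun setT X) (mY : measurable_fun setT Y).
Hypotheses (VX : forall w, V (X w)) (VY : forall w, V (Y w)).

Let cover (F : nat -> set E) : (forall n, fin_dim_subspace (F n)) ->
  (forall m n, (m <= n)%N -> F m `<=` F n) -> V = \bigcup_n F n ->
  let A n := X @^-1` F n `&` Y @^-1` F n in
  (forall n, measurable (A n)) /\ \bigcup_n A n = setT.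
Proof.
move=> fF ndF VE A; split=> [n|].
  apply: measurableI.
    by rewrite -[_ @^-1` _]setTI; apply: mX => //; exact: fin_dim_measurable.
  by rewrite -[_ @^-1` _]setTI; apply: mY => //; exact: fin_dim_measurable.
apply/seteqP; split => // w _.
have := VX w; rewrite VE => -[m _ Fm]; have := VY w; rewrite VE => -[n _ Fn].
exists (maxn m n) => //; split => /=.
  exact: ndF (leq_maxl m n) _ Fm.
exact: ndF (leq_maxr m n) _ Fn.
Qed.

(** Where both values lie in [F n], the sum is a linear combination whose coefficients are sums of
    Borel functions; the sets where this happens cover [O]. *)
Lemma tame_measurableD : measurable_fun setT (fun w => (X w + Y w : E) : borel E).
Proof.
have [F [fF ndF VE]] := tV; have [mA cA] := cover fF ndF VE.
have /choice[g gP] : forall n, exists g : O -> borel E, measurable_fun setT g /\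
    forall w, (X @^-1` F n `&` Y @^-1` F n) w -> (X w + Y w : E) = g w.
  move=> n; have [k [b [phi [bphi FE]]]] := fin_dimP (fF n); have [lphi _] := bphi.
  exists (fun w => lincomb k b (fun i => phi i (X w) + phi i (Y w))); split.
    apply: (@measurable_lincomb _ _ k b (fun i w => phi i (X w) + phi i (Y w))).
    move=> i _; apply: measurable_funD.
      by apply: measurableT_comp mX; exact: functional_measurable.
    by apply: measurableT_comp mY; exact: functional_measurable.
  move=> w [/= FX FY]; rewrite lincombD; congr (_ + _).
    by apply/(spanP _ bphi); rewrite -FE.
  by apply/(spanP _ bphi); rewrite -FE.
apply: (measurable_cover mA cA (g := g)) => [n|n w Aw].
  by case: (gP n).
by case: (gP n) => _ ->.
Qed.

(** Expanding only the first argument suffices: each [sigma (b i)] is a functional and hence Borel,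
    so each term is a function of [X] times a function of [Y]. *)
Lemma tame_measurable_form (sigma : E -> E -> R) :
  (forall f, scalar (sigma f)) -> (forall g, scalar (sigma ^~ g)) ->
  measurable_fun setT (fun w => sigma (X w) (Y w)).
Proof.
move=> s1 s2; have [F [fF ndF VE]] := tV; have [mA cA] := cover fF ndF VE.
have /choice[g gP] : forall n, exists g : O -> R, measurable_fun setT g /\
    forall w, (X @^-1` F n `&` Y @^-1` F n) w -> sigma (X w) (Y w) = g w.
  move=> n; have [k [b [phi [bphi FE]]]] := fin_dimP (fF n); have [lphi _] := bphi.
  exists (fun w => \sum_(i < k) phi i (X w) * sigma (b i) (Y w)); split.
    apply: measurable_sum => i; apply: measurable_funM.
      by apply: measurableT_comp mX; exact: functional_measurable.
    by apply: measurableT_comp mY; exact: functional_measurable.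
  move=> w [/= FX FY].
  have {1}-> : X w = lincomb k b (phi ^~ (X w)) by apply/(spanP _ bphi); rewrite -FE.
  exact: (scalar_sum k (phi ^~ (X w)) b (s2 (Y w))).
apply: (measurable_cover mA cA (g := g)) => [n|n w Aw].
  by case: (gP n).
by case: (gP n) => _ ->.
Qed.

End tame_maps.

Lemma measurable_translate x : 
  measurable_fun setT (fun y : borel E => (x + y : E) : borel E).
Proof.
apply: measurable_to_borel => U oU; apply: measurable_open.
rewrite il_openE => y /= Uxy; move: oU; rewrite il_openE => /(_ _ Uxy)[k nk kU].
by exists k => // z h; apply: kU; rewrite opprD addrACA subrr add0r.
Qed.

Lemma measurable_opp : 
  measurable_fun setT (fun y : borel E => (- y : E) : borel E).
Proof.
apply: measurable_to_borel => U oU; apply: measurable_open.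
rewrite il_openE => y /= Uy; move: oU; rewrite il_openE => /(_ _ Uy)[k nk kU].
by exists k => // z h; apply: kU; rewrite -opprD (seminormN _ nk).
Qed.

(** The origin is a zero-dimensional subspace, hence Borel, and translations are Borel maps. *)
Lemma borel_measurable1 x : measurable ([set x] : set (borel E)).
Proof.
have m0 : measurable ([set 0] : set (borel E)).
  apply: fin_dim_measurable; exists 0%N, (fun _ => 0).
  by apply/seteqP; split=> [_ ->|_ [a _ <-]]; [exists (fun _ => 0)|]; rewrite ?big_ord0.
have := measurable_translate (- x) measurableT m0; rewrite setTI.
congr measurable; apply/seteqP; split => y /=; last by move=> ->; rewrite addNr.
by move=> /eqP; rewrite addrC subr_eq0 => /eqP.
Qed.

Lemma borel_countable (D : set E) : countable D -> measurable (D : set (borel E)).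
Proof.
move=> cD; apply: (@countable_measurable _ (borel E)) => // x; exact: borel_measurable1.
Qed.

End borel_measurability.

Section fubini_cL1.
Context d1 d2 (T1 : measurableType d1) (T2 : measurableType d2) {R : realType}.
Variables (P : {sigma_finite_measure set T1 -> \bar R})
  (Q : {sigma_finite_measure set T2 -> \bar R}).
Variables (a : T1 -> R) (b : T2 -> R) (f : T1 * T2 -> R[i]).
Hypothesis ia : P.-integrable setT (EFin \o a).
Hypothesis ib : Q.-integrable setT (EFin \o b).
Hypothesis mf : cmeasurable f.
Hypothesis fab : forall x y, nrm (f (x, y)) <= a x * b y.

Lemma cL1_cint : cL1 P (fun x => cint Q (fun y => f (x, y))).
Proof.
apply: (cL1_dom (cmeasurable_cint_param Q mf)
  (integrableZr_EFin (\int[Q]_y b y) ia)) => x.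
have L := cL1_prod1 ib mf fab x.
rewrite (le_trans (ler_nrm_cint L))// mulrC -RintegralZl//.
apply: le_Rintegral => //; first by case: L.
exact: integrableZr_EFin.
Qed.

End fubini_cL1.

(** * Measures carried by tame subspaces *)

Section concentrated.
Context {R : realType} {E : lmodType R}.
Implicit Types (mu nu : set (borel E) -> R[i]) (V F : set E).

Lemma rep_concentrated_on d (O : measurableType d) (P : {measure set O -> \bar R})
    X u mu (D : set E) :
  rep P X u mu -> (forall w, D (X w)) -> concentrated_on D mu.
Proof.
move=> [_ _ muE _] DX A mA AD; rewrite muE// -[RHS](cint0 P).
apply: eq_cint => w; rewrite indicE memNset ?mul0r// => Aw.
by have : (A `&` D) (X w) by []; rewrite AD.
Qed.

Lemma concentratedS (D D' : set E) mu : D `<=` D' -> concentrated_on D mu ->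
  concentrated_on D' mu.
Proof.
move=> DD' cD A mA AD'; apply: cD => //.
by apply/seteqP; split=> // x [Ax Dx]; rewrite -AD'; split=> //; exact: DD'.
Qed.

(** Two representations of [mu] over the same [m]: the one by the identity computes the variation
    exactly, the one by the retraction takes all its values in [V], as convolutions require. *)
Definition based V (m : {finite_measure set (borel E) -> \bar R}) u mu :=
  [/\ forall x, ~ V x -> u x = 0, rep m (fun x => x) u mu &
    rep m (retract_to V 0) u mu].

Lemma based_concentrated V m u mu : tame V -> based V m u mu -> concentrated_on V mu.
Proof.
move=> tV [_ _ r]; apply: (rep_concentrated_on r) => x.
by apply: retract_toP; exact: tame0.
Qed.

Lemma null_forS (m m' : set (borel E) -> \bar R) mu :
  (forall A, measurable A -> m' A = 0%E -> m A = 0%E) ->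
  null_for m mu -> null_for m' mu.
Proof. by move=> mm' n A mA /(mm' A mA); exact: n. Qed.

(** The sum of dominating measures dominates each of the four measures, and the join of their
    carriers carries each of them, so all become densities over one measure. *)
Lemma common_base (V1 V2 V3 V4 : set E) mu1 mu2 mu3 mu4 :
  tame V1 -> tame V2 -> tame V3 -> tame V4 ->
  complex_measure mu1 -> complex_measure mu2 ->
  complex_measure mu3 -> complex_measure mu4 ->
  concentrated_on V1 mu1 -> concentrated_on V2 mu2 ->
  concentrated_on V3 mu3 -> concentrated_on V4 mu4 ->
  exists V m u1 u2 u3 u4, [/\ tame V, based V m u1 mu1, based V m u2 mu2,
    based V m u3 mu3 & based V m u4 mu4].
Proof.
move=> t1 t2 t3 t4 c1 c2 c3 c4 v1 v2 v3 v4.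
have [V12 [t12 V1s V2s]] := tame_join t1 t2.
have [V34 [t34 V3s V4s]] := tame_join t3 t4.
have [V [tV V12s V34s]] := tame_join t12 t34.
have [m1 n1] := complex_measure_dominated c1.
have [m2 n2] := complex_measure_dominated c2.
have [m3 n3] := complex_measure_dominated c3.
have [m4 n4] := complex_measure_dominated c4.
have [m12 m12E] := finite_measure_add m1 m2.
have [m34 m34E] := finite_measure_add m3 m4.
have [m mE] := finite_measure_add m12 m34.
have m0 A : m A = 0%E -> [/\ m1 A = 0, m2 A = 0, m3 A = 0 & m4 A = 0]%E.
  move=> /eqP; rewrite mE m12E m34E !padde_eq0 ?adde_ge0//.
  by move=> /andP[/andP[/eqP ? /eqP ?] /andP[/eqP ? /eqP ?]].
have mV := tame_measurable tV.
have key mui (mi : {finite_measure set (borel E) -> \bar R}) (Vi : set E) :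
    complex_measure mui ->
    (forall A, measurable A -> m A = 0%E -> mi A = 0%E) -> null_for mi mui ->
    Vi `<=` V -> concentrated_on Vi mui -> exists u, based V m u mui.
  move=> ci mi0 ni Vs cv.
  exact: (complex_measure_rep 0 ci (null_forS mi0 ni) mV (concentratedS Vs cv)).
have [u1 b1] := key _ _ _ c1 (fun A _ h => let: And4 h _ _ _ := m0 A h in h)
  n1 (subset_trans V1s V12s) v1.
have [u2 b2] := key _ _ _ c2 (fun A _ h => let: And4 _ h _ _ := m0 A h in h)
  n2 (subset_trans V2s V12s) v2.
have [u3 b3] := key _ _ _ c3 (fun A _ h => let: And4 _ _ h _ := m0 A h in h)
  n3 (subset_trans V3s V34s) v3.
have [u4 b4] := key _ _ _ c4 (fun A _ h => let: And4 _ _ _ h := m0 A h in h)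
  n4 (subset_trans V4s V34s) v4.
by exists V, m, u1, u2, u3, u4.
Qed.

Lemma rep_lin d (O : measurableType d) (P : {measure set O -> \bar R})
    X u v (a : R[i]) mu nu : rep P X u mu -> rep P X v nu ->
  rep P X (fun w => a * u w + v w) (a *: mu + nu).
Proof.
move=> [mX Lu muE mu0] [_ Lv nuE nu0]; split => //.
- by apply: cL1D => //; exact: cL1Z.
- move=> A mA; have mXA : measurable (X @^-1` A).
    by rewrite -[X in measurable X]setTI; exact: mX.
  rewrite [LHS](_ : _ = a * mu A + nu A)// muE// nuE//.
  have La : cL1 P (fun w => \1_A (X w) * u w) by exact: (cL1_indic Lu mXA).
  have Lb : cL1 P (fun w => \1_A (X w) * v w) by exact: (cL1_indic Lv mXA).
  rewrite -cintZ// -cintD//; last exact: cL1Z.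
  by apply: eq_cint => w; rewrite mulrDr mulrCA.
- by move=> A nA; rewrite [LHS](_ : _ = a * mu A + nu A)// mu0// nu0// mulr0 addr0.
Qed.

Lemma based_lin V m u v (a : R[i]) mu nu : based V m u mu -> based V m v nu ->
  based V m (fun x => a * u x + v x) (a *: mu + nu).
Proof.
move=> [u0 r r'] [v0 q q']; split; [|exact: rep_lin..].
by move=> x nV; rewrite u0// v0// mulr0 addr0.
Qed.

Lemma cvariation_based V m u mu A : based V m u mu -> measurable A ->
  cvariation mu A = (\int[m]_(x in A) (nrm (u x))%:E)%E.
Proof. by move=> [_ r _]; exact: cvariation_density. Qed.

Lemma integral_based V m u mu (phi : borel E -> \bar R) : based V m u mu ->
  measurable_fun setT phi -> (forall x, (0%R <= phi x)%E) ->
  (\int[cvariation mu]_x phi x = \int[m]_x (phi x * (nrm (u x))%:E))%E.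
Proof. by move=> [_ r _]; exact: cvariation_integral. Qed.

Lemma complex_measure_lin (a : R[i]) mu nu :
  complex_measure mu -> complex_measure nu -> complex_measure (a *: mu + nu).
Proof.
move=> cmu cnu.
have [m1 n1] := complex_measure_dominated cmu.
have [m2 n2] := complex_measure_dominated cnu.
have [m mE] := finite_measure_add m1 m2.
have m0 A : m A = 0%E -> (m1 A = 0 /\ m2 A = 0)%E.
  by move=> /eqP; rewrite mE padde_eq0// => /andP[/eqP ? /eqP ?].
have [u r] := complex_measure_density cmu
  (null_forS (fun A _ h => (m0 A h).1) n1).
have [v q] := complex_measure_density cnu
  (null_forS (fun A _ h => (m0 A h).2) n2).
exact: rep_complex_measure (rep_lin a r q).
Qed.

Lemma complex_measure0 : complex_measure (0 : set (borel E) -> R[i]).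
Proof.
split => //; move=> F mF tF mUF; rewrite [X in X @ _ --> _](_ : _ = fun=> 0%E).
- exact: cvg_cst.
- by apply/funext => n; rewrite big1.
- exact: cvg_cst.
- by apply/funext => n; rewrite big1.
Qed.

Lemma complex_measureB mu nu : complex_measure mu -> complex_measure nu ->
  complex_measure (mu - nu).
Proof.
move=> cmu cnu; rewrite -[mu - nu]addrC -[- nu]scaleN1r.
exact: complex_measure_lin.
Qed.

Lemma concentrated_lin (D : set E) (a : R[i]) mu nu :
  concentrated_on D mu -> concentrated_on D nu -> concentrated_on D (a *: mu + nu).
Proof.
move=> cmu cnu A mA AD; rewrite [LHS](_ : _ = a * mu A + nu A)// cmu// cnu//.
by rewrite mulr0 addr0.
Qed.

Lemma concentratedB (D : set E) mu nu :
  concentrated_on D mu -> concentrated_on D nu -> concentrated_on D (mu - nu).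
Proof.
move=> cmu cnu; rewrite -[mu - nu]addrC -[- nu]scaleN1r.
exact: concentrated_lin.
Qed.

Definition crestrict (D : set (borel E)) mu : set (borel E) -> R[i] :=
  on_measurable (fun A => mu (A `&` D)).

Lemma crestrict_rep (D : set (borel E)) (m : {measure set (borel E) -> \bar R}) u mu :
  measurable D ->
  rep m (fun x => x) u mu -> rep m (fun x => x) (fun x => \1_D x * u x) (crestrict D mu).
Proof.
move=> mD [mX Lu muE mu0]; split => // [|A mA|A nA].
- exact: cL1_indic.
- rewrite /crestrict /on_measurable asboolT// muE; last exact: measurableI.
  apply: eq_cint => x; rewrite mulrA; congr (_ * _).
  by rewrite !indicE in_setI; case: (_ \in A); case: (_ \in D);
    rewrite ?mulr1 ?mulr0 ?mul0r.
- by rewrite /crestrict /on_measurable asboolF.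
Qed.

(** The norm of the difference is the mass of the complement of [F n] under the finite measure with
    density [nrm u], and these complements decrease to a null set. *)
Lemma crestrict_approx (F : nat -> set (borel E)) mu :
  complex_measure mu -> (forall n, measurable (F n)) ->
  (forall m n, (m <= n)%N -> F m `<=` F n) -> concentrated_on (\bigcup_n F n) mu ->
  forall e : R, 0 < e -> exists n, (norm1 (mu - crestrict (F n) mu)%R < e%:E)%E.
Proof.
move=> cmu mF ndF cF e e0.
have [m mmu] := complex_measure_dominated cmu.
have mU : measurable (\bigcup_n F n : set (borel E)) by exact: bigcupT_measurable.
have [u [u0 r _]] := complex_measure_rep 0 cmu mmu mU cF.
have [_ Lu _ _] := r; have [_ iu] := Lu.
have dE n : (norm1 (mu - crestrict (F n) mu)%R =
    \int[m]_(x in ~` F n) (nrm (u x))%:E)%E.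
  have rd : rep m (fun x => x) (fun x => -1 * (\1_(F n) x * u x) + u x)
      (mu - crestrict (F n) mu).
    have -> : mu - crestrict (F n) mu = -1 *: crestrict (F n) mu + mu.
      by rewrite scaleN1r addrC.
    apply: rep_lin => //.
    exact: crestrict_rep.
  rewrite /norm1 (cvariation_density rd)// [RHS]integral_mkcond.
  apply: eq_integral => x _; rewrite /patch in_setC indicE mulN1r.
  case: (x \in F n); first by rewrite mul1r addNr nrm0.
  by rewrite mul0r oppr0 add0r.
have [N NE] := density_measure m (@measurable_id _ _ setT) (measurable_nrm Lu.1)
  (fun w => nrm_ge0 _).
have Nfin : (N setT < +oo)%E.
  rewrite NE; move/integrableP : iu => [_]; apply: le_lt_trans.
  rewrite le_eqVlt; apply/orP; left; apply/eqP.
  by apply: eq_integral => x _ /=; rewrite ger0_norm// nrm_ge0.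
have cvg0 : (N (~` F n) @[n --> \oo] --> N (\bigcap_n ~` F n))%E.
  apply: nonincreasing_cvg_mu.
  - apply: (le_lt_trans _ Nfin); apply: le_measure; rewrite ?inE//.
    exact: measurableC.
  - by move=> n; exact: measurableC.
  - by apply: bigcapT_measurable => n; exact: measurableC.
  - by move=> i j ij; apply/subsetPset; apply: subsetC; exact: ndF.
have N0 : N (\bigcap_n ~` F n) = 0%E.
  rewrite NE; apply: integral0_eq => x /= nF; rewrite u0 ?nrm0//.
  by move=> [n _ Fx]; exact: (nF n).
rewrite N0 in cvg0.
have := cvg0 [set x | (x < e%:E)%E].
have nb : nbhs 0%E [set x : \bar R | (x < e%:E)%E].
  by apply: open_nbhs_nbhs; split; [exact: open_ereal_lt_ereal|rewrite /= lte_fin].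
move=> /(_ nb)[n _ /(_ n (leqnn n))] /= h.
by exists n; rewrite dE; move: h; rewrite NE.
Qed.

Lemma concentrated_crestrict (D : set (borel E)) mu : complex_measure mu ->
  concentrated_on D (crestrict D mu).
Proof.
by move=> [_ mu0 _ _] A mA AD; rewrite /crestrict /on_measurable asboolT// AD.
Qed.

Lemma norm1_closure_approx (X : set E -> set (set (borel E) -> R[i])) mu :
  norm1_closure X mu ->
  exists (F : nat -> set E) (nu : nat -> set (borel E) -> R[i]),
    [/\ forall n, fin_dim_subspace (F n), forall n, X (F n) (nu n) &
        forall n, (norm1 (mu - nu n)%R < (n.+1%:R^-1)%:E)%E].
Proof.
move=> [cmu app].
have /choice[G GP] n : exists p : set E * (set (borel E) -> R[i]),
    [/\ fin_dim_subspace p.1, X p.1 p.2 &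
      (norm1 (mu - p.2)%R < (n.+1%:R^-1)%:E)%E].
  have [|F [nu [? ? ?]]] := app n.+1%:R^-1; first by rewrite invr_gt0.
  by exists (F, nu).
by exists (fun n => (G n).1), (fun n => (G n).2); split => n; case: (GP n).
Qed.

(** Evaluation at a measurable set is continuous for [norm1], so vanishing off [U] survives the
    limit. *)
Lemma norm1_lim_concentrated (nu : nat -> set (borel E) -> R[i])
    (U : set (borel E)) mu :
  complex_measure mu -> measurable U -> (forall n, complex_measure (nu n)) ->
  (forall n, concentrated_on U (nu n)) ->
  (forall n, (norm1 (mu - nu n)%R < (n.+1%:R^-1)%:E)%E) -> concentrated_on U mu.
Proof.
move=> cmu mU cnu cU lim A mA AU.
apply: nrm_eq0; apply/eqP; rewrite eq_le nrm_ge0 andbT.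
apply/ler_addgt0Pl => e e0; rewrite addr0.
pose n := Num.truncn e^-1.
have ne : n.+1%:R^-1 < e.
  by rewrite -[e]invrK ltf_pV2 ?posrE ?invr_gt0// truncnS_gt.
have -> : mu A = (mu - nu n) A by rewrite [RHS](_ : _ = mu A - nu n A)// cU// subr0.
rewrite -lee_fin; apply: (le_trans (nrm_cvariation (mu - nu n) mA)).
apply: (le_trans (le_cvariation _ mA measurableT _)) => //.
by apply: ltW; apply: (lt_trans (lim n)); rewrite lte_fin.
Qed.

(** An approximating sequence lives on countably many finite dimensional subspaces, which lie in a
    common tame one. Conversely, the restrictions to the members of an exhausting sequence converge
    in norm. *)
Lemma M_EP mu : M_E mu <->
  complex_measure mu /\ exists2 V, tame V & concentrated_on V mu.
Proof.
split=> [Mmu|[cmu [V [F [fF ndF ->]] cV]]]; last first.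
  split => // e e0; have mF n := fin_dim_measurable (fF n).
  have [n ne] := crestrict_approx cmu mF ndF cV e0.
  exists (F n), (crestrict (F n) mu); split => //.
  have [m mmu] := complex_measure_dominated cmu.
  have [u r] := complex_measure_density cmu mmu.
  split; first exact: rep_complex_measure (crestrict_rep (mF n) r).
  exact: concentrated_crestrict.
have [F [nu [fF Fnu lim]]] := norm1_closure_approx Mmu.
have [cmu _] := Mmu; split => //.
have [V tV FV] := tame_bigcup_add fF; exists V => //.
apply: (norm1_lim_concentrated (nu := nu)) => //.
- exact: tame_measurable.
- by move=> n; case: (Fnu n).
- by move=> n; case: (Fnu n) => _; exact: concentratedS.
Qed.

End concentrated.

(** * Twisted convolutions *)

Section convolution.
Context {R : realType} {E : lmodType R}.
Variables (sigma : E -> E -> R) (s : E -> R).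
Hypotheses (sigma1 : forall f, scalar (sigma f))
  (sigma2 : forall g, scalar (sigma ^~ g)) (ns : seminorm s).
Variables (psi : measurableTypeR R -> R[i]) (K : R) (j : nat).
Hypothesis mpsi : cmeasurable psi.
Hypothesis K0 : 0 <= K.
Hypothesis psiK : forall f g, nrm (psi (sigma f g)) <= K * (s f ^+ j * s g ^+ j).
Implicit Types (mu nu : set (borel E) -> R[i]).

Let s0 x : 0 <= s x. Proof. by case: ns. Qed.

Lemma kernel_measurable d (O : measurableType d) V (X Y : O -> borel E) : tame V ->
  measurable_fun setT X -> measurable_fun setT Y ->
  (forall w, V (X w)) -> (forall w, V (Y w)) ->
  cmeasurable (fun w => psi (sigma (X w) (Y w))).
Proof.
move=> tV mX mY VX VY; have [m1 m2] := mpsi.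
have ms := tame_measurable_form tV mX mY VX VY sigma1 sigma2.
split.
  exact: (measurableT_comp (f := fun t : measurableTypeR R => complex.Re (psi t)) m1 ms).
exact: (measurableT_comp (f := fun t : measurableTypeR R => complex.Im (psi t)) m2 ms).
Qed.

Lemma indicD_measurable d (O : measurableType d) V (X Y : O -> borel E)
    (L : set (borel E)) : tame V -> measurable L ->
  measurable_fun setT X -> measurable_fun setT Y ->
  (forall w, V (X w)) -> (forall w, V (Y w)) ->
  cmeasurable (fun w => \1_L (X w + Y w : E) : R[i]).
Proof.
move=> tV mL mX mY VX VY.
have mD := tame_measurableD tV mX mY VX VY.
have mA : measurable ((fun w => (X w + Y w : E) : borel E) @^-1` L).
  by rewrite -[X in measurable X]setTI; exact: mD.
exact: (cmeasurable_indic mA).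
Qed.

Section reps.
Context d1 d2 (O1 : measurableType d1) (O2 : measurableType d2).
Variables (P1 : {sigma_finite_measure set O1 -> \bar R})
  (P2 : {sigma_finite_measure set O2 -> \bar R}).
Variables (X1 : O1 -> borel E) (X2 : O2 -> borel E).
Variables (u1 : O1 -> R[i]) (u2 : O2 -> R[i]) (mu1 mu2 : set (borel E) -> R[i]).
Hypotheses (r1 : rep P1 X1 u1 mu1) (r2 : rep P2 X2 u2 mu2).
Variable V : set E.
Hypotheses (tV : tame V) (V1 : forall w, V (X1 w)) (V2 : forall w, V (X2 w)).
Hypothesis i1 : P1.-integrable setT (EFin \o (fun w => s (X1 w) ^+ j * nrm (u1 w))).
Hypothesis i2 : P2.-integrable setT (EFin \o (fun w => s (X2 w) ^+ j * nrm (u2 w))).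

Let mX1 : measurable_fun setT X1. Proof. by case: r1. Qed.
Let mX2 : measurable_fun setT X2. Proof. by case: r2. Qed.
Let mu1' : cmeasurable u1. Proof. by case: r1 => _ []. Qed.
Let mu2' : cmeasurable u2. Proof. by case: r2 => _ []. Qed.
Let mV : measurable (V : set (borel E)). Proof. exact: tame_measurable. Qed.

Let a w := K * (s (X1 w) ^+ j * nrm (u1 w)).
Let b w := s (X2 w) ^+ j * nrm (u2 w).

Let ia : P1.-integrable setT (EFin \o a). Proof. exact: integrableZr_EFin. Qed.

Let mfst : measurable_fun setT (fun z : O1 * O2 => X1 z.1).
Proof. exact: (measurableT_comp mX1 (@measurable_fst _ _ _ _)). Qed.
Let msnd : measurable_fun setT (fun z : O1 * O2 => X2 z.2).
Proof. exact: (measurableT_comp mX2 (@measurable_snd _ _ _ _)). Qed.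
Definition conv_density (z : O1 * O2) : R[i] :=
  psi (sigma (X1 z.1) (X2 z.2)) * (u1 z.1 * u2 z.2).

Lemma conv_density_measurable : cmeasurable conv_density.
Proof.
have [h1 h1'] := mu1'; have [h2 h2'] := mu2'.
apply: cmeasurableM; last first.
  apply: cmeasurableM; split.
  - exact: (measurableT_comp h1 (@measurable_fst _ _ _ _)).
  - exact: (measurableT_comp h1' (@measurable_fst _ _ _ _)).
  - exact: (measurableT_comp h2 (@measurable_snd _ _ _ _)).
  - exact: (measurableT_comp h2' (@measurable_snd _ _ _ _)).
exact: (kernel_measurable tV mfst msnd (fun z => V1 z.1) (fun z => V2 z.2)).
Qed.

Lemma conv_density_bound x y : nrm (conv_density (x, y)) <= a x * b y.
Proof.
rewrite /conv_density /a /b !nrmM /=.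
rewrite (_ : K * _ * _ = K * (s (X1 x) ^+ j * s (X2 y) ^+ j) * (nrm (u1 x) * nrm (u2 y))).
  by rewrite ler_wpM2r// mulr_ge0// nrm_ge0.
by rewrite -!mulrA; congr (_ * (_ * _)); rewrite mulrCA.
Qed.

Lemma conv_density_cL1 : cL1 (P1 \x P2)%E conv_density.
Proof. exact: (cL1_prod ia i2 conv_density_measurable conv_density_bound). Qed.

(* For uncountable dimension neither the sum nor [sigma] need be measurable on
   [E * E]; they are on the tame subspace carrying both measures. *)
Lemma conv_inner (f : E) (L : set (borel E)) : V f -> measurable L ->
  cmeasurable (fun w => psi (sigma f (X2 w)) * \1_L (f + X2 w : E) * u2 w) /\
  cL1 P2 (fun w => psi (sigma f (X2 w)) * \1_L (f + X2 w : E) * u2 w) /\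
  cintegral mu2 (fun g => psi (sigma f g) * \1_L (f + g : E)) =
    cint P2 (fun w => psi (sigma f (X2 w)) * \1_L (f + X2 w : E) * u2 w).
Proof.
move=> Vf mL.
have mk d (O : measurableType d) (Y : O -> borel E) : measurable_fun setT Y ->
    (forall w, V (Y w)) ->
    cmeasurable (fun w => psi (sigma f (Y w)) * \1_L (f + Y w : E)).
  move=> mY VY; apply: cmeasurableM.
    exact: (kernel_measurable tV (X := fun=> f : borel E)).
  exact: (indicD_measurable tV mL (X := fun=> f : borel E)).
have m2 : cmeasurable (fun w => psi (sigma f (X2 w)) * \1_L (f + X2 w : E) * u2 w).
  by apply: cmeasurableM => //; exact: mk.
have L2 : cL1 P2 (fun w => psi (sigma f (X2 w)) * \1_L (f + X2 w : E) * u2 w).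
  apply: (cL1_dom m2 (integrableZr_EFin (K * s f ^+ j) i2)) => w.
  rewrite !nrmM nrm_indic mulrA ler_wpM2r ?nrm_ge0//.
  have [I0 I1] : 0 <= (\1_L (f + X2 w : E) : R) /\ (\1_L (f + X2 w : E) : R) <= 1.
    by rewrite indicE; case: (_ \in _).
  by rewrite -[leRHS]mulr1; apply: ler_pM; rewrite ?nrm_ge0// -mulrA.
split=> //; split=> //; apply: (rep_cintegral r2 mV) => //.
(* On [V] the retraction is the identity, so the integrand becomes Borel after multiplication by the
   indicator of [V], although alone it need not be. *)
have := cmeasurableM (cmeasurable_indic (R := R) mV)
  (mk _ _ _ (measurable_retract_to 0 mV) (retract_toP (tame0 tV))).
congr cmeasurable; apply/funext => g; rewrite indicE /retract_to.
by case: ifPn => gV; rewrite ?mul0r.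
Qed.

(** Addition maps the product of the representing spaces to [E], and Fubini's theorem identifies the
    iterated integral in [twisted_convolution] with an integral over that product. The outer
    integrand is known to be Borel only on [V], which is exactly what [rep_cintegral] asks for. *)
Lemma conv_rep : rep (P1 \x P2)%E (fun z => (X1 z.1 + X2 z.2 : E) : borel E)
  conv_density (twisted_convolution (fun f g => psi (sigma f g)) mu1 mu2).
Proof.
have mD := tame_measurableD tV mfst msnd (fun z => V1 z.1) (fun z => V2 z.2).
split=> // [|L mL|L nL]; [exact: conv_density_cL1| |by rewrite /twisted_convolution
  /on_measurable asboolF].
rewrite /twisted_convolution /on_measurable asboolT//.
pose G (z : O1 * O2) := \1_L (X1 z.1 + X2 z.2 : E) * conv_density z.
have mG : cmeasurable G.
  apply: cmeasurableM; last exact: conv_density_measurable.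
  exact: (indicD_measurable tV mL mfst msnd (fun z => V1 z.1) (fun z => V2 z.2)).
have Gb x y : nrm (G (x, y)) <= a x * b y.
  rewrite /G nrmM nrm_indic (le_trans _ (conv_density_bound x y))//.
  by rewrite ler_piMl ?nrm_ge0// indicE; case: (_ \in _).
rewrite -(cint_fubini1 ia i2 mG Gb).
have E1 w : cintegral mu2 (fun g => psi (sigma (X1 w) g) * \1_L (X1 w + g : E)) * u1 w
    = cint P2 (fun w' => G (w, w')).
  have [_ [L2 ->]] := conv_inner (V1 w) mL.
  rewrite mulrC -cintZ//; apply: eq_cint => w'.
  by rewrite /G /conv_density /=; ring.
rewrite (rep_cintegral r1 mV V1).
- by apply: eq_cint => w; exact: E1.
- have mF : cmeasurable (fun z : borel E * O2 =>
      psi (sigma (retract_to V 0 z.1) (X2 z.2)) *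
      \1_L (retract_to V 0 z.1 + X2 z.2 : E) * u2 z.2).
    have mr : measurable_fun setT (fun z : borel E * O2 => retract_to V 0 z.1 : borel E).
      exact: (measurableT_comp (measurable_retract_to 0 mV) (@measurable_fst _ _ _ _)).
    have ms' : measurable_fun setT (fun z : borel E * O2 => X2 z.2).
      exact: (measurableT_comp mX2 (@measurable_snd _ _ _ _)).
    have Vr (z : borel E * O2) : V (retract_to V 0 z.1).
      exact: (retract_toP (tame0 tV)).
    apply: cmeasurableM.
      apply: cmeasurableM.
        exact: (kernel_measurable tV mr ms' Vr (fun z => V2 z.2)).
      exact: (indicD_measurable tV mL mr ms' Vr (fun z => V2 z.2)).
    have [h1 h2] := mu2'; split.
      exact: (measurableT_comp h1 (@measurable_snd _ _ _ _)).
    exact: (measurableT_comp h2 (@measurable_snd _ _ _ _)).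
  have := cmeasurableM (cmeasurable_indic (R := R) mV) (cmeasurable_cint_param P2 mF).
  congr cmeasurable; apply/funext => f; rewrite indicE /=.
  have [fV|fV] := boolP (f \in V); last by rewrite !mul0r.
  have Vf : V f by exact: set_mem.
  have [_ [_ ->]] := conv_inner Vf mL.
  by rewrite /retract_to fV.
- rewrite (_ : (fun _ => _) = (fun w => cint P2 (fun w' => G (w, w')))).
    exact: (cL1_cint ia i2 mG Gb).
  by apply/funext => w; exact: E1.
Qed.

End reps.

End convolution.

Section tonelli_product.
Context d1 d2 (T1 : measurableType d1) (T2 : measurableType d2) {R : realType}.
Variables (P : {sigma_finite_measure set T1 -> \bar R})
  (Q : {sigma_finite_measure set T2 -> \bar R}).
Local Open Scope ereal_scope.

Lemma ge0_integral_prod (a : T1 -> R) (b : T2 -> R) :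
  measurable_fun setT a -> measurable_fun setT b ->
  (forall x, 0 <= a x)%R -> (forall y, 0 <= b y)%R ->
  \int[P \x Q]_z (a z.1 * b z.2)%:E = \int[P]_x (a x)%:E * \int[Q]_y (b y)%:E.
Proof.
move=> ma mb a0 b0.
rewrite (fubini_tonelli1 (fun z => (a z.1 * b z.2)%:E)); last 2 first.
- apply/measurable_EFinP; apply: measurable_funM.
    exact: (measurableT_comp ma (@measurable_fst _ _ _ _)).
  exact: (measurableT_comp mb (@measurable_snd _ _ _ _)).
- by move=> z; rewrite lee_fin mulr_ge0.
rewrite -ge0_integralZr//; last 3 first.
- exact/measurable_EFinP.
- by move=> x _; rewrite lee_fin.
- by apply: integral_ge0 => y _; rewrite lee_fin.
apply: eq_integral => x _; rewrite /fubini_F /=.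
under eq_integral do rewrite EFinM.
by rewrite ge0_integralZl_EFin//; [move=> y _; rewrite lee_fin|exact/measurable_EFinP].
Qed.

End tonelli_product.

Section weighted_mass.
Context {R : realType} {E : lmodType R}.
Implicit Types (mu nu : set (borel E) -> R[i]) (w kappa : E -> R).
Local Open Scope ereal_scope.

(** The integral of [w] against the image under [X] of the measure with density [nrm u]. It bounds
    the integral of [w] against the variation from above, with equality for a based
    representation. *)
Definition wmass d (O : measurableType d) (P : {measure set O -> \bar R})
    (X : O -> borel E) (u : O -> R[i]) w : \bar R :=
  \int[P]_x (w (X x) * nrm (u x))%:E.

Definition mom kappa (k : nat) mu : \bar R :=
  \int[cvariation mu]_x (kappa x ^+ k)%:E.

Lemma wmass_ge0 d (O : measurableType d) (P : {measure set O -> \bar R}) X u w :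
  (forall x, 0 <= w x)%R -> 0 <= wmass P X u w.
Proof. by move=> w0; apply: integral_ge0 => x _; rewrite lee_fin mulr_ge0// nrm_ge0. Qed.

Lemma wmass_integrable d (O : measurableType d) (P : {measure set O -> \bar R}) X u w mu :
  rep P X u mu -> measurable_fun setT (w : borel E -> R) -> (forall x, 0 <= w x)%R ->
  P.-integrable setT (EFin \o (fun x => w (X x) * nrm (u x))%R) <->
  wmass P X u w < +oo.
Proof.
move=> [mX [mu' _] _ _] mw w0.
have mf : measurable_fun setT (fun x => w (X x) * nrm (u x))%R.
  by apply: measurable_funM; [exact: (measurableT_comp mw mX)|exact: measurable_nrm].
have E1 : \int[P]_x `|(EFin \o (fun x => w (X x) * nrm (u x))%R) x| = wmass P X u w.
  by apply: eq_integral => x _ /=; rewrite ger0_norm// mulr_ge0// nrm_ge0.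
split=> [/integrableP[_]|h]; first by rewrite E1.
by apply/integrableP; rewrite E1; split => //; exact/measurable_EFinP.
Qed.

Lemma wmass_based V (m : {finite_measure set (borel E) -> \bar R}) u mu w :
  based V m u mu -> measurable_fun setT (w : borel E -> R) -> (forall x, 0 <= w x)%R ->
  \int[cvariation mu]_x (w x)%:E = wmass m (retract_to V 0%R) u w.
Proof.
move=> b mw w0; rewrite (integral_based b); last 2 first.
- exact/measurable_EFinP.
- by move=> x; rewrite lee_fin.
have [u0 _ _] := b.
apply: eq_integral => x _; rewrite -EFinM /retract_to; case: ifPn => // /negP xV.
by rewrite u0 ?nrm0 ?mulr0// => Vx; apply: xV; exact: mem_set.
Qed.

Lemma mom_based V (m : {finite_measure set (borel E) -> \bar R}) u mu kappa k :
  based V m u mu -> seminorm kappa ->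
  mom kappa k mu = wmass m (retract_to V 0%R) u (fun x => kappa x ^+ k)%R.
Proof.
move=> b nk; apply: (wmass_based b).
  by apply: measurable_funX; exact: seminorm_measurable.
by move=> x; rewrite exprn_ge0//; case: nk.
Qed.

Lemma mom0 kappa mu : complex_measure mu -> mom kappa 0 mu = norm1 mu.
Proof. by move=> cmu; rewrite norm1_integral. Qed.

End weighted_mass.

(** * Moments of convolutions *)

Section convolution_mass.
Context {R : realType} {E : lmodType R}.
Variables (sigma : E -> E -> R) (s : E -> R).
Hypotheses (sigma1 : forall f, scalar (sigma f))
  (sigma2 : forall g, scalar (sigma ^~ g)) (ns : seminorm s).
Variables (psi : measurableTypeR R -> R[i]) (K : R) (j : nat).
Hypothesis mpsi : cmeasurable psi.
Hypothesis K0 : 0 <= K.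
Hypothesis psiK : forall f g, nrm (psi (sigma f g)) <= K * (s f ^+ j * s g ^+ j).
Context d1 d2 (O1 : measurableType d1) (O2 : measurableType d2).
Variables (P1 : {sigma_finite_measure set O1 -> \bar R})
  (P2 : {sigma_finite_measure set O2 -> \bar R}).
Variables (X1 : O1 -> borel E) (X2 : O2 -> borel E).
Variables (u1 : O1 -> R[i]) (u2 : O2 -> R[i]) (mu1 mu2 : set (borel E) -> R[i]).
Hypotheses (r1 : rep P1 X1 u1 mu1) (r2 : rep P2 X2 u2 mu2).
Variable V : set E.
Hypotheses (tV : tame V) (V1 : forall w, V (X1 w)) (V2 : forall w, V (X2 w)).
Local Open Scope ereal_scope.

Let s0 x : (0 <= s x)%R. Proof. by case: ns. Qed.

Let mw kappa a b : seminorm kappa ->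
  measurable_fun setT (fun x : borel E => s x ^+ a * kappa x ^+ b)%R.
Proof.
move=> nk; apply: measurable_funM; apply: measurable_funX; exact: seminorm_measurable.
Qed.

(** The binomial formula for [(kappa (X1 x) + kappa (X2 y)) ^+ k] produces a sum of products, which
    Tonelli's theorem separates; the kernel contributes the factor [K] and the weights [s ^+ j]. *)
Lemma conv_wmass_le kappa k : seminorm kappa ->
  wmass (P1 \x P2) (fun z => (X1 z.1 + X2 z.2 : E)%R : borel E)
      (conv_density sigma psi X1 X2 u1 u2) (fun x => kappa x ^+ k)%R <=
  \sum_(i < k.+1) (K * 'C(k, i)%:R)%:E *
    (wmass P1 X1 u1 (fun x => s x ^+ j * kappa x ^+ (k - i))%R *
     wmass P2 X2 u2 (fun x => s x ^+ j * kappa x ^+ i)%R).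
Proof.
move=> nk; have [k0 kD _] := nk.
have [mX1 [mu1' _] _ _] := r1; have [mX2 [mu2' _] _ _] := r2.
pose A i x := (s (X1 x) ^+ j * kappa (X1 x) ^+ (k - i) * nrm (u1 x))%R.
pose B i y := (s (X2 y) ^+ j * kappa (X2 y) ^+ i * nrm (u2 y))%R.
have mA i : measurable_fun setT (A i).
  apply: measurable_funM; last exact: measurable_nrm.
  exact: (measurableT_comp (mw j (k - i) nk) mX1).
have mB i : measurable_fun setT (B i).
  apply: measurable_funM; last exact: measurable_nrm.
  exact: (measurableT_comp (mw j i nk) mX2).
have A0 i x : (0 <= A i x)%R by rewrite /A !mulr_ge0 ?exprn_ge0 ?nrm_ge0.
have B0 i y : (0 <= B i y)%R by rewrite /B !mulr_ge0 ?exprn_ge0 ?nrm_ge0.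
have C0 i : (0 <= K * 'C(k, i)%:R)%R by rewrite mulr_ge0.
have mAB i : measurable_fun setT (fun z : O1 * O2 => (A i z.1 * B i z.2)%:E).
  apply/measurable_EFinP; apply: measurable_funM.
    exact: (measurableT_comp (mA i) (@measurable_fst _ _ _ _)).
  exact: (measurableT_comp (mB i) (@measurable_snd _ _ _ _)).
apply: (@le_trans _ _ (\int[P1 \x P2]_z
    \sum_(i < k.+1) (K * 'C(k, i)%:R)%:E * (A i z.1 * B i z.2)%:E)).
  have mfst : measurable_fun setT (fun z : O1 * O2 => X1 z.1).
    exact: (measurableT_comp mX1 (@measurable_fst _ _ _ _)).
  have msnd : measurable_fun setT (fun z : O1 * O2 => X2 z.2).
    exact: (measurableT_comp mX2 (@measurable_snd _ _ _ _)).
  apply: ge0_le_integral => //.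
  - by move=> z _; rewrite lee_fin mulr_ge0 ?nrm_ge0 ?exprn_ge0.
  - apply/measurable_EFinP; apply: measurable_funM.
      apply: measurable_funX; apply: (measurableT_comp (seminorm_measurable nk)).
      exact: (tame_measurableD tV mfst msnd (fun z => V1 z.1) (fun z => V2 z.2)).
    apply: measurable_nrm.
    exact: (conv_density_measurable sigma1 sigma2 mpsi r1 r2 tV V1 V2).
  - by apply: emeasurable_sum => i; exact: measurable_funeM.
  - move=> [x y] _; under eq_bigr do rewrite -EFinM.
    rewrite sumEFin lee_fin /=.
    apply: (@le_trans _ _ ((kappa (X1 x) + kappa (X2 y)) ^+ k *
       (K * (s (X1 x) ^+ j * s (X2 y) ^+ j) * (nrm (u1 x) * nrm (u2 y))))%R).
      apply: ler_pM; rewrite ?exprn_ge0 ?nrm_ge0//.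
        by rewrite lerXn2r ?nnegrE ?addr_ge0.
      by rewrite /conv_density !nrmM /= ler_wpM2r ?mulr_ge0 ?nrm_ge0.
    rewrite exprDn mulr_suml le_eqVlt; apply/orP; left; apply/eqP.
    by apply: eq_bigr => i _; rewrite /A /B -[(_ *+ 'C(k, i))%R]mulr_natr; ring.
rewrite ge0_integral_sum//; last 2 first.
- by move=> i; apply: measurable_funeM.
- by move=> i z _; apply: mule_ge0; rewrite lee_fin ?C0// mulr_ge0.
apply: lee_sum => i _; rewrite ge0_integralZl_EFin//; last first.
- by move=> z _; rewrite lee_fin mulr_ge0.
rewrite lee_wpmul2l// ?lee_fin//.
by rewrite ge0_integral_prod.
Qed.

Hypothesis i1 : P1.-integrable setT (EFin \o (fun w => s (X1 w) ^+ j * nrm (u1 w))%R).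
Hypothesis i2 : P2.-integrable setT (EFin \o (fun w => s (X2 w) ^+ j * nrm (u2 w))%R).

Lemma conv_mom_le kappa k : seminorm kappa ->
  mom kappa k (twisted_convolution (fun f g => psi (sigma f g)) mu1 mu2) <=
  \sum_(i < k.+1) (K * 'C(k, i)%:R)%:E *
    (wmass P1 X1 u1 (fun x => s x ^+ j * kappa x ^+ (k - i))%R *
     wmass P2 X2 u2 (fun x => s x ^+ j * kappa x ^+ i)%R).
Proof.
move=> nk; apply: le_trans (conv_wmass_le k nk).
have r := conv_rep sigma1 sigma2 mpsi psiK r1 r2 tV V1 V2 i1 i2.
rewrite /mom (le_trans (cvariation_integral_le r _ _))//.
- by apply/measurable_EFinP; apply: measurable_funX; exact: seminorm_measurable.
- by move=> x; rewrite lee_fin exprn_ge0//; case: nk.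
Qed.

End convolution_mass.

Section M_E_bases.
Context {R : realType} {E : lmodType R}.
Implicit Types (mu nu rho : set (borel E) -> R[i]) (kappa : E -> R).

Lemma M_E_complex_measure mu : M_E mu -> complex_measure mu.
Proof. by move=> /M_EP[]. Qed.

Lemma rep_M_E d (O : measurableType d) (P : {measure set O -> \bar R}) X u mu V :
  tame V -> (forall w, V (X w)) -> rep P X u mu -> M_E mu.
Proof.
move=> tV VX r; apply/M_EP; split; first exact: rep_complex_measure r.
by exists V => //; exact: rep_concentrated_on r _.
Qed.

Lemma base4 mu1 mu2 mu3 mu4 : M_E mu1 -> M_E mu2 -> M_E mu3 -> M_E mu4 ->
  exists V m u1 u2 u3 u4, [/\ tame V, based V m u1 mu1, based V m u2 mu2,
    based V m u3 mu3 & based V m u4 mu4].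
Proof.
move=> /M_EP[c1 [V1 t1 v1]] /M_EP[c2 [V2 t2 v2]].
move=> /M_EP[c3 [V3 t3 v3]] /M_EP[c4 [V4 t4 v4]].
exact: (common_base t1 t2 t3 t4).
Qed.

Lemma base3 mu1 mu2 mu3 : M_E mu1 -> M_E mu2 -> M_E mu3 ->
  exists V m u1 u2 u3, [/\ tame V, based V m u1 mu1, based V m u2 mu2 &
    based V m u3 mu3].
Proof.
move=> M1 M2 M3.
have [V [m [u1 [u2 [u3 [_ [tV b1 b2 b3 _]]]]]]] := base4 M1 M2 M3 M3.
by exists V, m, u1, u2, u3.
Qed.

Lemma base2 mu1 mu2 : M_E mu1 -> M_E mu2 ->
  exists V m u1 u2, [/\ tame V, based V m u1 mu1 & based V m u2 mu2].
Proof.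
move=> M1 M2; have [V [m [u1 [u2 [_ [tV b1 b2 _]]]]]] := base3 M1 M2 M2.
by exists V, m, u1, u2.
Qed.

Lemma based_M_E V m u mu : tame V -> based V m u mu -> M_E mu.
Proof.
move=> tV [_ _ r]; apply: (rep_M_E tV _ r).
by apply: retract_toP; exact: tame0.
Qed.

Lemma M_E_lin (a : R[i]) mu nu : M_E mu -> M_E nu -> M_E (a *: mu + nu).
Proof.
move=> M1 M2; have [V [m [u [v [tV b1 b2]]]]] := base2 M1 M2.
exact: based_M_E tV (based_lin a b1 b2).
Qed.

Lemma fin_dim_zero : fin_dim_subspace [set 0 : E].
Proof.
exists 0%N, (fun _ => 0).
by apply/seteqP; split=> [_ ->|_ [a _ <-]]; [exists (fun _ => 0)|]; rewrite ?big_ord0.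
Qed.

Lemma M_E0 : M_E (0 : set (borel E) -> R[i]).
Proof.
apply/M_EP; split; first exact: complex_measure0.
exists [set 0]; last by [].
by apply: tame_fin_dim; exact: fin_dim_zero.
Qed.

Lemma lin_subE mu nu : mu - nu = (-1) *: nu + mu.
Proof. by rewrite scaleN1r addrC. Qed.

Lemma M_EB mu nu : M_E mu -> M_E nu -> M_E (mu - nu).
Proof. by move=> M1 M2; rewrite lin_subE; exact: M_E_lin. Qed.

Local Open Scope ereal_scope.

Lemma mom_ge0 kappa k mu : seminorm kappa -> M_E mu -> 0 <= mom kappa k mu.
Proof.
move=> nk M; have [V [m [u [v [tV b1 _]]]]] := base2 M M.
rewrite (mom_based k b1 nk); apply: wmass_ge0 => x; rewrite exprn_ge0//.
by case: nk.
Qed.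

Lemma mom_lin_le kappa k (a : R[i]) mu nu : seminorm kappa -> M_E mu -> M_E nu ->
  mom kappa k (a *: mu + nu)%R <= (nrm a)%:E * mom kappa k mu + mom kappa k nu.
Proof.
move=> nk M1 M2; have [V [m [u [v [tV b1 b2]]]]] := base2 M1 M2.
have b := based_lin a b1 b2; have [k0 _ _] := nk.
have [_ _ [mX [mu' _] _ _]] := b1; have [_ _ [_ [mv' _] _ _]] := b2.
have [_ _ [_ [muv' _] _ _]] := b.
rewrite (mom_based k b nk) (mom_based k b1 nk) (mom_based k b2 nk) /wmass.
have mk : measurable_fun setT (fun x : borel E => kappa (retract_to V 0%R x) ^+ k)%R.
  apply: measurable_funX; exact: (measurableT_comp (seminorm_measurable nk) mX).
have mE (w : borel E -> R[i]) : cmeasurable w -> measurable_fun setT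
    (fun x : borel E => (kappa (retract_to V 0%R x) ^+ k * nrm (w x))%:E).
  move=> mw; apply/measurable_EFinP; apply: measurable_funM => //.
  exact: measurable_nrm.
have pos (w : borel E -> R[i]) x :
    0 <= (kappa (retract_to V 0%R x) ^+ k * nrm (w x))%:E.
  by rewrite lee_fin mulr_ge0 ?exprn_ge0 ?nrm_ge0.
rewrite -ge0_integralZl_EFin ?nrm_ge0//; last exact: mE.
rewrite -ge0_integralD//; last 3 first.
- by move=> x _; apply: mule_ge0; [rewrite lee_fin nrm_ge0|exact: pos].
- by apply: measurable_funeM; exact: mE.
- exact: mE.
apply: ge0_le_integral => //.
- by move=> x _; exact: (pos (fun x => a * u x + v x)%R).
- exact: mE.
- by apply: emeasurable_funD; [apply: measurable_funeM|]; exact: mE.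
move=> x _; rewrite -EFinM -EFinD lee_fin mulrCA -mulrDr ler_wpM2l ?exprn_ge0//.
by rewrite -nrmM nrmD.
Qed.

Lemma mom_0 kappa k : mom kappa k (0%R : set (borel E) -> R[i]) = 0.
Proof.
have [V [m [u [_ [tV b1 _]]]]] := base2 M_E0 M_E0.
have b := based_lin 0%R b1 b1.
rewrite /mom; have [m' mm] := complex_measure_dominated (@complex_measure0 R E).
have r : rep m' (fun x => x) (fun _ => 0%R) (0%R : set (borel E) -> R[i]).
  split => //; first exact: cL1_cst.
  by move=> A mA; under eq_cint do rewrite mulr0; rewrite cint0.
have sE A : measurable A -> cvariation (0%R : set (borel E) -> R[i]) A = mzero A.
  by move=> mA; rewrite (cvariation_density r mA); apply: integral0_eq => x _; rewrite nrm0.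
by rewrite (eq_setfun_integral _ _ sE) integral_measure_zero.
Qed.

Definition admissible (n : option nat) (k : nat) : bool :=
  if n is Some n' then (k <= n')%N else true.

Lemma M_momentP kappa n mu : M_moment kappa n mu <->
  M_E mu /\ forall k, admissible n k -> mom kappa k mu < +oo.
Proof. by []. Qed.

Lemma M_moment_lin kappa n (a : R[i]) mu nu : seminorm kappa ->
  M_moment kappa n mu -> M_moment kappa n nu -> M_moment kappa n (a *: mu + nu)%R.
Proof.
move=> nk [M1 m1] [M2 m2]; apply/M_momentP; split; first exact: M_E_lin.
move=> k nk'; apply: (le_lt_trans (mom_lin_le k a nk M1 M2)).
by rewrite lte_add_pinfty//; [rewrite lte_mul_pinfty ?lee_fin ?nrm_ge0//; exact: m1|exact: m2].
Qed.

Lemma M_moment0 kappa n : M_moment kappa n (0%R : set (borel E) -> R[i]).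
Proof.
by apply/M_momentP; split; [exact: M_E0|move=> k _; rewrite mom_0].
Qed.

Lemma M_momentB kappa n mu nu : seminorm kappa ->
  M_moment kappa n mu -> M_moment kappa n nu -> M_moment kappa n (mu - nu)%R.
Proof. by move=> nk M1 M2; rewrite lin_subE; exact: M_moment_lin. Qed.

(** Reading [norm1] as the moment of order 0 allows all orders to be treated alike. *)
Lemma norm_momentE kappa n mu : seminorm kappa -> M_E mu ->
  (forall k, (k <= n)%N -> mom kappa k mu < +oo) ->
  norm_moment kappa n mu = \sum_(k < n.+1) mom kappa k mu.
Proof.
move=> nk M fin; have cmu := M_E_complex_measure M.
rewrite /norm_moment -(big_mkord xpredT (fun k => mom kappa k mu)).
rewrite big_nat_recl// mom0//; congr (_ + _).
rewrite big_add1 /= big_nat [RHS]big_nat; apply: eq_bigr => k /andP[_ kn].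
apply: norm1_moment_measure => //.
- exact: seminorm_measurable.
- by case: nk.
- exact: fin.
Qed.

End M_E_bases.

Section conv_on_M_E.
Context {R : realType} {E : lmodType R}.
Variables (sigma : E -> E -> R) (s : E -> R).
Hypotheses (sigma1 : forall f, scalar (sigma f))
  (sigma2 : forall g, scalar (sigma ^~ g)) (ns : seminorm s).
Implicit Types (mu nu rho : set (borel E) -> R[i]) (kappa : E -> R).

(** The exponent [j] is 0 for the phases of the star product and 1 for brackets; it tells how many
    moments in [s] a convolution consumes in each factor. *)
Definition good_kernel (psi : measurableTypeR R -> R[i]) (K : R) (j : nat) :=
  [/\ cmeasurable psi, 0 <= K &
    forall f g, nrm (psi (sigma f g)) <= K * (s f ^+ j * s g ^+ j)].

Definition conv (psi : measurableTypeR R -> R[i]) mu nu :=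
  twisted_convolution (fun f g => psi (sigma f g)) mu nu.

Lemma based_integrable V m u mu j : based V m u mu ->
  (mom s j mu < +oo)%E ->
  m.-integrable setT (EFin \o (fun w => s (retract_to V 0 w) ^+ j * nrm (u w))).
Proof.
move=> b fin; have [_ _ r] := b; have [s0 _ _] := ns.
apply/(wmass_integrable r (w := fun x => s x ^+ j)).
- by apply: measurable_funX; exact: seminorm_measurable.
- by move=> x; rewrite exprn_ge0.
- by rewrite -(mom_based j b ns).
Qed.

Section one_kernel.
Variables (psi : measurableTypeR R -> R[i]) (K : R) (j : nat).
Hypothesis gk : good_kernel psi K j.

Lemma conv_based V m u v mu nu : tame V ->
  based V m u mu -> based V m v nu ->
  (mom s j mu < +oo)%E -> (mom s j nu < +oo)%E ->
  rep (m \x m)%E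
    (fun z => (retract_to V 0 z.1 + retract_to V 0 z.2 : E) : borel E)
    (conv_density sigma psi (retract_to V 0 : borel E -> borel E)
      (retract_to V 0 : borel E -> borel E) (u : borel E -> R[i]) v)
    (conv psi mu nu).
Proof.
move=> tV b1 b2 f1 f2; have [mpsi K0 psiK] := gk.
have [_ _ r1] := b1; have [_ _ r2] := b2.
have Vr := retract_toP (tame0 tV).
exact: (conv_rep sigma1 sigma2 mpsi psiK r1 r2 tV Vr Vr
  (based_integrable b1 f1) (based_integrable b2 f2)).
Qed.

Lemma conv_M_E mu nu : M_E mu -> M_E nu ->
  (mom s j mu < +oo)%E -> (mom s j nu < +oo)%E -> M_E (conv psi mu nu).
Proof.
move=> M1 M2 f1 f2; have [V [m [u [v [tV b1 b2]]]]] := base2 M1 M2.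
apply: (rep_M_E tV _ (conv_based tV b1 b2 f1 f2)) => z.
by apply: (tameD tV); apply: retract_toP; exact: tame0.
Qed.

Lemma conv_mom kappa k mu nu : seminorm kappa -> M_E mu -> M_E nu ->
  (mom s j mu < +oo)%E -> (mom s j nu < +oo)%E ->
  (mom kappa k (conv psi mu nu) <=
  \sum_(i < k.+1) (K * 'C(k, i)%:R)%:E *
    ((\int[cvariation mu]_x (s x ^+ j * kappa x ^+ (k - i))%:E) *
     (\int[cvariation nu]_x (s x ^+ j * kappa x ^+ i)%:E)))%E.
Proof.
move=> nk M1 M2 f1 f2; have [V [m [u [v [tV b1 b2]]]]] := base2 M1 M2.
have [mpsi K0 psiK] := gk; have [_ _ r1] := b1; have [_ _ r2] := b2.
have Vr := retract_toP (tame0 tV); have [s0 _ _] := ns; have [k0 _ _] := nk.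
have mw a b : measurable_fun setT (fun x : borel E => s x ^+ a * kappa x ^+ b).
  by apply: measurable_funM; apply: measurable_funX; exact: seminorm_measurable.
have w0 a b x : 0 <= s x ^+ a * kappa x ^+ b by rewrite mulr_ge0 ?exprn_ge0.
apply: (le_trans (conv_mom_le sigma1 sigma2 ns mpsi K0 psiK r1 r2 tV Vr Vr
  (based_integrable b1 f1) (based_integrable b2 f2) k nk)).
apply: lee_sum => i _.
by rewrite (wmass_based b1 (mw j (k - i)%N)) ?(wmass_based b2 (mw j i)).
Qed.

Lemma norm1_conv mu nu : j = 0%N -> M_E mu -> M_E nu ->
  (norm1 (conv psi mu nu) <= K%:E * (norm1 mu * norm1 nu))%E.
Proof.
move=> j0 M1 M2.
have c1 := M_E_complex_measure M1; have c2 := M_E_complex_measure M2.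
have f1 : (mom s j mu < +oo)%E by rewrite j0 mom0// norm1_lty.
have f2 : (mom s j nu < +oo)%E by rewrite j0 mom0// norm1_lty.
have := conv_mom 0 ns M1 M2 f1 f2.
rewrite mom0; last exact/M_E_complex_measure/conv_M_E.
rewrite big_ord1 bin0 mulr1 j0 /=.
have -> : (fun x : borel E => (s x ^+ 0 * s x ^+ (0 - 0))%:E) = (fun x => (cst 1 x)%:E).
  by apply/funext => x; rewrite subnn mulr1.
by rewrite -!norm1_integral.
Qed.

Lemma convZl_D (a : R[i]) mu mu' nu : M_E mu -> M_E mu' -> M_E nu ->
  (mom s j mu < +oo)%E -> (mom s j mu' < +oo)%E -> (mom s j nu < +oo)%E ->
  conv psi (a *: mu + mu') nu = a *: conv psi mu nu + conv psi mu' nu.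
Proof.
move=> M1 M2 M3 f1 f2 f3.
have [V [m [u [v [w [tV b1 b2 b3]]]]]] := base3 M1 M2 M3.
have f12 : (mom s j (a *: mu + mu')%R < +oo)%E.
  apply: (le_lt_trans (mom_lin_le _ a ns M1 M2)).
  by rewrite lte_add_pinfty// lte_mul_pinfty ?lee_fin ?nrm_ge0.
have r1 := conv_based tV b1 b3 f1 f3; have r2 := conv_based tV b2 b3 f2 f3.
have r12 := conv_based tV (based_lin a b1 b2) b3 f12 f3.
apply: (rep_uniq r12); have := rep_lin a r1 r2; congr (rep _ _ _ _).
by apply/funext => z; rewrite /conv_density; ring.
Qed.

Lemma convZr_D (a : R[i]) mu nu nu' : M_E mu -> M_E nu -> M_E nu' ->
  (mom s j mu < +oo)%E -> (mom s j nu < +oo)%E -> (mom s j nu' < +oo)%E ->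
  conv psi mu (a *: nu + nu') = a *: conv psi mu nu + conv psi mu nu'.
Proof.
move=> M1 M2 M3 f1 f2 f3.
have [V [m [u [v [w [tV b1 b2 b3]]]]]] := base3 M1 M2 M3.
have f23 : (mom s j (a *: nu + nu')%R < +oo)%E.
  apply: (le_lt_trans (mom_lin_le _ a ns M2 M3)).
  by rewrite lte_add_pinfty// lte_mul_pinfty ?lee_fin ?nrm_ge0.
have r1 := conv_based tV b1 b2 f1 f2; have r2 := conv_based tV b1 b3 f1 f3.
have r12 := conv_based tV b1 (based_lin a b2 b3) f1 f23.
apply: (rep_uniq r12); have := rep_lin a r1 r2; congr (rep _ _ _ _).
by apply/funext => z; rewrite /conv_density; ring.
Qed.

End one_kernel.

(** This writes linear combinations of products, in particular commutators, as a single convolution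
    with a combined kernel. *)
Lemma conv_kernel_lin psi1 psi2 K1 K2 j (a : R[i]) mu nu :
  good_kernel psi1 K1 j -> good_kernel psi2 K2 j -> M_E mu -> M_E nu ->
  (mom s j mu < +oo)%E -> (mom s j nu < +oo)%E ->
  good_kernel (fun t => a * psi1 t + psi2 t) (nrm a * K1 + K2) j /\
  conv (fun t => a * psi1 t + psi2 t) mu nu = a *: conv psi1 mu nu + conv psi2 mu nu.
Proof.
move=> g1 g2 M1 M2 f1 f2.
have g : good_kernel (fun t => a * psi1 t + psi2 t) (nrm a * K1 + K2) j.
  have [m1 K10 b1] := g1; have [m2 K20 b2] := g2; split.
  - by apply: cmeasurableD => //; apply: cmeasurableM => //; exact: cmeasurable_cst.
  - by rewrite addr_ge0 ?mulr_ge0 ?nrm_ge0.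
  - move=> f h; rewrite (le_trans (nrmD _ _))// mulrDl lerD// nrmM -mulrA.
    by rewrite ler_wpM2l ?nrm_ge0.
split => //; have [V [m [u [v [tV b1 b2]]]]] := base2 M1 M2.
have r1 := conv_based g1 tV b1 b2 f1 f2; have r2 := conv_based g2 tV b1 b2 f1 f2.
apply: (rep_uniq (conv_based g tV b1 b2 f1 f2)); have := rep_lin a r1 r2; congr (rep _ _ _ _).
by apply/funext => z; rewrite /conv_density; ring.
Qed.

Lemma eq_conv psi psi' mu nu : psi =1 psi' -> conv psi mu nu = conv psi' mu nu.
Proof. by move=> /funext ->. Qed.

End conv_on_M_E.

(** * Products and brackets *)

Section norm1_metric.
Context {R : realType} {E : lmodType R}.
Implicit Types (mu nu rho : set (borel E) -> R[i]).
Local Open Scope ereal_scope.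

Lemma norm1N mu : norm1 (- mu)%R = norm1 mu.
Proof.
rewrite /norm1 /cvariation; congr ereal_sup; apply/seteqP.
have E1 n (F : 'I_n -> set (borel E)) : (\sum_(i < n) complex.Re `|(- mu) (F i)|
    = \sum_(i < n) complex.Re `|mu (F i)|)%R.
  by apply: eq_bigr => i _; rewrite [(- mu)%R _](_ : _ = - mu (F i))%R// normrN.
by split=> _ [n [F [mF tF FA ->]]]; exists n, F; rewrite E1.
Qed.

Lemma norm1_distC mu nu : norm1 (mu - nu)%R = norm1 (nu - mu)%R.
Proof. by rewrite -norm1N opprB. Qed.

Lemma norm1_ge0 mu : 0 <= norm1 mu.
Proof.
apply: (@le_trans _ _ (nrm (mu set0))%:E); first by rewrite lee_fin nrm_ge0.
by apply: (le_trans (nrm_cvariation mu measurable0)); exact: le_cvariation.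
Qed.

Lemma norm1D mu nu : M_E mu -> M_E nu -> norm1 (mu + nu)%R <= norm1 mu + norm1 nu.
Proof.
move=> M1 M2; have := mom_lin_le 0 1%R (@seminorm0 R E) M1 M2.
rewrite scale1r nrm1 mul1e !mom0//; try exact: M_E_complex_measure.
by apply: M_E_complex_measure; rewrite -[mu]scale1r; exact: M_E_lin.
Qed.

Lemma norm1_eq0 mu nu : complex_measure mu -> complex_measure nu ->
  norm1 (mu - nu)%R = 0 -> mu = nu.
Proof.
move=> [mu0 _ _ _] [nu0 _ _ _] d0; apply/funext => A.
have [mA|nA] := pselect (measurable A); last by rewrite mu0// nu0.
apply/eqP; rewrite -subr_eq0; apply/eqP; apply: nrm_eq0.
apply/eqP; rewrite eq_le nrm_ge0 andbT -lee_fin.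
rewrite [X in (nrm X)%:E](_ : _ = (mu - nu)%R A)//.
apply: (le_trans (nrm_cvariation _ mA)); rewrite -[leRHS]/(0%R : \bar R) -d0.
exact: le_cvariation.
Qed.

Lemma M_fin_M_E F mu : fin_dim_subspace F -> M_fin F mu -> M_E mu.
Proof.
move=> fF [cmu cF]; apply/M_EP; split => //.
by exists F => //; exact: tame_fin_dim.
Qed.

Lemma norm1_cvg0 mu (nu : nat -> set (borel E) -> R[i]) :
  (forall n, norm1 (mu - nu n)%R < (n.+1%:R^-1)%:E) ->
  norm1 (nu k - mu)%R @[k --> \oo] --> 0.
Proof.
move=> lim; apply: (@squeeze_cvge _ _ _ _ (fun=> 0) _ (fun n => (n.+1%:R^-1)%:E)).
- by apply: nearW => n; rewrite norm1_ge0/= norm1_distC ltW.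
- exact: cvg_cst.
- by apply: cvg_EFin; [exact: nearW|exact: cvg_harmonic].
Qed.

End norm1_metric.

(** * Kernels of the star product and of the bracket *)

Section kernels.
Context {R : realType} {E : lmodType R}.
Variables (sigma : E -> E -> R) (s : E -> R) (c : R).
Hypotheses (c0 : 0 < c)
  (sigma_bound : forall f g, `|sigma f g| <= c * s f * s g).
Implicit Types (h t : R).

Definition ekernel h (t : measurableTypeR R) : R[i] := expi (- (2^-1 * h * t)).

Lemma nrm_expi t : nrm (expi t) = 1.
Proof. by rewrite /nrm normc_def /expi /= cos2Dsin2 sqrtr1. Qed.

Lemma ekernel_good h : good_kernel sigma s (ekernel h) 1 0.
Proof.
split => // [|f g]; last by rewrite nrm_expi !expr0 !mulr1.
have ml : measurable_fun setT (fun t : R => - (2^-1 * h * t)).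
  by apply: measurable_funN; apply: measurable_funM; first exact: measurable_cst.
split.
  apply: (measurableT_comp (f := @cos R)) => //.
  by apply: continuous_measurable_fun; exact: continuous_cos.
apply: (measurableT_comp (f := @sin R)) => //.
by apply: continuous_measurable_fun; exact: continuous_sin.
Qed.

(** The scaled commutator of phases: [i / h] times the difference of [exp (- i h t / 2)] and
    [exp (i h t / 2)] is [2 / h * sin (h t / 2)], extended by its limit [t] at [h = 0]. *)
Definition bfun h (t : R) : R := if h == 0 then t else 2 / h * sin (2^-1 * h * t).

Definition bkernel h (t : measurableTypeR R) : R[i] := (bfun h t)%:C%C.

Lemma normr_sin_le t : `|sin t| <= `|t|.
Proof.
wlog t0 : t / 0 <= t.
  move=> H; have [/H//|/ltW] := leP 0 t.
  by rewrite -oppr_ge0 => /H; rewrite sinN !normrN.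
have [->|tn0] := eqVneq t 0; first by rewrite sin0 normr0.
have tgt0 : 0 < t by rewrite lt_neqAle eq_sym tn0.
have [|x xt] := @MVT R sin cos 0 t tgt0 (fun x _ => is_derive_sin x).
  by apply: continuous_subspaceT; exact: continuous_sin.
rewrite sin0 !subr0 => ->; rewrite normrM ler_piMl//.
by rewrite ler_norml cos_geN1 cos_le1.
Qed.

(** A bound uniform in [h], from [|sin x| <= |x|]: all brackets thus share the constant [c], which
    supplies both the norm estimate and the dominating function when [h] varies. *)
Lemma bfun_le h t : `|bfun h t| <= `|t|.
Proof.
rewrite /bfun; case: eqVneq => // h0.
rewrite normrM (le_trans (ler_wpM2l _ (normr_sin_le _)))//.
rewrite -normrM (_ : 2 / h * _ = t)//.
by field.
Qed.

Lemma bkernel_good h : good_kernel sigma s (bkernel h) c 1.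
Proof.
split; [|exact: ltW|]; last first.
  by move=> f g; rewrite nrm_real !expr1 mulrA (le_trans (bfun_le _ _)).
  apply: cmeasurable_real; rewrite /bfun; case: (h == 0).
    exact: measurable_id.
  apply: measurable_funM; first exact: measurable_cst.
  apply: (measurableT_comp (f := @sin R)).
    by apply: continuous_measurable_fun; exact: continuous_sin.
  by apply: measurable_funM; first exact: measurable_cst.
Qed.

Lemma bkernelE h t : h != 0 ->
  bkernel h t = ('i / h%:C)%C * (ekernel h t - ekernel h (- t)).
Proof.
move=> h0; rewrite /bkernel /bfun (negbTE h0) /ekernel mulrN opprK.
set x := 2^-1 * h * t.
have -> : expi (- x) - expi x = (0 +i* (- 2 * sin x))%C.
  apply: complex_eqP; rewrite ?ReD ?ImD ?ReN ?ImN /expi /= ?cosN ?sinN; first by rewrite subrr.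
  by ring.
have -> : (h%:C^-1)%C = (h^-1)%:C%C :> R[i] by rewrite fmorphV.
apply: complex_eqP; rewrite ?ReM ?ImM /=.
  by ring.
by ring.
Qed.

End kernels.

(** * The adjoint of a measure *)

Section adjoint.
Context {R : realType} {E : lmodType R}.
Implicit Types (mu nu rho : set (borel E) -> R[i]).

Lemma opp_image (A : set E) : [set - x | x in A] = (fun x => - x) @^-1` A.
Proof.
apply/seteqP; split=> [_ [x Ax <-]|x Ax]; first by rewrite /= opprK.
by exists (- x) => //; rewrite opprK.
Qed.

Lemma measurable_opp_image (A : set (borel E)) :
  measurable ([set - x | x in A : set E] : set (borel E)) <-> measurable A.
Proof.
have key (B : set (borel E)) : measurable B ->
    measurable ([set - x | x in B : set E] : set (borel E)).
  move=> mB; rewrite opp_image -[X in measurable X]setTI.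
  exact: (@measurable_opp R E measurableT).
split=> [/key|]; last exact: key.
congr measurable; apply/seteqP; split=> [_ [_ [x Ax <-] <-]|x Ax].
  by rewrite opprK.
by exists (- x); rewrite ?opprK//; exists x.
Qed.

Lemma rep_adjoint d (O : measurableType d) (P : {measure set O -> \bar R}) X u mu :
  rep P X u mu ->
  rep P (fun w => (- X w : E) : borel E) (fun w => (u w)^*%C) (adjoint mu).
Proof.
move=> [mX [mu' iu] muE mu0]; split.
- exact: (measurableT_comp (@measurable_opp R E) mX).
- split; first exact: cmeasurableJ.
  by apply: eq_integrable iu => // w _ /=; rewrite nrmJ.
- move=> A mA; rewrite /adjoint muE; last exact/measurable_opp_image.
  rewrite -cintJ.
    apply: eq_cint => w; apply: complex_eqP; rewrite ?ReJ ?ImJ ?ReM ?ImM ?ReJ ?ImJ;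
    rewrite !Re_indic !Im_indic !indicE opp_image.
      by rewrite !mul0r !subr0.
    by rewrite !mul0r !addr0 mulrN.
  have mA' : measurable (X @^-1` ([set - x | x in A : set E])).
    by rewrite -[Y in measurable Y]setTI; apply: mX => //; exact/measurable_opp_image.
  exact: (cL1_indic (conj mu' iu) mA').
- move=> A nA; rewrite /adjoint mu0 ?conjc0//.
  by move/measurable_opp_image.
Qed.

Lemma adjointK mu : adjoint (adjoint mu) = mu.
Proof.
apply/funext => A; rewrite /adjoint conjcK; congr mu.
apply/seteqP; split=> [_ [_ [x Ax <-] <-]|x Ax]; first by rewrite opprK.
by exists (- x); rewrite ?opprK//; exists x.
Qed.

Lemma adjoint_lin (a : R[i]) mu nu :
  adjoint (a *: mu + nu) = (a^*)%C *: adjoint mu + adjoint nu.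
Proof.
apply/funext => A; rewrite /adjoint.
rewrite [((a *: mu + nu) _)](_ : _ = a * mu [set - x | x in A] + nu [set - x | x in A])//.
by rewrite rmorphD rmorphM.
Qed.

Lemma adjoint_concentrated (D : set E) mu : concentrated_on D mu ->
  concentrated_on [set - x | x in D] (adjoint mu).
Proof.
move=> cD A mA AD; rewrite /adjoint cD ?conjc0//; first exact/measurable_opp_image.
apply/seteqP; split=> // _ [[x Ax <-] Dx].
have : (A `&` [set - x0 | x0 in D]) x.
  by split => //; exists (- x) => //; rewrite opprK.
by rewrite AD.
Qed.

Lemma adjoint_M_E mu : M_E mu -> M_E (adjoint mu).
Proof.
move=> M; have [V [m [u [_ [tV [_ _ r] _]]]]] := base2 M M.
apply: (rep_M_E tV _ (rep_adjoint r)) => x; apply: (tameN tV).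
by apply: retract_toP; exact: tame0.
Qed.

Lemma adjoint_mom kappa k mu : seminorm kappa -> M_E mu ->
  (mom kappa k (adjoint mu) <= mom kappa k mu)%E.
Proof.
move=> nk M; have [V [m [u [_ [tV b _]]]]] := base2 M M.
have [_ _ r] := b; rewrite (mom_based k b nk).
rewrite (le_trans (cvariation_integral_le (rep_adjoint r) _ _))//.
- by apply/measurable_EFinP; apply: measurable_funX; exact: seminorm_measurable.
- by move=> x; rewrite lee_fin exprn_ge0//; case: nk.
rewrite /wmass le_eqVlt; apply/orP; left; apply/eqP; apply: eq_integral => x _.
by rewrite nrmJ (seminormN _ nk).
Qed.

Lemma adjoint_M_moment kappa n mu : seminorm kappa ->
  M_moment kappa n mu -> M_moment kappa n (adjoint mu).
Proof.
move=> nk [M mm]; apply/M_momentP; split; first exact: adjoint_M_E.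
by move=> k nk'; apply: (le_lt_trans (adjoint_mom k nk M)); exact: mm.
Qed.

End adjoint.

(** * The star product as an extension by continuity *)

Section star.
Context {R : realType} {E : lmodType R}.
Variables (sigma : E -> E -> R) (s : E -> R).
Hypotheses (sigma1 : forall f, scalar (sigma f))
  (sigma2 : forall g, scalar (sigma ^~ g)) (sigmaA : forall f g, sigma f g = - sigma g f)
  (ns : seminorm s).
Implicit Types (mu nu rho : set (borel E) -> R[i]) (kappa : E -> R).

Lemma mom_0_lty mu : M_E mu -> (mom s 0 mu < +oo)%E.
Proof.
by move=> M; rewrite mom0 ?norm1_lty//; exact: M_E_complex_measure.
Qed.

Section kernel.
Variables (psi : measurableTypeR R -> R[i]) (K : R) (j : nat).
Hypothesis gk : good_kernel sigma s psi K j.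
Let T := conv sigma psi.

Lemma convBl mu mu' nu : M_E mu -> M_E mu' -> M_E nu ->
  (mom s j mu < +oo)%E -> (mom s j mu' < +oo)%E -> (mom s j nu < +oo)%E ->
  T (mu - mu') nu = T mu nu - T mu' nu.
Proof.
move=> M1 M2 M3 f1 f2 f3; rewrite !lin_subE.
exact: (convZl_D sigma1 sigma2 ns gk).
Qed.

Lemma convBr mu nu nu' : M_E mu -> M_E nu -> M_E nu' ->
  (mom s j mu < +oo)%E -> (mom s j nu < +oo)%E -> (mom s j nu' < +oo)%E ->
  T mu (nu - nu') = T mu nu - T mu nu'.
Proof.
move=> M1 M2 M3 f1 f2 f3; rewrite !lin_subE.
exact: (convZr_D sigma1 sigma2 ns gk).
Qed.

Lemma mom_sub_lty mu nu : M_E mu -> M_E nu ->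
  (mom s j mu < +oo)%E -> (mom s j nu < +oo)%E -> (mom s j (mu - nu)%R < +oo)%E.
Proof.
move=> M1 M2 f1 f2; rewrite lin_subE.
apply: (le_lt_trans (mom_lin_le _ (-1) ns M2 M1)).
by rewrite lte_add_pinfty// lte_mul_pinfty ?lee_fin ?nrm_ge0.
Qed.

(** The expansion of a bilinear map around [(mu, nu)]: apart from the differences only the fixed
    measures occur, so continuity estimates involve only their norms. *)
Lemma conv_diff mu nu mu' nu' : M_E mu -> M_E nu -> M_E mu' -> M_E nu' ->
  (mom s j mu < +oo)%E -> (mom s j nu < +oo)%E ->
  (mom s j mu' < +oo)%E -> (mom s j nu' < +oo)%E ->
  T mu' nu' - T mu nu =
    T (mu' - mu) (nu' - nu) + (T (mu' - mu) nu + T mu (nu' - nu)).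
Proof.
move=> M1 M2 M3 M4 f1 f2 f3 f4.
have M31 := M_EB M3 M1; have f31 := mom_sub_lty M3 M1 f3 f1.
have M42 := M_EB M4 M2; have f42 := mom_sub_lty M4 M2 f4 f2.
rewrite (convBr M31 M4 M2)// (convBr M1 M4 M2)// !(convBl M3 M1)//.
by rewrite addrA subrK addrA subrK.
Qed.

(** Exchanging the order of integration swaps the arguments of [sigma], and antisymmetry moves this
    into the sign of the argument of [psi]. *)
Lemma conv_swap mu nu : M_E mu -> M_E nu ->
  (mom s j mu < +oo)%E -> (mom s j nu < +oo)%E ->
  good_kernel sigma s (fun t => psi (- t : R)) K j /\
  conv sigma (fun t => psi (- t : R)) nu mu = T mu nu.
Proof.
move=> M1 M2 f1 f2; have [mpsi K0 psiK] := gk.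
have g : good_kernel sigma s (fun t => psi (- t : R)) K j.
  split => //; last first.
    by move=> f h; rewrite -sigmaA [_ ^+ j * _]mulrC.
  have [h1 h2] := mpsi; split.
    apply: (measurableT_comp (f := fun t : measurableTypeR R => complex.Re (psi t)) h1).
    exact: oppr_measurable.
  apply: (measurableT_comp (f := fun t : measurableTypeR R => complex.Im (psi t)) h2).
  exact: oppr_measurable.
split => //; have [V [m [u [v [tV b1 b2]]]]] := base2 M1 M2.
have r1 := conv_based sigma1 sigma2 ns gk tV b1 b2 f1 f2.
have r2 := conv_based sigma1 sigma2 ns g tV b2 b1 f2 f1.
have ia := based_integrable ns b1 f1; have ib := based_integrable ns b2 f2.
have [_ [md _] E1 n1] := r1; have [_ _ E2 n2] := r2.
rewrite /T; apply/funext => A.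
have [mA|nA] := pselect (measurable A); last by rewrite n1// n2.
rewrite E1// E2//.
pose p : borel E -> borel E := retract_to V 0.
pose G (z : borel E * borel E) := \1_A (p z.1 + p z.2 : E) *
  conv_density sigma psi p p u v z.
have Vr := retract_toP (tame0 tV).
have [_ _ [mp _ _ _]] := b1.
have mfst : measurable_fun setT (fun z : borel E * borel E => p z.1).
  exact: (measurableT_comp mp (@measurable_fst _ _ _ _)).
have msnd : measurable_fun setT (fun z : borel E * borel E => p z.2).
  exact: (measurableT_comp mp (@measurable_snd _ _ _ _)).
have mG : cmeasurable G.
  apply: cmeasurableM => //.
  exact: (indicD_measurable tV mA mfst msnd (fun z => Vr z.1) (fun z => Vr z.2)).
pose a x := K * (s (p x) ^+ j * nrm (u x)).
have iKa : m.-integrable setT (EFin \o a) by exact: integrableZr_EFin.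
have GB x y : nrm (G (x, y)) <= a x * (s (p y) ^+ j * nrm (v y)).
  rewrite /G nrmM nrm_indic (le_trans _ (conv_density_bound psiK p p u v x y))//.
  by rewrite ler_piMl ?nrm_ge0// indicE; case: (_ \in _).
rewrite -(cint_fubini2 iKa ib mG GB).
pose G' (z : borel E * borel E) := \1_A (p z.1 + p z.2 : E) *
  conv_density sigma (fun t => psi (- t : R)) p p v u z.
have G'E x y : G' (x, y) = G (y, x).
  rewrite /G' /G /conv_density /= -sigmaA; congr (_ * (_ * _)).
    by rewrite addrC.
  by rewrite mulrC.
have mG' : cmeasurable G'.
  have [_ [md' _] _ _] := r2; apply: cmeasurableM => //.
  exact: (indicD_measurable tV mA mfst msnd (fun z => Vr z.1) (fun z => Vr z.2)).
have G'B x y : nrm (G' (x, y)) <= (s (p x) ^+ j * nrm (v x)) * a y.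
  by rewrite G'E mulrC.
rewrite -(cint_fubini1 ib iKa mG' G'B).
by apply: eq_cint => x; apply: eq_cint => y; rewrite G'E.
Qed.

(** Since [sigma (- f) (- g) = sigma f g], reflecting both measures leaves the argument of the
    kernel alone; only its value is conjugated. *)
Lemma conv_adjoint mu nu : M_E mu -> M_E nu ->
  (mom s j mu < +oo)%E -> (mom s j nu < +oo)%E ->
  conv sigma (fun t => (psi t)^*%C) (adjoint mu) (adjoint nu) = adjoint (T mu nu).
Proof.
move=> M1 M2 f1 f2; have [mpsi K0 psiK] := gk.
have [V [m [u [v [tV b1 b2]]]]] := base2 M1 M2.
have r := rep_adjoint (conv_based sigma1 sigma2 ns gk tV b1 b2 f1 f2).
have Vr x : V (- retract_to V 0 x).
  by apply: (tameN tV); apply: retract_toP; exact: tame0.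
have adj_int w tau : based V m w tau -> (mom s j tau < +oo)%E ->
    m.-integrable setT (EFin \o (fun x => s (- retract_to V 0 x) ^+ j * nrm (w x)^*%C)).
  move=> b f; apply: eq_integrable (based_integrable ns b f) => // x _ /=.
  by rewrite nrmJ (seminormN _ ns).
have [_ _ r1] := b1; have [_ _ r2] := b2.
have psiK' f g : nrm (psi (sigma f g))^*%C <= K * (s f ^+ j * s g ^+ j).
  by rewrite nrmJ.
have r' := conv_rep sigma1 sigma2 (cmeasurableJ mpsi) psiK' (rep_adjoint r1)
  (rep_adjoint r2) tV Vr Vr (adj_int _ _ b1 f1) (adj_int _ _ b2 f2).
apply: (rep_uniq r'); move: r; congr (rep _ _ _ _).
  by apply/funext => z; rewrite opprD.
apply/funext => z; rewrite /conv_density !rmorphM/=; congr ((psi _)^*%C * _).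
by rewrite -[- retract_to V 0 z.1]scaleN1r -[- retract_to V 0 z.2]scaleN1r
  (scalarZ _ _ (sigma1 _)) (scalarZ (phi := sigma ^~ _) _ _ (sigma2 _)) !mulN1r opprK.
Qed.

End kernel.

Lemma star_fin_conv h mu nu : star_fin sigma h mu nu = conv sigma (ekernel h) mu nu.
Proof. by []. Qed.

(** Phases have modulus 1, so the norm of a product is at most the product of the norms; together
    with [conv_diff] this is the continuity demanded of the extension. *)
Lemma conv_star_spec h mu nu : M_E mu -> M_E nu ->
  star_spec sigma h mu nu (conv sigma (ekernel h) mu nu).
Proof.
move=> M1 M2; have gk := ekernel_good sigma s h.
have f1 := mom_0_lty M1; have f2 := mom_0_lty M2.
have cM mu1 mu2 : M_E mu1 -> M_E mu2 -> M_E (conv sigma (ekernel h) mu1 mu2).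
  move=> M3 M4; exact: (conv_M_E sigma1 sigma2 ns gk M3 M4 (mom_0_lty M3) (mom_0_lty M4)).
split; first exact: cM.
move=> F mu_ nu_ Fk cmu cnu.
have M3 k : M_E (mu_ k) by case: (Fk k) => fF mF _; exact: M_fin_M_E mF.
have M4 k : M_E (nu_ k) by case: (Fk k) => fF _ mF; exact: M_fin_M_E mF.
have nb mu1 mu2 : M_E mu1 -> M_E mu2 ->
    (norm1 (conv sigma (ekernel h) mu1 mu2) <= norm1 mu1 * norm1 mu2)%E.
  move=> N1 N2; have := norm1_conv sigma1 sigma2 ns gk erefl N1 N2.
  by rewrite mul1e.
have fin (tau : set (borel E) -> R[i]) : M_E tau -> norm1 tau \is a fin_num.
  move=> N; rewrite ge0_fin_numE ?norm1_ge0 ?norm1_lty//.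
  exact: M_E_complex_measure.
apply: (@squeeze_cvge _ _ _ _ (fun=> 0%E) _ (fun k =>
  norm1 (mu_ k - mu)%R * norm1 (nu_ k - nu)%R +
  (norm1 (mu_ k - mu)%R * norm1 nu + norm1 mu * norm1 (nu_ k - nu)%R))%E).
- apply: nearW => k; rewrite norm1_ge0/= star_fin_conv.
  rewrite (conv_diff gk M1 M2 (M3 k) (M4 k) f1 f2 (mom_0_lty (M3 k)) (mom_0_lty (M4 k))).
  have D1 := M_EB (M3 k) M1; have D2 := M_EB (M4 k) M2.
  have MD (tau tau' : set (borel E) -> R[i]) : M_E tau -> M_E tau' -> M_E (tau + tau').
    by move=> N1 N2; rewrite -[tau]scale1r; exact: M_E_lin.
  have N2 := MD _ _ (cM _ _ D1 M2) (cM _ _ M1 D2).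
  apply: (le_trans (norm1D (cM _ _ D1 D2) N2)); apply: leeD; first exact: nb.
  by apply: (le_trans (norm1D (cM _ _ D1 M2) (cM _ _ M1 D2))); apply: leeD; exact: nb.
- exact: cvg_cst.
- have -> : 0%E = (0 * 0 + (0 * norm1 nu + norm1 mu * 0) : \bar R)%E.
    by rewrite !(mul0e, mule0) !adde0.
  apply: cvgeD; first by rewrite !(mul0e, mule0) adde0.
    by apply: cvgeM => //; rewrite mule_def_fin.
  apply: cvgeD; first by rewrite !(mul0e, mule0).
    by apply: cvgeZr => //; exact: fin.
  by apply: cvgeZl => //; exact: fin.
Qed.

(** Both candidates are limits of the same sequence of products. The approximants of [mu] and of
    [nu] come from different subspaces, hence the passage to the sums [H k]. *)
Lemma star_spec_uniq h mu nu rho rho' : M_E mu -> M_E nu ->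
  star_spec sigma h mu nu rho -> star_spec sigma h mu nu rho' -> rho = rho'.
Proof.
move=> M1 M2 [Mr lr] [Mr' lr'].
have [F [mu_ [fF Fmu limmu]]] := norm1_closure_approx M1.
have [G [nu_ [fG Gnu limnu]]] := norm1_closure_approx M2.
pose H k := [set x + y | x in F k & y in G k].
have FH k : F k `<=` H k.
  move=> x Fx; exists x => //; exists 0; last by rewrite addr0.
  by have [] := fin_dim_subP (fG k).
have GH k : G k `<=` H k.
  move=> x Gx; exists 0; last by exists x; rewrite ?add0r.
  by have [] := fin_dim_subP (fF k).
have Hk k : [/\ fin_dim_subspace (H k), M_fin (H k) (mu_ k) & M_fin (H k) (nu_ k)].
  split; first exact: fin_dim_add.
    by case: (Fmu k) => cm cF; split => //; exact: concentratedS cF.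
  by case: (Gnu k) => cm cG; split => //; exact: concentratedS cG.
have l1 := lr _ _ _ Hk (norm1_cvg0 limmu) (norm1_cvg0 limnu).
have l2 := lr' _ _ _ Hk (norm1_cvg0 limmu) (norm1_cvg0 limnu).
apply: norm1_eq0; [exact: M_E_complex_measure|exact: M_E_complex_measure|].
apply/eqP; rewrite eq_le norm1_ge0 andbT.
have gk := ekernel_good sigma s h.
have Mx k : M_E (star_fin sigma h (mu_ k) (nu_ k)).
  have [fH h1 h2] := Hk k; have N1 := M_fin_M_E fH h1; have N2 := M_fin_M_E fH h2.
  exact: (conv_M_E sigma1 sigma2 ns gk N1 N2 (mom_0_lty N1) (mom_0_lty N2)).
have l12 : (norm1 (star_fin sigma h (mu_ k) (nu_ k) - rho)%R +
    norm1 (star_fin sigma h (mu_ k) (nu_ k) - rho')%R @[k --> \oo] --> 0)%E.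
  by rewrite -[X in _ --> X]adde0; apply: cvgeD.
rewrite -(cvg_lim _ l12)//.
apply: lime_ge; first by apply/cvg_ex; exists 0%E.
apply: nearW => k.
set x := star_fin _ _ _ _.
have -> : rho - rho' = (x - rho') + - (x - rho).
  by rewrite [RHS]addrC opprB addrA subrK.
have N1 : M_E (x - rho') by apply: M_EB => //; exact: Mx.
have N2 : M_E (- (x - rho)) by rewrite opprB; apply: M_EB => //; exact: Mx.
by apply: (le_trans (norm1D N1 N2)); rewrite norm1N addeC.
Qed.

Lemma starE h mu nu : M_E mu -> M_E nu ->
  star sigma h mu nu = conv sigma (ekernel h) mu nu.
Proof.
move=> M1 M2; apply: (star_spec_uniq M1 M2 (h := h)); last exact: conv_star_spec.
rewrite /star; apply: xgetPex; exists (conv sigma (ekernel h) mu nu).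
exact: conv_star_spec.
Qed.

End star.

(** A scaled commutator has coefficients [a] and [- a], while [conv_kernel_lin] leaves the second
    coefficient equal to 1; using it twice, with -1 and then with [a - 1], produces
    [a *: (x - y)]. *)
Lemma scale_sub_lin (R : pzRingType) (V : lmodType R) (a : R) (x y z w : V) :
  z = -1 *: y + x -> w = (a - 1) *: z + z -> a *: (x - y) = w.
Proof.
by move=> -> ->; rewrite scalerBl scale1r subrK scaleN1r addrC.
Qed.

Section bracket.
Context {R : realType} {E : lmodType R}.
Variables (sigma : E -> E -> R) (s : E -> R) (c : R).
Hypotheses (sigma1 : forall f, scalar (sigma f))
  (sigma2 : forall g, scalar (sigma ^~ g)) (sigmaA : forall f g, sigma f g = - sigma g f)
  (ns : seminorm s) (c0 : 0 < c)
  (sigma_bound : forall f g, `|sigma f g| <= c * s f * s g).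
Implicit Types (mu nu rho : set (borel E) -> R[i]) (kappa : E -> R).

Lemma bracket0E mu nu : bracket0 sigma mu nu = conv sigma (bkernel 0) mu nu.
Proof. by rewrite /bracket0 /conv /bkernel /bfun eqxx. Qed.

(** By [conv_swap] the product with exchanged factors is a convolution of [mu] with [nu] whose
    kernel has the opposite argument, so the commutator is a single convolution. *)
Lemma bracketE h mu nu : M_E mu -> M_E nu ->
  bracket sigma h mu nu = conv sigma (bkernel h) mu nu.
Proof.
move=> M1 M2; rewrite /bracket; case: eqVneq => [->|h0]; first exact: bracket0E.
rewrite !(starE sigma1 sigma2 ns)//.
have gk := ekernel_good sigma s h.
have f1 := mom_0_lty s M1; have f2 := mom_0_lty s M2.
have [g' <-] := conv_swap sigma1 sigma2 sigmaA ns gk M2 M1 f2 f1.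
have [g1 E1] := conv_kernel_lin sigma1 sigma2 ns (-1) g' gk M1 M2 f1 f2.
have [g2 E2] := conv_kernel_lin sigma1 sigma2 ns ('i / h%:C - 1)%C g1 g1 M1 M2 f1 f2.
rewrite (scale_sub_lin E1 E2); apply: eq_conv => t; rewrite (bkernelE _ h0).
by rewrite mulN1r mulrBl mul1r subrK addrC.
Qed.

End bracket.

(** * Iterated convolutions *)

Lemma cmeasurable_comp d d' (T : measurableType d) (T' : measurableType d')
    (R : realType) (f : T -> R[i]) (g : T' -> T) :
  cmeasurable f -> measurable_fun setT g -> cmeasurable (fun x => f (g x)).
Proof.
by move=> [f1 f2] mg; split; apply: (measurableT_comp (f := _ \o f)).
Qed.

Section product_sigma_finite.
Context d1 d2 (T1 : measurableType d1) (T2 : measurableType d2) (R : realType).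
Variables (P : {sigma_finite_measure set T1 -> \bar R})
  (Q : {sigma_finite_measure set T2 -> \bar R}).
Local Open Scope ereal_scope.

(* [P \x Q] under a name of its own, because the canonical instances of the
   library do not make it a sigma-finite measure. *)
Definition product_sigma_finite := P \x Q.

HB.instance Definition _ := Measure.copy product_sigma_finite (P \x Q).

Let sigma_finite_product : sigma_finite setT product_sigma_finite.
Proof.
have /sigma_finiteP[F [TF ndF Foo]] := sigma_finiteT P.
have /sigma_finiteP[G [TG ndG Goo]] := sigma_finiteT Q.
exists (fun n => F n `*` G n).
  apply/seteqP; split=> // -[x y] _.
  have [n _ Fx] : (\bigcup_i F i) x by rewrite -TF.
  have [k _ Gy] : (\bigcup_i G i) y by rewrite -TG.
  exists (maxn n k) => //; split => /=.
    by move: x Fx; apply/subsetPset/ndF/leq_maxl.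
  by move: y Gy; apply/subsetPset/ndG/leq_maxr.
move=> k; have [mFk Fk] := Foo k; have [mGk Gk] := Goo k.
split; first exact: measurableX.
by rewrite /product_sigma_finite product_measure1E// lte_mul_pinfty// ge0_fin_numE.
Qed.

HB.instance Definition _ := Measure_isSigmaFinite.Build _ _ _
  product_sigma_finite sigma_finite_product.

End product_sigma_finite.

Section dominated3.
Context d (T : measurableType d) {R : realType}.
Variable m : {sigma_finite_measure set T -> \bar R}.
Variables (F : T -> T -> T -> R[i]) (a b c : T -> R).
Hypotheses (ia : m.-integrable setT (EFin \o a)) (ib : m.-integrable setT (EFin \o b))
  (ic : m.-integrable setT (EFin \o c)).
Hypothesis mF : cmeasurable (fun z : T * (T * T) => F z.1 z.2.1 z.2.2).
Hypothesis Fabc : forall x y z, nrm (F x y z) <= a x * (b y * c z).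

Let mpair (f g h : T * (T * T) -> T) : measurable_fun setT f ->
  measurable_fun setT g -> measurable_fun setT h ->
  cmeasurable (fun z => F (f z) (g z) (h z)).
Proof.
move=> mf mg mh.
apply: (cmeasurable_comp (g := fun z => (f z, (g z, h z))) mF).
by apply: measurable_fun_pair => //; exact: measurable_fun_pair.
Qed.

Let m1 : measurable_fun setT (fun z : T * (T * T) => z.1).
Proof. exact: measurable_fst. Qed.
Let m2 : measurable_fun setT (fun z : T * (T * T) => z.2.1).
Proof. exact: (measurableT_comp (@measurable_fst _ _ _ _) (@measurable_snd _ _ _ _)). Qed.
Let m3 : measurable_fun setT (fun z : T * (T * T) => z.2.2).
Proof. exact: (measurableT_comp (@measurable_snd _ _ _ _) (@measurable_snd _ _ _ _)). Qed.

Lemma cmeasurable_swap12 : cmeasurable (fun z : T * (T * T) => F z.2.1 z.1 z.2.2).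
Proof. exact: mpair. Qed.

Lemma cmeasurable_swap23 : cmeasurable (fun z : T * (T * T) => F z.1 z.2.2 z.2.1).
Proof. exact: mpair. Qed.

Let ibc : (product_sigma_finite m m).-integrable setT
  (EFin \o (fun z : T * T => b z.1 * c z.2)).
Proof. exact: integrable_prod. Qed.

Lemma cL1_triple : cL1 (m \x product_sigma_finite m m)%E (fun z => F z.1 z.2.1 z.2.2).
Proof.
by apply: (cL1_prod ia ibc mF) => x [y z]; exact: Fabc.
Qed.

Let G x y z : nrm (F x y z) <= b y * (a x * c z).
Proof. by rewrite mulrCA. Qed.

Let mx x : cmeasurable (fun z : T * T => F x z.1 z.2).
Proof. exact: (cmeasurable_comp (g := fun z : T * T => (x, z)) mF (measurable_pair1 x)). Qed.

Lemma cint_triple : cint (m \x product_sigma_finite m m)%E (fun z => F z.1 z.2.1 z.2.2) =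
  cint m (fun x => cint m (fun y => cint m (fun z => F x y z))).
Proof.
rewrite -(cint_fubini1 ia ibc mF); last by move=> x [y z]; exact: Fabc.
apply: eq_cint => x /=.
rewrite -(@cint_fubini1 _ _ _ _ _ m m (fun y => a x * b y) c (fun z => F x z.1 z.2))//.
- exact: integrableZr_EFin.
- by move=> y z /=; rewrite -mulrA.
Qed.

(** Together with the other transposition this reaches every order of the three integrations. *)
Lemma cint_triple_swap23 : cint (m \x product_sigma_finite m m)%E (fun z => F z.1 z.2.1 z.2.2) =
  cint m (fun x => cint m (fun y => cint m (fun z => F x z y))).
Proof.
rewrite cint_triple; apply: eq_cint => x.
have iab : m.-integrable setT (EFin \o (fun y => a x * b y)) by exact: integrableZr_EFin.
have bd y z : nrm (F x (y, z).1 (y, z).2) <= (a x * b y) * c z by rewrite -mulrA.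
by rewrite (cint_fubini1 iab ic (mx x) bd) (cint_fubini2 iab ic (mx x) bd).
Qed.

Lemma cint_triple_swap12 : cint (m \x product_sigma_finite m m)%E (fun z => F z.1 z.2.1 z.2.2) =
  cint m (fun x => cint m (fun y => cint m (fun z => F y x z))).
Proof.
rewrite cint_triple.
(* Swapping the two outer integrations requires the inner integral as a function of two variables,
   dominated by [a x * b y] times the integral of [c]. *)
pose H (p : T * T) := cint m (fun z => F p.1 p.2 z).
have mH : cmeasurable H.
  apply: (@cmeasurable_cint_param _ _ _ _ _ m (fun q : (T * T) * T => F q.1.1 q.1.2 q.2)).
  apply: (cmeasurable_comp (g := fun q : (T * T) * T => (q.1.1, (q.1.2, q.2))) mF).
  apply: measurable_fun_pair.
    exact: (measurableT_comp (@measurable_fst _ _ _ _) (@measurable_fst _ _ _ _)).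
  apply: measurable_fun_pair; last exact: measurable_snd.
  exact: (measurableT_comp (@measurable_snd _ _ _ _) (@measurable_fst _ _ _ _)).
have iaC : m.-integrable setT (EFin \o (fun x => \int[m]_z c z * a x)).
  exact: integrableZr_EFin.
have bd x y : nrm (H (x, y)) <= \int[m]_z c z * a x * b y.
  have i3 : m.-integrable setT (EFin \o (fun z => a x * b y * c z)) by exact: integrableZr_EFin.
  have mz : cmeasurable (fun z => F x y z).
    exact: (cmeasurable_comp (g := fun z => (y, z)) (mx x) (measurable_pair1 y)).
  have L : cL1 m (fun z => F x y z).
    by apply: (cL1_dom mz i3) => z; rewrite -mulrA.
  apply: (le_trans (ler_nrm_cint L)).
  apply: (@le_trans _ _ (\int[m]_z (a x * b y * c z))).
    apply: le_Rintegral => //; first by case: L.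
    by move=> z _; rewrite -mulrA.
  by rewrite RintegralZl//; lra.
by rewrite (cint_fubini1 iaC ib mH bd) (cint_fubini2 iaC ib mH bd).
Qed.

End dominated3.

(** * Threefold products as integrals of kernels in three variables *)

Section conv_triple.
Context {R : realType} {E : lmodType R}.
Variables (sigma : E -> E -> R) (s : E -> R).
Hypotheses (sigma1 : forall f, scalar (sigma f))
  (sigma2 : forall g, scalar (sigma ^~ g)) (ns : seminorm s).
Variables (V : set E) (m : {finite_measure set (borel E) -> \bar R}).
Hypothesis tV : tame V.
Implicit Types (mu nu rho : set (borel E) -> R[i]) (u v w : borel E -> R[i]).
Implicit Types (k : E -> E -> E -> R[i]) (A : set (borel E)).

Let p : borel E -> borel E := retract_to V 0.
Let Vp x : V (p x). Proof. exact: retract_toP (tame0 tV) x. Qed.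
Let s0 x : 0 <= s x. Proof. by case: ns. Qed.
Let mp : measurable_fun setT p.
Proof. by apply: measurable_retract_to; exact: tame_measurable. Qed.

(** In the kernel of an iterated product each variable occurs with degree at most 2 in [s], whence
    the weights [1 + s ^+ 2]. Measurability is required after composition with [p], since sums and
    [sigma] are jointly Borel only on tame subspaces. *)
Definition kernel3 k := cmeasurable (fun z : borel E * (borel E * borel E) =>
    k (p z.1) (p z.2.1) (p z.2.2)) /\
  exists2 C : R, 0 <= C & forall f g e,
    nrm (k f g e) <= C * ((1 + s f ^+ 2) * ((1 + s g ^+ 2) * (1 + s e ^+ 2))).

Definition weighted u := cmeasurable u /\
  m.-integrable setT (EFin \o (fun x => (1 + s (p x) ^+ 2) * nrm (u x))).

Definition triple_integrand k u v w A (x y z : borel E) : R[i] :=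
  \1_A (p x + (p y + p z) : E) * k (p x) (p y) (p z) * (u x * (v y * w z)).

Definition triple k u v w A : R[i] :=
  cint (m \x product_sigma_finite m m)%E
    (fun z => triple_integrand k u v w A z.1 z.2.1 z.2.2).

Lemma kernel3_swap12 k : kernel3 k -> kernel3 (fun f g e => k g f e).
Proof.
move=> [mk [C C0 kC]]; split.
  exact: (cmeasurable_swap12 (F := fun x y z => k (p x) (p y) (p z))).
by exists C => // f g e; rewrite [(1 + s f ^+ 2) * (_ * _)]mulrCA.
Qed.

Lemma kernel3_swap23 k : kernel3 k -> kernel3 (fun f g e => k f e g).
Proof.
move=> [mk [C C0 kC]]; split.
  exact: (cmeasurable_swap23 (F := fun x y z => k (p x) (p y) (p z))).
by exists C => // f g e; rewrite [(1 + s g ^+ 2) * _]mulrC.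
Qed.

Section integrand.
Variables (k : E -> E -> E -> R[i]) (u v w : borel E -> R[i]) (A : set (borel E)).
Hypotheses (kk : kernel3 k) (wu : weighted u) (wv : weighted v) (ww : weighted w)
  (mA : measurable A).

Let m1 : measurable_fun setT (fun z : borel E * (borel E * borel E) => p z.1).
Proof. exact: (measurableT_comp mp (@measurable_fst _ _ _ _)). Qed.
Let m2 : measurable_fun setT (fun z : borel E * (borel E * borel E) => p z.2.1).
Proof.
apply: (measurableT_comp mp).
exact: (measurableT_comp (@measurable_fst _ _ _ _) (@measurable_snd _ _ _ _)).
Qed.
Let m3 : measurable_fun setT (fun z : borel E * (borel E * borel E) => p z.2.2).
Proof.
apply: (measurableT_comp mp).
exact: (measurableT_comp (@measurable_snd _ _ _ _) (@measurable_snd _ _ _ _)).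
Qed.

Lemma triple_measurable : cmeasurable (fun z : borel E * (borel E * borel E) =>
  triple_integrand k u v w A z.1 z.2.1 z.2.2).
Proof.
have m23 := tame_measurableD tV m2 m3 (fun z => Vp z.2.1) (fun z => Vp z.2.2).
have V23 (z : borel E * (borel E * borel E)) : V (p z.2.1 + p z.2.2) by apply: tameD.
apply: cmeasurableM; [apply: cmeasurableM|apply: cmeasurableM; [|apply: cmeasurableM]].
- exact: (indicD_measurable tV mA m1 m23 (fun z => Vp z.1) V23).
- by case: kk.
- by apply: (cmeasurable_comp (proj1 wu)); exact: measurable_fst.
- apply: (cmeasurable_comp (proj1 wv)).
  exact: (measurableT_comp (@measurable_fst _ _ _ _) (@measurable_snd _ _ _ _)).
- apply: (cmeasurable_comp (proj1 ww)).
  exact: (measurableT_comp (@measurable_snd _ _ _ _) (@measurable_snd _ _ _ _)).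
Qed.

Lemma triple_bound : exists2 C : R,
  m.-integrable setT (EFin \o (fun x => C * ((1 + s (p x) ^+ 2) * nrm (u x)))) &
  forall x y z, nrm (triple_integrand k u v w A x y z) <=
    C * ((1 + s (p x) ^+ 2) * nrm (u x)) *
    (((1 + s (p y) ^+ 2) * nrm (v y)) * ((1 + s (p z) ^+ 2) * nrm (w z))).
Proof.
have [_ [C C0 kC]] := kk; exists C; first by case: wu => _; exact: integrableZr_EFin.
move=> x y z; rewrite /triple_integrand !nrmM nrm_indic.
have n0 : 0 <= nrm (u x) * (nrm (v y) * nrm (w z)) by rewrite !mulr_ge0 ?nrm_ge0.
apply: (@le_trans _ _ (nrm (k (p x) (p y) (p z)) * (nrm (u x) * (nrm (v y) * nrm (w z))))).
  rewrite ler_wpM2r// ler_piMl ?nrm_ge0// indicE; case: (_ \in _).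
apply: (le_trans (ler_wpM2r n0 (kC _ _ _))).
by rewrite le_eqVlt; apply/orP; left; apply/eqP; ring.
Qed.

Lemma triple_cL1 : cL1 (m \x product_sigma_finite m m)%E
  (fun z => triple_integrand k u v w A z.1 z.2.1 z.2.2).
Proof.
have [C iu bd] := triple_bound; have [_ iv] := wv; have [_ iw] := ww.
exact: (cL1_triple iu iv iw triple_measurable bd).
Qed.

Lemma triple_iter : triple k u v w A =
  cint m (fun x => cint m (fun y => cint m (fun z => triple_integrand k u v w A x y z))).
Proof.
have [C iu bd] := triple_bound; have [_ iv] := wv; have [_ iw] := ww.
exact: (cint_triple iu iv iw triple_measurable bd).
Qed.

End integrand.

Lemma triple_swap12 k u v w A : kernel3 k -> weighted u -> weighted v -> weighted w ->
  measurable A -> triple k u v w A = triple (fun f g e => k g f e) v u w A.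
Proof.
move=> kk wu wv ww mA; rewrite [RHS]triple_iter//; last exact: kernel3_swap12.
have [C iu bd] := triple_bound v w A kk wu; have [_ iv] := wv; have [_ iw] := ww.
rewrite /triple (cint_triple_swap12 iu iv iw (triple_measurable kk wu wv ww mA) bd).
apply: eq_cint => x; apply: eq_cint => y; apply: eq_cint => z.
by rewrite /triple_integrand addrCA [u y * _]mulrCA.
Qed.

Lemma triple_swap23 k u v w A : kernel3 k -> weighted u -> weighted v -> weighted w ->
  measurable A -> triple k u v w A = triple (fun f g e => k f e g) u w v A.
Proof.
move=> kk wu wv ww mA; rewrite [RHS]triple_iter//; last exact: kernel3_swap23.
have [C iu bd] := triple_bound v w A kk wu; have [_ iv] := wv; have [_ iw] := ww.
rewrite /triple (cint_triple_swap23 iu iv iw (triple_measurable kk wu wv ww mA) bd).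
apply: eq_cint => x; apply: eq_cint => y; apply: eq_cint => z.
by rewrite /triple_integrand [p z + _]addrC [v z * _]mulrC.
Qed.

Lemma triple_kernelD k k1 k2 u v w A : kernel3 k1 -> kernel3 k2 ->
  weighted u -> weighted v -> weighted w -> measurable A ->
  (forall f g e, k f g e = k1 f g e + k2 f g e) ->
  triple k u v w A = triple k1 u v w A + triple k2 u v w A.
Proof.
move=> kk1 kk2 wu wv ww mA kE; rewrite /triple -cintD; [|exact: triple_cL1..].
by apply: eq_cint => z; rewrite /triple_integrand kE mulrDr mulrDl.
Qed.

Lemma based_weighted u mu : based V m u mu ->
  (forall j, (mom s j mu < +oo)%E) -> weighted u.
Proof.
move=> b fin; have [_ _ [_ [mu' _] _ _]] := b; split=> //.
have i0 := based_integrable ns b (fin 0%N); have i2 := based_integrable ns b (fin 2%N).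
have := integrableD measurableT i0 i2; apply: eq_integrable => // x _ /=.
by rewrite -EFinD expr0 mulrDl.
Qed.

Section conv_conv.
Variables (psi1 psi2 : measurableTypeR R -> R[i]) (K1 K2 : R) (j1 j2 : nat).
Hypotheses (g1 : good_kernel sigma s psi1 K1 j1) (g2 : good_kernel sigma s psi2 K2 j2).
Hypotheses (j1_le1 : (j1 <= 1)%N) (j2_le1 : (j2 <= 1)%N).

Definition kernel_conv f g e : R[i] := psi1 (sigma f (g + e)) * psi2 (sigma g e).

Let pow_le1 j x : (j <= 1)%N -> s x ^+ j <= 1 + s x.
Proof. by case: j => [|[|//]] _; rewrite ?expr0 ?expr1 ?lerDl ?lerDr. Qed.

Let pow_le2 j x : (j <= 1)%N -> s x ^+ j * (1 + s x) <= 2 * (1 + s x ^+ 2).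
Proof.
move=> /pow_le1 => /(_ x) h; apply: (le_trans (ler_wpM2r _ h)).
  by rewrite addr_ge0.
by have := sqr_ge0 (1 - s x); rewrite !expr2; nra.
Qed.

(** From [1 + s (g + e) <= (1 + s g) * (1 + s e)], each variable collects at most two factors
    [1 + s], and [(1 + s) ^+ 2 <= 2 * (1 + s ^+ 2)]. The three variables give the constant
    [2 * (2 * 2)]. *)
Lemma kernel_convP : kernel3 kernel_conv.
Proof.
have [mpsi1 K10 b1] := g1; have [mpsi2 K20 b2] := g2.
split.
  have m1 : measurable_fun setT (fun z : borel E * (borel E * borel E) => p z.1).
    exact: (measurableT_comp mp (@measurable_fst _ _ _ _)).
  have m2 : measurable_fun setT (fun z : borel E * (borel E * borel E) => p z.2.1).
    apply: (measurableT_comp mp).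
    exact: (measurableT_comp (@measurable_fst _ _ _ _) (@measurable_snd _ _ _ _)).
  have m3 : measurable_fun setT (fun z : borel E * (borel E * borel E) => p z.2.2).
    apply: (measurableT_comp mp).
    exact: (measurableT_comp (@measurable_snd _ _ _ _) (@measurable_snd _ _ _ _)).
  apply: cmeasurableM.
    apply: (kernel_measurable sigma1 sigma2 mpsi1 tV m1
      (tame_measurableD tV m2 m3 (fun z => Vp z.2.1) (fun z => Vp z.2.2))
      (fun z => Vp z.1)) => z.
    exact: tameD.
  exact: (kernel_measurable sigma1 sigma2 mpsi2 tV m2 m3
    (fun z => Vp z.2.1) (fun z => Vp z.2.2)).
exists (K1 * K2 * (2 * (2 * 2))); first by rewrite !mulr_ge0.
move=> f g e; rewrite /kernel_conv nrmM.
have pw x j : 0 <= s x ^+ j by rewrite exprn_ge0.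
apply: (@le_trans _ _ ((K1 * ((1 + s f) * ((1 + s g) * (1 + s e)))) *
    (K2 * (s g ^+ j2 * s e ^+ j2)))).
  apply: ler_pM; rewrite ?nrm_ge0//; apply: (le_trans (b1 _ _)).
  apply: ler_wpM2l => //; apply: ler_pM => //; first exact: pow_le1.
  apply: (le_trans (pow_le1 _ j1_le1)).
  have [_ sD _] := ns; have := sD g e; have := mulr_ge0 (s0 g) (s0 e).
  by nra.
have H1 : 1 + s f <= 2 * (1 + s f ^+ 2).
  by have := pow_le2 f (leq0n 1); rewrite mul1r.
have H2 := pow_le2 g j2_le1; have H3 := pow_le2 e j2_le1.
rewrite [leLHS](_ : _ = K1 * K2 * ((1 + s f) *
    ((s g ^+ j2 * (1 + s g)) * (s e ^+ j2 * (1 + s e))))); last by ring.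
rewrite -[leRHS]mulrA ler_wpM2l ?mulr_ge0//.
rewrite [leRHS](_ : _ = 2 * (1 + s f ^+ 2) *
    ((2 * (1 + s g ^+ 2)) * (2 * (1 + s e ^+ 2)))); last by ring.
have d0 x : 0 <= 1 + s x by rewrite addr_ge0.
by apply: ler_pM => //; [rewrite !mulr_ge0|apply: ler_pM => //; rewrite mulr_ge0].
Qed.

(** The inner convolution is represented over a product, and [conv_rep] applies once more with that
    product as its second space; for this the inner density must have an integrable moment of order
    [j1], which is [i2]. *)
Lemma conv_triple u v w mu nu rho A : based V m u mu -> based V m v nu ->
  based V m w rho -> (forall j, mom s j mu < +oo)%E -> (forall j, mom s j nu < +oo)%E ->
  (forall j, mom s j rho < +oo)%E -> measurable A ->
  conv sigma psi1 mu (conv sigma psi2 nu rho) A = triple kernel_conv u v w A.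
Proof.
move=> b1 b2 b3 f1 f2 f3 mA.
have [mpsi1 K10 psiK1] := g1; have [mpsi2 K20 psiK2] := g2.
have r2 := conv_based sigma1 sigma2 ns g2 tV b2 b3 (f2 j2) (f3 j2).
have [_ _ r1] := b1.
have V23 (z : borel E * borel E) : V (p z.1 + p z.2 : E) by apply: tameD.
have iv := based_weighted b2 f2; have iw := based_weighted b3 f3.
have i2 : (product_sigma_finite m m).-integrable setT (EFin \o (fun z =>
    s (p z.1 + p z.2 : E) ^+ j1 * nrm (conv_density sigma psi2 p p v w z))).
  have [_ iv'] := iv; have [_ iw'] := iw.
  have ivK : m.-integrable setT (EFin \o (fun x => K2 * (2 * 2) *
      ((1 + s (p x) ^+ 2) * nrm (v x)))) by exact: integrableZr_EFin.
  apply: le_integrable (integrable_prod ivK iw') => //.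
    apply/measurable_EFinP; apply: measurable_funM.
      apply: measurable_funX; have [mX _ _ _] := r2.
      exact: (measurableT_comp (seminorm_measurable ns) mX).
    by apply: measurable_nrm; have [_ [] ] := r2.
  move=> z _ /=; rewrite lee_fin !ger0_norm ?mulr_ge0 ?exprn_ge0 ?nrm_ge0 ?addr_ge0 ?exprn_ge0//.
  have [_ sD _] := ns.
  have B1 : s (p z.1 + p z.2 : E) ^+ j1 <= (1 + s (p z.1)) * (1 + s (p z.2)).
    apply: (le_trans (pow_le1 _ j1_le1)).
    by have := sD (p z.1) (p z.2); have := mulr_ge0 (s0 (p z.1)) (s0 (p z.2)); nra.
  apply: (le_trans (ler_pM _ _ B1 (conv_density_bound psiK2 p p v w z.1 z.2)));
    rewrite ?exprn_ge0 ?nrm_ge0//.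
  have H1 := pow_le2 (p z.1) j2_le1; have H2 := pow_le2 (p z.2) j2_le1.
  rewrite [leLHS](_ : _ = K2 * (((s (p z.1) ^+ j2 * (1 + s (p z.1))) *
     (s (p z.2) ^+ j2 * (1 + s (p z.2)))) * (nrm (v z.1) * nrm (w z.2)))); last by ring.
  rewrite [leRHS](_ : _ = K2 * ((2 * (1 + s (p z.1) ^+ 2)) * (2 * (1 + s (p z.2) ^+ 2)) *
     (nrm (v z.1) * nrm (w z.2)))); last by ring.
  apply: ler_wpM2l => //; apply: ler_wpM2r; first by rewrite mulr_ge0 ?nrm_ge0.
  by apply: ler_pM; rewrite ?mulr_ge0 ?exprn_ge0 ?addr_ge0.
have r3 := conv_rep (P2 := product_sigma_finite m m) sigma1 sigma2 mpsi1 psiK1 r1 r2 tV Vp V23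
  (based_integrable ns b1 (f1 j1)) i2.
have [_ _ r3E _] := r3; rewrite [LHS](r3E _ mA).
apply: eq_cint => z; rewrite /triple_integrand /kernel_conv /conv_density /=.
rewrite -/(p z.1) -/(p z.2.1) -/(p z.2.2); ring.
Qed.

End conv_conv.

End conv_triple.

(** * The identities of a Poisson algebra *)

Section poisson_identities.
Context {R : realType} {E : lmodType R}.
Variables (sigma : E -> E -> R) (s : E -> R) (c : R).
Hypotheses (sigma1 : forall f, scalar (sigma f))
  (sigma2 : forall g, scalar (sigma ^~ g)) (sigmaA : forall f g, sigma f g = - sigma g f)
  (ns : seminorm s) (c0 : 0 < c)
  (sigma_bound : forall f g, `|sigma f g| <= c * s f * s g).
Implicit Types (mu nu rho : set (borel E) -> R[i]).

Let M := M_moment (R := R) (E := E) s None.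
Local Notation mul := (conv sigma (ekernel 0)).
Local Notation br := (conv sigma (bkernel 0)).

Let g0 := ekernel_good sigma s 0.
Let g1 := bkernel_good c0 sigma_bound 0.

Let fin mu j : M mu -> (mom s j mu < +oo)%E.
Proof. by case=> _; exact. Qed.

Let ekernel0 t : ekernel 0 t = 1 :> R[i].
Proof. by rewrite /ekernel mulr0 mul0r oppr0 /expi cos0 sin0. Qed.

Let bkernel0 t : bkernel 0 t = t%:C%C :> R[i].
Proof. by rewrite /bkernel /bfun eqxx. Qed.

Let sigmaDr x y z : sigma x (y + z) = sigma x y + sigma x z.
Proof. by have := sigma1 x 1 y z; rewrite scale1r mul1r. Qed.

Lemma mul_comm mu nu : M mu -> M nu -> mul mu nu = mul nu mu.
Proof.
move=> M1 M2.
have [_ <-] := conv_swap sigma1 sigma2 sigmaA ns g0 (proj1 M2) (proj1 M1)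
  (fin 0 M2) (fin 0 M1).
by apply: eq_conv => t; rewrite !ekernel0.
Qed.

Lemma br_anticomm mu nu : M mu -> M nu -> br mu nu = - br nu mu.
Proof.
move=> M1 M2.
have f1 := fin 1 M1; have f2 := fin 1 M2.
have [g <-] := conv_swap sigma1 sigma2 sigmaA ns g1 (proj1 M2) (proj1 M1) f2 f1.
(* In [conv_kernel_lin] the last coefficient is 1, so a change of sign is written as -2 plus 1. *)
have [_] := conv_kernel_lin sigma1 sigma2 ns (-2) g g (proj1 M1) (proj1 M2) f1 f2.
have aux (W : lmodType R[i]) (y : W) : -2 *: y + y = - y.
  by rewrite -{2}[y]scale1r -scalerDl -scaleN1r; congr (_ *: _); ring.
rewrite aux => <-.
by apply: eq_conv => t; rewrite !bkernel0 rmorphN /= mulrNN mulr_natl mulr2n addrK.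
Qed.

Section triples.
Variables (V : set E) (m : {finite_measure set (borel E) -> \bar R})
  (u v w : borel E -> R[i]) (mu nu rho : set (borel E) -> R[i]) (A : set (borel E)).
Hypotheses (tV : tame V) (b1 : based V m u mu) (b2 : based V m v nu)
  (b3 : based V m w rho) (M1 : M mu) (M2 : M nu) (M3 : M rho) (mA : measurable A).
Variables (psi1 psi2 : measurableTypeR R -> R[i]) (K1 K2 : R) (j1 j2 : nat).
Hypotheses (h1 : good_kernel sigma s psi1 K1 j1) (h2 : good_kernel sigma s psi2 K2 j2)
  (l1 : (j1 <= 1)%N) (l2 : (j2 <= 1)%N).
Let k := kernel_conv sigma psi1 psi2.
Let kk : kernel3 s V k. Proof. exact: (kernel_convP sigma1 sigma2 ns tV h1 h2). Qed.
Let wu : weighted s V m u. Proof. by apply: (based_weighted ns b1) => j; exact: fin. Qed.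
Let wv : weighted s V m v. Proof. by apply: (based_weighted ns b2) => j; exact: fin. Qed.
Let ww : weighted s V m w. Proof. by apply: (based_weighted ns b3) => j; exact: fin. Qed.
Local Notation conv2 x y z := (conv sigma psi1 x (conv sigma psi2 y z)).

Lemma conv_triple123 : kernel3 s V k /\ conv2 mu nu rho A = triple V m k u v w A.
Proof.
split=> //.
by apply: (conv_triple sigma1 sigma2 ns tV h1 h2) => // j; exact: fin.
Qed.

(** Permuting the measures is traded for permuting the arguments of the kernel: all terms of an
    identity become integrals of the same densities [u], [v], [w] in the same order and can be added
    under the integral sign. *)
Lemma conv_triple213 : kernel3 s V (fun f g e => k g f e) /\
  conv2 nu mu rho A = triple V m (fun f g e => k g f e) u v w A.
Proof.
split; first exact: kernel3_swap12.
rewrite -(triple_swap12 tV kk)//.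
by apply: (conv_triple sigma1 sigma2 ns tV h1 h2) => // j; exact: fin.
Qed.

Lemma conv_triple312 : kernel3 s V (fun f g e => k e f g) /\
  conv2 rho mu nu A = triple V m (fun f g e => k e f g) u v w A.
Proof.
split; first by apply: (@kernel3_swap23 _ _ _ _ (fun f g e => k g f e)); exact: kernel3_swap12.
rewrite -(triple_swap23 tV (kernel3_swap12 kk))// -(triple_swap12 tV kk)//.
by apply: (conv_triple sigma1 sigma2 ns tV h1 h2) => // j; exact: fin.
Qed.

Lemma conv_triple231 : kernel3 s V (fun f g e => k g e f) /\
  conv2 nu rho mu A = triple V m (fun f g e => k g e f) u v w A.
Proof.
have k23 := kernel3_swap23 kk; split.
  exact: (@kernel3_swap12 _ _ _ _ (fun f g e => k f e g)).
rewrite -(triple_swap12 tV k23)// -(triple_swap23 tV kk)//.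
by apply: (conv_triple sigma1 sigma2 ns tV h1 h2) => // j; exact: fin.
Qed.

End triples.

Let conv_null psi mu nu A : ~ measurable A -> conv sigma psi mu nu A = 0.
Proof. by move=> nA; rewrite /conv /twisted_convolution /on_measurable asboolF. Qed.

(** For nonnegative reals [a * b <= a ^+ 2 + b ^+ 2], so mixed moments are controlled by pure
    moments of twice the order. *)
Lemma mixed_moment_fin_num kappa j a mu : seminorm kappa -> M mu ->
  M_moment kappa None mu ->
  (0 <= \int[cvariation mu]_x (s x ^+ j * kappa x ^+ a)%:E < +oo)%E.
Proof.
move=> nk Ms [_ Mk]; have [V [m [u [_ [tV b _]]]]] := base2 (proj1 Ms) (proj1 Ms).
have [_ _ r] := b; have [s0 _ _] := ns; have [k0 _ _] := nk.
have w0 x : 0 <= s x ^+ j * kappa x ^+ a by rewrite mulr_ge0 ?exprn_ge0.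
have mw : measurable_fun setT (fun x : borel E => s x ^+ j * kappa x ^+ a).
  by apply: measurable_funM; apply: measurable_funX; exact: seminorm_measurable.
rewrite (wmass_based b mw)// wmass_ge0//=; apply/(wmass_integrable r mw w0).
have i1 := based_integrable ns b (fin (j + j) Ms).
have i2 : m.-integrable setT (EFin \o (fun x => kappa (retract_to V 0 x) ^+ (a + a) * nrm (u x))).
  by apply: (based_integrable nk b); exact: Mk.
apply: le_integrable (integrableD measurableT i1 i2) => //.
  apply/measurable_EFinP; apply: measurable_funM.
    by have [mX _ _ _] := r; exact: (measurableT_comp mw mX).
  by apply: measurable_nrm; have [_ [] ] := r.
move=> x _ /=; rewrite lee_fin !exprD -mulrDl.
have A0 : 0 <= s (retract_to V 0 x) ^+ j by rewrite exprn_ge0.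
have B0 : 0 <= kappa (retract_to V 0 x) ^+ a by rewrite exprn_ge0.
move: A0 B0; set A := s _ ^+ j; set B := kappa _ ^+ a => A0 B0.
rewrite !ger0_norm ?mulr_ge0 ?addr_ge0 ?nrm_ge0// ?mulr_ge0//.
by rewrite ler_wpM2r ?nrm_ge0//; nra.
Qed.

Lemma conv_moment psi K j kappa mu nu : good_kernel sigma s psi K j ->
  seminorm kappa -> M mu -> M nu ->
  M_moment kappa None mu -> M_moment kappa None nu ->
  M_moment kappa None (conv sigma psi mu nu).
Proof.
move=> g nk M1 M2 Mk1 Mk2; apply/M_momentP; split.
  by apply: (conv_M_E sigma1 sigma2 ns g (proj1 M1) (proj1 M2)); exact: fin.
move=> k _; apply: (le_lt_trans (conv_mom sigma1 sigma2 ns g k nk (proj1 M1) (proj1 M2)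
  (fin j M1) (fin j M2))).
have [_ K0 _] := g.
apply: lte_sum_pinfty => i _.
have /andP[I1 F1] := mixed_moment_fin_num j (k - i)%N nk M1 Mk1.
have /andP[I2 F2] := mixed_moment_fin_num j i nk M2 Mk2.
apply: lte_mul_pinfty => //; first by rewrite lee_fin mulr_ge0.
by apply: lte_mul_pinfty => //; rewrite ge0_fin_numE.
Qed.

Lemma conv_M psi K j mu nu : good_kernel sigma s psi K j -> M mu -> M nu ->
  M (conv sigma psi mu nu).
Proof. by move=> g M1 M2; exact: (conv_moment g). Qed.

Lemma mul_assoc mu nu rho : M mu -> M nu -> M rho -> mul mu (mul nu rho) = mul (mul mu nu) rho.
Proof.
(* Commutativity turns the left-nested product into a right-nested one, the shape that [conv_triple]
   evaluates. *)
move=> M1 M2 M3; rewrite (mul_comm (conv_M g0 M1 M2) M3).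
apply/funext => A; have [mA|nA] := pselect (measurable A); last by rewrite !conv_null.
have [V [m [u [v [w [tV b1 b2 b3]]]]]] := base3 (proj1 M1) (proj1 M2) (proj1 M3).
have [_ ->] := conv_triple123 tV b1 b2 b3 M1 M2 M3 mA g0 g0 isT isT.
have [_ ->] := conv_triple312 tV b1 b2 b3 M1 M2 M3 mA g0 g0 isT isT.
apply: eq_cint => z; rewrite /triple_integrand /kernel_conv.
by rewrite !ekernel0.
Qed.

(** On kernels this is the additivity [sigma f (g + e) = sigma f g + sigma f e]. *)
Lemma br_mul mu nu rho : M mu -> M nu -> M rho ->
  br mu (mul nu rho) = mul (br mu nu) rho + mul nu (br mu rho).
Proof.
move=> M1 M2 M3; rewrite (mul_comm (conv_M g1 M1 M2) M3).
apply/funext => A; have [mA|nA] := pselect (measurable A); last first.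
  by rewrite [RHS](_ : _ = mul rho (br mu nu) A + mul nu (br mu rho) A)// !conv_null// addr0.
have [V [m [u [v [w [tV b1 b2 b3]]]]]] := base3 (proj1 M1) (proj1 M2) (proj1 M3).
rewrite [RHS](_ : _ = mul rho (br mu nu) A + mul nu (br mu rho) A)//.
have [_ ->] := conv_triple123 tV b1 b2 b3 M1 M2 M3 mA g1 g0 isT isT.
have [k1 ->] := conv_triple312 tV b1 b2 b3 M1 M2 M3 mA g0 g1 isT isT.
have [k2 ->] := conv_triple213 tV b1 b2 b3 M1 M2 M3 mA g0 g1 isT isT.
have fu j := fin j M1; have fv j := fin j M2; have fw j := fin j M3.
apply: (triple_kernelD tV k1 k2 (based_weighted ns b1 fu) (based_weighted ns b2 fv)
  (based_weighted ns b3 fw) mA) => f g e.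
rewrite /kernel_conv !ekernel0 !bkernel0 mulr1 !mul1r -rmorphD; congr (_%:C%C).
by rewrite sigmaDr.
Qed.

(** With [x = sigma f g], [y = sigma g e] and [z = sigma e f], the three kernels are [(x - z) * y],
    [(y - x) * z] and [(z - y) * x], whose sum is zero. *)
Lemma br_jacobi mu nu rho : M mu -> M nu -> M rho ->
  br mu (br nu rho) + br nu (br rho mu) + br rho (br mu nu) = 0.
Proof.
move=> M1 M2 M3; apply/funext => A.
rewrite [LHS](_ : _ = br mu (br nu rho) A + br nu (br rho mu) A + br rho (br mu nu) A)//.
have [mA|nA] := pselect (measurable A); last by rewrite !conv_null// !addr0.
have [V [m [u [v [w [tV b1 b2 b3]]]]]] := base3 (proj1 M1) (proj1 M2) (proj1 M3).
have [k1 ->] := conv_triple123 tV b1 b2 b3 M1 M2 M3 mA g1 g1 isT isT.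
have [k2 ->] := conv_triple231 tV b1 b2 b3 M1 M2 M3 mA g1 g1 isT isT.
have [k3 ->] := conv_triple312 tV b1 b2 b3 M1 M2 M3 mA g1 g1 isT isT.
have fu j := fin j M1; have fv j := fin j M2; have fw j := fin j M3.
have wu := based_weighted ns b1 fu; have wv := based_weighted ns b2 fv.
have ww := based_weighted ns b3 fw.
set k1' := kernel_conv _ _ _ in k1 *.
(* Kernels are added two at a time, and the partial sum must itself satisfy [kernel3] before the
   third one is added. *)
pose k12 f g e : R[i] := k1' f g e + k1' g e f.
rewrite -(@triple_kernelD _ _ s _ _ tV k12 _ _ _ _ _ _ k1 k2 wu wv ww mA)//.
have k12k : kernel3 s V k12.
  have [mk1 [C1 C10 kC1]] := k1; have [mk2 [C2 C20 kC2]] := k2; split.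
    exact: cmeasurableD.
  exists (C1 + C2); first by rewrite addr_ge0.
  by move=> f g e; rewrite mulrDl (le_trans (nrmD _ _))// lerD.
rewrite -(@triple_kernelD _ _ s _ _ tV (fun _ _ _ => 0) _ _ _ _ _ _ k12k k3 wu wv ww mA).
  rewrite /triple -[RHS](cint0 (m \x product_sigma_finite m m)%E).
  by apply: eq_cint => z; rewrite /triple_integrand mulr0 mul0r.
move=> f g e; rewrite /k12 /k1' /kernel_conv !bkernel0 -!rmorphM -!rmorphD.
rewrite -[LHS](rmorph0 (real_complex R)); congr (_%:C%C); rewrite !sigmaDr (sigmaA e f) (sigmaA g f) (sigmaA e g).
by ring.
Qed.

End poisson_identities.

(** * Continuity of the bracket *)

Section convolution_bound.
Context {R : realType} {E : lmodType R}.
Variables (sigma : E -> E -> R) (s : E -> R).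
Hypotheses (sigma1 : forall f, scalar (sigma f))
  (sigma2 : forall g, scalar (sigma ^~ g)) (ns : seminorm s).
Implicit Types (mu nu rho : set (borel E) -> R[i]).

(** Binomials grow down the columns of Pascal's triangle, so the constant of order [n] serves all
    lower orders as well. *)
Lemma bin_le_max_bin k n i : (k <= n)%N -> (i <= k)%N -> ('C(k, i) <= max_bin n)%N.
Proof.
move=> kn ik; apply: (leq_trans (leq_bin2l i kn)).
have i_n : (i < n.+1)%N by rewrite ltnS (leq_trans ik).
exact: (leq_bigmax (F := fun k : 'I_n.+1 => 'C(n, k)) (Ordinal i_n)).
Qed.

(** The left side runs over the pairs [(p, q)] with [p + q < n], which form a part of the square on
    the right. *)
Lemma ler_sum_triangle (F : nat -> nat -> R) n : (forall p q, 0 <= F p q) ->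
  \sum_(k < n) \sum_(i < k.+1) F (k - i)%N i <= \sum_(p < n) \sum_(q < n) F p q.
Proof.
move=> F0; rewrite [leRHS]exchange_big /=.
under eq_bigr => k _ do rewrite (big_ord_widen n (fun i => F (k - i)%N i) (ltn_ord k)).
rewrite (exchange_big_dep xpredT)//=; apply: ler_sum => i _.
rewrite -(big_geq_mkord _ _ xpredT (fun k => F (k - i)%N i)) -{1}[nat_of_ord i]add0n.
rewrite big_addn big_mkord (big_ord_widen n (fun p => F (p + i - i)%N i) (leq_subr _ _)).
by rewrite big_mkcond; apply: ler_sum => p _; case: ifP; rewrite ?addnK.
Qed.

Lemma M_moment_mom n k mu : M_moment s (Some n) mu -> (k <= n)%N -> (mom s k mu < +oo)%E.
Proof. by move=> [_ h] kn; exact: h. Qed.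

Lemma M_moment_norm n mu : M_moment s (Some n) mu ->
  norm_moment s n mu = (\sum_(k < n.+1) fine (mom s k mu))%:E.
Proof.
move=> M1; have [M h] := M1; rewrite norm_momentE//.
rewrite -sumEFin; apply: eq_bigr => k _; rewrite fineK// ge0_fin_numE ?mom_ge0//.
by apply: (M_moment_mom M1); rewrite -ltnS.
Qed.

Lemma norm_momentD n mu nu : M_moment s (Some n) mu -> M_moment s (Some n) nu ->
  (norm_moment s n (mu + nu)%R <= norm_moment s n mu + norm_moment s n nu)%E.
Proof.
move=> M1 M2; have M3 := M_moment_lin 1 ns M1 M2.
rewrite scale1r in M3; have [N1 h1] := M1; have [N2 h2] := M2; have [N3 h3] := M3.
rewrite !norm_momentE// -big_split /=; apply: lee_sum => k _.
by have := mom_lin_le k 1 ns N1 N2; rewrite scale1r nrm1 mul1e.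
Qed.

(** The kernel contributes one factor [s] on each side, so the moment of order [k] involves the
    orders [(k - i).+1] and [i.+1] of the factors; this is where one order is lost. Summing over [k]
    and completing the triangle to a square yields a product of sums. *)
Lemma conv_norm_moment psi K n mu nu : good_kernel sigma s psi K 1 ->
  M_moment s (Some n.+1) mu -> M_moment s (Some n.+1) nu ->
  M_moment s (Some n) (conv sigma psi mu nu) /\
  (norm_moment s n (conv sigma psi mu nu) <=
    (K * (max_bin n)%:R)%:E * norm_moment s n.+1 mu * norm_moment s n.+1 nu)%E.
Proof.
move=> g M1 M2; have [_ K0 _] := g; have [N1 _] := M1; have [N2 _] := M2.
have f1 := M_moment_mom M1 (ltn0Sn n); have f2 := M_moment_mom M2 (ltn0Sn n).
have N3 := conv_M_E sigma1 sigma2 ns g N1 N2 f1 f2.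
pose a k := fine (mom s k mu); pose b k := fine (mom s k nu).
have a0 k : 0 <= a k by rewrite fine_ge0// mom_ge0.
have b0 k : 0 <= b k by rewrite fine_ge0// mom_ge0.
have aE k : (k <= n.+1)%N -> mom s k mu = (a k)%:E.
  by move=> kn; rewrite fineK// ge0_fin_numE ?mom_ge0//; exact: M_moment_mom kn.
have bE k : (k <= n.+1)%N -> mom s k nu = (b k)%:E.
  by move=> kn; rewrite fineK// ge0_fin_numE ?mom_ge0//; exact: M_moment_mom kn.
have SE k (tau : set (borel E) -> R[i]) :
    (\int[cvariation tau]_x (s x ^+ 1 * s x ^+ k)%:E = mom s k.+1 tau)%E.
  rewrite /mom (_ : (fun x : borel E => (s x ^+ 1 * s x ^+ k)%:E) =
    (fun x => (s x ^+ k.+1)%:E))//.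
  by apply/funext => x; rewrite -exprD.
have momk k : (k <= n)%N -> (mom s k (conv sigma psi mu nu) <=
    (\sum_(i < k.+1) K * (max_bin n)%:R * (a (k - i).+1 * b i.+1))%:E)%E.
  move=> kn; apply: (le_trans (conv_mom sigma1 sigma2 ns g k ns N1 N2 f1 f2)).
  rewrite -sumEFin; apply: lee_sum => i _; rewrite !SE.
  have ik : (i <= k)%N by rewrite -ltnS.
  rewrite aE ?bE ?ltnS ?(leq_trans ik)// ?(leq_trans (leq_subr _ _))//.
  rewrite -EFinM lee_fin ler_wpM2r ?mulr_ge0//.
  by rewrite ler_wpM2l// ler_nat bin_le_max_bin.
have M3 : M_moment s (Some n) (conv sigma psi mu nu).
  by split => // k kn; apply: (le_lt_trans (momk k kn)); rewrite ltry.
split => //; rewrite norm_momentE//; last by have [] := M3.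
rewrite (M_moment_norm M1) (M_moment_norm M2) -!EFinM.
apply: (@le_trans _ _ (\sum_(k < n.+1)
    \sum_(i < k.+1) K * (max_bin n)%:R * (a (k - i).+1 * b i.+1))%:E).
  by rewrite -sumEFin; apply: lee_sum => k _; apply: momk; rewrite -ltnS.
rewrite lee_fin.
under eq_bigr do rewrite -mulr_sumr.
rewrite -[leLHS]mulr_sumr -[leRHS]mulrA ler_wpM2l ?mulr_ge0//.
apply: (le_trans (ler_sum_triangle (F := fun p q => a p.+1 * b q.+1) _ _)).
  by move=> p q; rewrite mulr_ge0.
under eq_bigr do rewrite -mulr_sumr.
(* The remaining sums are the two norms without their nonnegative terms of order 0. *)
rewrite -mulr_suml; apply: ler_pM; rewrite ?sumr_ge0//.
  by rewrite [leRHS]big_ord_recl -[leLHS]add0r; apply: lerD; [exact: a0|exact: lexx].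
by rewrite [leRHS]big_ord_recl -[leLHS]add0r; apply: lerD; [exact: b0|exact: lexx].
Qed.

(** Domination by a multiple of [s] on a set of full variation is enough, since the first moment of
    [nu] is finite. *)
Lemma cintegrable_based V (m : {finite_measure set (borel E) -> \bar R}) v nu
    (D : set (borel E)) (phi : borel E -> R[i]) C :
  based V m v nu -> (mom s 1 nu < +oo)%E ->
  measurable D -> cvariation nu (~` D) = 0%E ->
  cmeasurable (fun x => \1_D x * phi x) ->
  (forall x, D x -> nrm (phi x) <= C * s x) -> cintegrable nu phi.
Proof.
move=> b f mD D0 mphi phiC; exists D.
have [_ _ r] := b; have [s0 _ _] := ns.
have ib := based_integrable ns b f.
have key (q : R[i] -> R) : (forall z, `|q z| <= nrm z) ->
    (forall x : borel E, q (\1_D x * phi x) = \1_D x * q (phi x)) ->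
    measurable_fun setT (fun x : borel E => q (\1_D x * phi x)) ->
    (cvariation nu).-integrable D (fun x => (q (phi x))%:E).
  move=> qn qD mq; apply/integrableP; split.
    apply/measurable_EFinP; apply: (eq_measurable_fun (fun x => q (\1_D x * phi x))).
      by move=> x xD; rewrite qD indicE xD mul1r.
    exact: measurable_funS mq.
  have mk (F : borel E -> \bar R) :
      (\int[cvariation nu]_(x in D) F x = \int[cvariation nu]_x (F \_ D) x)%E.
    by rewrite /integral patch_setT.
  rewrite mk.
  have E1 : (fun x : borel E => ((fun y => `|(q (phi y))%:E|%E) \_ D) x) =
      (fun x => (`|q (\1_D x * phi x)|)%:E).
    apply/funext => x; rewrite /patch qD indicE.
    by case: ifP => _; rewrite ?mul1r// mul0r normr0.
  rewrite E1 (integral_based b); last 2 first.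
  - by apply/measurable_EFinP; exact: measurableT_comp.
  - by move=> x; rewrite lee_fin.
  have iC : m.-integrable setT (EFin \o (fun x => C * (s (retract_to V 0 x) ^+ 1 * nrm (v x)))).
    exact: integrableZr_EFin.
  have [v0 [_ [mv _] _ _] _] := b.
  have /integrableP[_] : m.-integrable setT
      (fun x => (`|q (\1_D x * phi x)|%:E * (nrm (v x))%:E)%E); last first.
    apply: le_lt_trans; rewrite le_eqVlt; apply/orP; left; apply/eqP.
    by apply: eq_integral => x _; rewrite gee0_abs// -EFinM lee_fin mulr_ge0// nrm_ge0.
  apply: le_integrable iC => //.
  - apply/measurable_EFinP; apply: measurable_funM; last exact: measurable_nrm.
    exact: measurableT_comp.
  - move=> x _; have [vx|/v0 vx] := pselect (V x); last by rewrite vx nrm0 mule0 abse0.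
    rewrite -EFinM lee_fin /= /retract_to mem_set//.
    rewrite [leLHS]ger0_norm ?mulr_ge0 ?nrm_ge0//.
    rewrite qD indicE; case: (boolP (x \in D)) => [xD|_].
      rewrite mul1r (le_trans _ (ler_norm _))// mulrA ler_wpM2r ?nrm_ge0//.
      by rewrite expr1 (le_trans (qn _))// phiC//; exact: set_mem.
    by rewrite mul0r normr0 mul0r.
split => //.
- apply: key => [z|x|]; first exact: ler_Re.
    by rewrite ReM Re_indic Im_indic mul0r subr0.
  by have [] := mphi.
- apply: key => [z|x|]; first exact: ler_Im.
    by rewrite ImM Re_indic Im_indic mul0r addr0.
  by have [] := mphi.
Qed.

End convolution_bound.

Section bracket_continuity.
Context {R : realType} {E : lmodType R}.
Variables (sigma : E -> E -> R) (s : E -> R) (c : R).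
Hypotheses (sigma1 : forall f, scalar (sigma f))
  (sigma2 : forall g, scalar (sigma ^~ g)) (sigmaA : forall f g, sigma f g = - sigma g f)
  (ns : seminorm s) (c0 : 0 < c)
  (sigma_bound : forall f g, `|sigma f g| <= c * s f * s g).
Implicit Types (mu nu rho : set (borel E) -> R[i]) (h t : R).

Lemma bracket0_integrableP mu nu : M_moment s (Some 1%N) mu ->
  M_moment s (Some 1%N) nu -> bracket0_integrable sigma mu nu.
Proof.
move=> M1 M2 L mL; have [N1 _] := M1; have [N2 _] := M2.
have f1 := M_moment_mom M1 (leqnn 1); have f2 := M_moment_mom M2 (leqnn 1).
have [V [m [u [v [tV b1 b2]]]]] := base2 N1 N2.
have [_ _ r2] := b2; have [s0 _ _] := ns.
have mV := tame_measurable tV.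
have Vr := retract_toP (tame0 tV).
have bK f g : nrm ((sigma f g)%:C%C * \1_L (f + g : E)) <= c * s f * s g.
  rewrite nrmM nrm_real nrm_indic (le_trans _ (sigma_bound f g))//.
  by rewrite ler_piMr// indicE; case: (_ \in _).
(* For fixed [f] the inner integrand is Borel on all of [E], whereas the outer one is shown to be
   Borel only on [V]. Accordingly the sets of full variation are [setT] and [V]. *)
split=> [f|].
  apply: (@cintegrable_based _ _ s ns V m v nu setT _ (c * s f) b2 f2 measurableT) => //.
    rewrite setCT; apply/eqP; rewrite eq_le -{1}(mom_0 s 0).
    have [mm mm_n] := complex_measure_dominated (M_E_complex_measure N2).
    have [w rw] := complex_measure_density (M_E_complex_measure N2) mm_n.
    by rewrite (cvariation_density rw)// integral_set0 mom_0 lexx.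
  have -> : (fun g : borel E => \1_setT g * ((sigma f g)%:C%C * \1_L (f + g : E)) : R[i]) =
      (fun g => (sigma f g)%:C%C * \1_L (f + g : E)).
    by apply/funext => g; rewrite indicT mul1r.
  apply: cmeasurableM.
    by apply: cmeasurable_real; exact: (functional_measurable (sigma1 f)).
  have mA : measurable ((fun g : borel E => (f + g : E) : borel E) @^-1` L).
    by rewrite -[X in measurable X]setTI; exact: (measurable_translate f).
  exact: (cmeasurable_indic mA).
pose psi (t : measurableTypeR R) : R[i] := t%:C%C.
have mpsi : cmeasurable psi by apply: cmeasurable_real; exact: measurable_id.
have psiK f g : nrm (psi (sigma f g)) <= c * (s f ^+ 1 * s g ^+ 1).
  by rewrite nrm_real !expr1 mulrA.
have i2 := based_integrable ns b2 f2.
have inner f : V f -> _ := fun Vf => conv_inner sigma1 sigma2 mpsi psiK r2 tV Vr i2 Vf mL.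
apply: (cintegrable_based (D := V) (C := c * \int[m]_x (s (retract_to V 0 x) ^+ 1 * nrm (v x)))
  ns b1 f1) => //.
- apply: (cvariation_concentrated (M_E_complex_measure N1) mV).
  exact: based_concentrated b1.
- pose G (z : borel E * borel E) : R[i] := (sigma (retract_to V 0 z.1) (retract_to V 0 z.2))%:C%C *
    \1_L (retract_to V 0 z.1 + retract_to V 0 z.2 : E) * v z.2.
  have [mX [mv _] _ _] := r2.
  have m1 : measurable_fun setT (fun z : borel E * borel E => retract_to V 0 z.1 : borel E).
    exact: (measurableT_comp mX (@measurable_fst _ _ _ _)).
  have m2 : measurable_fun setT (fun z : borel E * borel E => retract_to V 0 z.2 : borel E).
    exact: (measurableT_comp mX (@measurable_snd _ _ _ _)).
  have mG : cmeasurable G.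
    apply: cmeasurableM; last by apply: (cmeasurable_comp mv); exact: measurable_snd.
    apply: cmeasurableM.
      exact: (kernel_measurable sigma1 sigma2 mpsi tV m1 m2 (fun z => Vr z.1) (fun z => Vr z.2)).
    exact: (indicD_measurable tV mL m1 m2 (fun z => Vr z.1) (fun z => Vr z.2)).
  have := cmeasurableM (cmeasurable_indic (R := R) mV) (cmeasurable_cint_param m mG).
  congr cmeasurable; apply/funext => f; rewrite indicE.
  have [fV|fV] := boolP (f \in V); last by rewrite !mul0r.
  have [_ [_ ->]] := inner _ (set_mem fV).
  have rf : retract_to V 0 f = f by rewrite /retract_to fV.
  by rewrite /G /= rf.
move=> f Vf; have [_ [L1 ->]] := inner _ Vf.
apply: (le_trans (ler_nrm_cint L1)).
have iC : m.-integrable setT (EFin \o (fun x => (c * s f) *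
    (s (retract_to V 0 x) ^+ 1 * nrm (v x)))) by exact: integrableZr_EFin.
apply: (@le_trans _ _ (\int[m]_x ((c * s f) * (s (retract_to V 0 x) ^+ 1 * nrm (v x))))).
  apply: le_Rintegral => //; first by case: L1.
  by move=> x _; rewrite nrmM [leRHS]mulrA ler_wpM2r ?nrm_ge0.
by rewrite RintegralZl// mulrAC.
Qed.

(** The mean value theorem for [sin y - y] and then for [cos]; this crude quadratic bound suffices
    for the continuity of [bfun] at [h = 0]. *)
Lemma normr_sinB_le (x : R) : `|sin x - x| <= x ^+ 2.
Proof.
wlog x0 : x / 0 <= x.
  move=> H; have [/H//|/ltW] := leP 0 x.
  by rewrite -oppr_ge0 => /H; rewrite sinN sqrrN -opprD normrN.
have [->|xn0] := eqVneq x 0; first by rewrite sin0 subrr normr0 expr0n.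
have xgt0 : 0 < x by rewrite lt_neqAle eq_sym xn0.
have [|y /itvP xy] := @MVT R (fun y => sin y - y) (fun y => cos y - 1) 0 x xgt0 _.
  apply: continuous_subspaceT => y; apply: cvgB; last exact: cvg_id.
  exact: continuous_sin.
rewrite sin0 !subr0 => ->; rewrite normrM (ger0_norm x0) expr2 ler_wpM2r//.
have y0 : 0 < y by rewrite xy.
have [|z zy] := @MVT R cos (fun z => - sin z) 0 y y0 (fun z _ => is_derive_cos z).
  by apply: continuous_subspaceT; exact: continuous_cos.
rewrite cos0 subr0 => ->; rewrite normrM normrN (gtr0_norm y0).
apply: (@le_trans _ _ y); last by rewrite ltW// xy.
rewrite ler_piMl ?(ltW y0)//.
by rewrite ler_norml sin_geN1 sin_le1.
Qed.

(** Away from [h = 0] the formula is continuous as it stands; at 0 the distance to [t] is at most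
    [|h'| * t ^+ 2]. *)
Lemma bfun_continuous t : continuous (fun h => bfun h t).
Proof.
move=> h; have [->|h0] := eqVneq h 0; last first.
  have nh : \forall h' \near h, 2 / h' * sin (2^-1 * h' * t) = bfun h' t.
    have : \forall h' \near h, h' != 0.
      apply/nbhs_ballP; exists `|h|; first by rewrite /= normr_gt0.
      by move=> y; rewrite /ball /= => hy; apply/eqP => y0; move: hy; rewrite y0 subr0 ltxx.
    by apply: filterS => h' h'0; rewrite /bfun (negbTE h'0).
  apply: cvg_trans; first exact: (near_eq_cvg nh).
  rewrite /bfun (negbTE h0); apply: cvgM.
    by apply: cvgM; [exact: cvg_cst|apply: cvgV => //; exact: cvg_id].
  apply: continuous_cvg; first exact: continuous_sin.
  by apply: cvgM; [apply: cvgM; [exact: cvg_cst|exact: cvg_id]|exact: cvg_cst].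
have bd h' : `|bfun h' t - bfun 0 t| <= `|h'| * t ^+ 2.
  rewrite {2}/bfun eqxx; rewrite /bfun; case: eqVneq => [->|h'0].
    by rewrite subrr normr0 mul0r.
  have -> : 2 / h' * sin (2^-1 * h' * t) - t =
      2 / h' * (sin (2^-1 * h' * t) - 2^-1 * h' * t) by field.
  rewrite normrM (le_trans (ler_wpM2l _ (normr_sinB_le _)))// normrM normfV.
  have -> : (2^-1 * h' * t) ^+ 2 = 2^-1 ^+ 2 * (`|h'| ^+ 2 * t ^+ 2).
    by rewrite real_normK ?num_real//; ring.
  have n0 : `|h'| != 0 by rewrite normr_eq0.
  have t2 := sqr_ge0 t; have h2 := normr_ge0 h'.
  rewrite [leLHS](_ : _ = 2^-1 * (`|h'| * t ^+ 2)); first by have := mulr_ge0 h2 t2; lra.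
  by rewrite (ger0_norm (ler0n R 2)); field.
apply/cvgrPdist_le => e e0.
(* The added 1 avoids a division by zero when [t = 0]. *)
have t1 : 0 < t ^+ 2 + 1 by rewrite ltr_pwDr ?sqr_ge0.
near=> h'.
rewrite distrC (le_trans (bd h'))//.
apply: (@le_trans _ _ (`|h'| * (t ^+ 2 + 1))); first by rewrite ler_wpM2l// lerDl.
rewrite -ler_pdivlMr//; near: h'.
apply/nbhs_ballP; exists (e / (t ^+ 2 + 1)); first by rewrite /= divr_gt0.
by move=> y; rewrite /ball /= sub0r normrN => /ltW.
Unshelve. all: end_near. Qed.

Local Notation br h := (conv sigma (bkernel h)).

(** For fixed measures this is dominated convergence in [h']: the difference of two brackets is the
    convolution with the difference of their kernels, which [bfun_le] bounds by [2 * |t|] whatever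
    [h'] is. *)
Lemma bracket_kernel_cvg n mu nu h (e : R) :
  M_moment s (Some n.+1) mu -> M_moment s (Some n.+1) nu -> 0 < e ->
  \forall h' \near h, (norm_moment s n (br h' mu nu - br h mu nu)%R < e%:E)%E.
Proof.
move=> M1 M2 e0; have [N1 _] := M1; have [N2 _] := M2; have [s0 _ _] := ns.
have f1 := M_moment_mom M1 (ltn0Sn n); have f2 := M_moment_mom M2 (ltn0Sn n).
have [V [m [u [v [tV b1 b2]]]]] := base2 N1 N2.
pose p : borel E -> borel E := retract_to V 0.
pose X (z : borel E * borel E) : borel E := p z.1 + p z.2 : E.
pose psi h' (t : measurableTypeR R) : R[i] := -1 * bkernel h t + bkernel h' t.
have gb h' := bkernel_good c0 sigma_bound h'.
have gpsi h' : good_kernel sigma s (psi h') (nrm (-1) * c + c) 1 /\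
    conv sigma (psi h') mu nu = br h' mu nu - br h mu nu.
  have [g ->] := conv_kernel_lin sigma1 sigma2 ns (-1) (gb h) (gb h') N1 N2 f1 f2.
  by split => //; rewrite lin_subE.
pose t (z : borel E * borel E) := sigma (p z.1) (p z.2).
pose D (z : borel E * borel E) := nrm (u z.1 * v z.2).
have densE h' z : nrm (conv_density sigma (psi h') p p u v z) =
    `|bfun h' (t z) - bfun h (t z)| * D z.
  rewrite /conv_density nrmM /psi /bkernel mulN1r addrC -rmorphB /=.
  by rewrite nrm_real.
(* All moments up to order [n] are treated at once, by integrating against the sum of their
   weights. *)
pose W (z : borel E * borel E) := \sum_(k < n.+1) s (X z) ^+ k.
have W0 z : 0 <= W z by apply: sumr_ge0 => k _; rewrite exprn_ge0.
have D0 z : 0 <= D z by exact: nrm_ge0.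
have r0 := conv_based sigma1 sigma2 ns (gb 0) tV b1 b2 f1 f2.
have [mX [md0 _] _ _] := r0.
have mW : measurable_fun setT W.
  apply: measurable_sum => k; apply: measurable_funX.
  exact: (measurableT_comp (seminorm_measurable ns) mX).
have rpsi h' := conv_based sigma1 sigma2 ns (gpsi h').1 tV b1 b2 f1 f2.
have mdpsi h' : measurable_fun setT (fun z => `|bfun h' (t z) - bfun h (t z)| * D z).
  have [_ [md _] _ _] := rpsi h'; have := measurable_nrm md.
  by rewrite (_ : (fun z => _) = (fun z => `|bfun h' (t z) - bfun h (t z)| * D z))//;
    apply/funext => z; exact: densE.
pose F h' z := W z * (`|bfun h' (t z) - bfun h (t z)| * D z).
(* The bracket kernel at 0 has modulus [|t|]; its integrability against [W] is where the moments of
   order [n.+1] enter. *)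
pose G z := 2 * (W z * nrm (conv_density sigma (bkernel 0) p p u v z)).
have d0E z : nrm (conv_density sigma (bkernel 0) p p u v z) = `|t z| * D z.
  by rewrite /conv_density nrmM /bkernel nrm_real /bfun eqxx.
have iG : (m \x m)%E.-integrable setT (EFin \o G).
  apply: integrableZr_EFin.
  have : (m \x m)%E.-integrable setT (fun z => \sum_(k < n.+1)
      (s (X z) ^+ k * nrm (conv_density sigma (bkernel 0) p p u v z))%:E)%E.
    apply: (integrable_sum measurableT) => k _.
    apply/(wmass_integrable r0 (w := fun x => s x ^+ k)).
    - by apply: measurable_funX; exact: seminorm_measurable.
    - by move=> x; rewrite exprn_ge0.
    have [mpsi K0 psiK] := gb 0; have [_ _ r1] := b1; have [_ _ r2] := b2.
    have Vr := retract_toP (tame0 tV).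
    apply: (le_lt_trans (conv_wmass_le sigma1 sigma2 ns mpsi K0 psiK r1 r2 tV Vr Vr k ns)).
    have fin V' w tau i : based V' m w tau -> M_moment s (Some n.+1) tau -> (i <= n)%N ->
        (0 <= wmass m (retract_to V' 0) w (fun x => s x ^+ 1 * s x ^+ i)%R < +oo)%E.
      move=> b M i_n; rewrite wmass_ge0 => [|x]; last by rewrite mulr_ge0 ?exprn_ge0.
      rewrite (_ : (fun x => s x ^+ 1 * s x ^+ i) = (fun x => s x ^+ i.+1)); last first.
        by apply/funext => x; rewrite -exprD.
      by rewrite -(mom_based _ b ns); exact: M_moment_mom M _.
    apply: lte_sum_pinfty => i _.
    have ik : (i <= n)%N by rewrite (leq_trans (_ : i <= k)%N) -1?ltnS.
    have ki : (k - i <= n)%N by rewrite (leq_trans (leq_subr _ _)) -1?ltnS.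
    have /andP[A0 A1] := fin _ _ _ _ b1 M1 ki.
    have /andP[B0 B1] := fin _ _ _ _ b2 M2 ik.
    apply: lte_mul_pinfty => //; first by rewrite lee_fin mulr_ge0.
    by apply: lte_mul_pinfty => //; rewrite ge0_fin_numE.
  apply: eq_integrable => // z _ /=.
  by rewrite sumEFin -mulr_suml.
have FG h' z : `|F h' z| <= G z.
  rewrite /F /G d0E ger0_norm ?mulr_ge0 ?normr_ge0//.
  rewrite [leRHS]mulrCA ler_wpM2l// mulrA ler_wpM2r//.
  rewrite (le_trans (ler_normB _ _))//.
  by have := bfun_le h' (t z); have := bfun_le h (t z); lra.
have mF h' : measurable_fun setT (F h') by exact: measurable_funM.
have iF h' : (m \x m)%E.-integrable setT (EFin \o F h').
  apply: le_integrable iG => //; first exact/measurable_EFinP.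
  by move=> z _ /=; rewrite lee_fin (le_trans (FG h' z))// ler_norm.
have nF h' : (norm_moment s n (br h' mu nu - br h mu nu)%R <=
    (\int[(m \x m)%E]_z F h' z)%:E)%E.
  have [g E1] := gpsi h'; have [M3 _] := conv_norm_moment sigma1 sigma2 ns g M1 M2.
  rewrite -E1 norm_momentE//; [|by case: M3|by case: M3].
  rewrite (_ : (\int[(m \x m)%E]_z F h' z)%:E = (\int[(m \x m)%E]_z (F h' z)%:E)%E); last first.
    by rewrite /Rintegral fineK//; exact: (integrable_fin_num measurableT (iF h')).
  rewrite (_ : (\int[(m \x m)%E]_z (F h' z)%:E)%E = (\int[(m \x m)%E]_z \sum_(k < n.+1)
      (s (X z) ^+ k * (`|bfun h' (t z) - bfun h (t z)| * D z))%:E)%E); last first.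
    by apply: eq_integral => z _; rewrite sumEFin -mulr_suml.
  rewrite ge0_integral_sum//; last 2 first.
  - move=> k; apply/measurable_EFinP; apply: measurable_funM => //.
    apply: measurable_funX.
    exact: (measurableT_comp (seminorm_measurable ns) mX).
  - by move=> k z _; rewrite lee_fin !mulr_ge0 ?exprn_ge0.
  apply: lee_sum => k _.
  have ms : measurable_fun setT (fun x : borel E => (s x ^+ k)%:E).
    by apply/measurable_EFinP; apply: measurable_funX; exact: seminorm_measurable.
  apply: (le_trans (cvariation_integral_le (rpsi h') ms _)).
    by move=> x; rewrite lee_fin exprn_ge0.
  rewrite le_eqVlt; apply/orP; left; apply/eqP; apply: eq_integral => z _.
  by rewrite -EFinM densE.
have cF : (fun h' => \int[(m \x m)%E]_z F h' z) @ h --> \int[(m \x m)%E]_z F h z.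
  apply: (@continuity_under_integral R _ _ (m \x m)%E F setT measurableT (h - 1) (h + 1)
    (fun h' _ => iF h') _ G iG).
  - apply: aeW => z _ h' _; apply: cvgM; first exact: cvg_cst.
    apply: cvgM; last exact: cvg_cst.
    apply: cvg_norm; apply: cvgB; last exact: cvg_cst.
    exact: bfun_continuous.
  - by move=> h' _; apply: aeW => z _; exact: FG.
  - by rewrite inE /= in_itv /= ltrBlDr ltrDl ltr01.
have Fh : \int[(m \x m)%E]_z F h z = 0.
  rewrite (_ : F h = fun=> 0) ?Rintegral_cst ?mul0r//.
  by apply/funext => z; rewrite /F subrr normr0 mul0r mulr0.
rewrite Fh in cF.
apply: filterS (cvgr_lt 0 cF e e0) => h' h'e.
by apply: (le_lt_trans (nF h')); rewrite lte_fin.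
Qed.

(** The radius [d] is chosen before [h']: the constant of the norm estimate is the same for all
    [h'], so only the term with both measures fixed forces [h'] towards [h]. *)
Lemma bracket_continuous_at n mu nu h (e : R) :
  M_moment s (Some n.+1) mu -> M_moment s (Some n.+1) nu -> 0 < e ->
  exists2 d : R, 0 < d & \forall h' \near h, forall mu' nu',
    M_moment s (Some n.+1) mu' -> M_moment s (Some n.+1) nu' ->
    (norm_moment s n.+1 (mu' - mu)%R < d%:E)%E ->
    (norm_moment s n.+1 (nu' - nu)%R < d%:E)%E ->
    (norm_moment s n (br h' mu' nu' - br h mu nu)%R < e%:E)%E.
Proof.
move=> M1 M2 e0; have e20 : 0 < e / 2 by rewrite divr_gt0.
have gb h' := bkernel_good c0 sigma_bound h'.
pose C := c * (max_bin n)%:R.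
have C0 : 0 <= C by rewrite mulr_ge0// ltW.
pose nm (tau : set (borel E) -> R[i]) := \sum_(k < n.+2) fine (mom s k tau).
have nmE tau : M_moment s (Some n.+1) tau -> norm_moment s n.+1 tau = (nm tau)%:E.
  exact: M_moment_norm.
have nm0 tau : M_moment s (Some n.+1) tau -> 0 <= nm tau.
  by move=> [N _]; apply: sumr_ge0 => k _; rewrite fine_ge0// mom_ge0.
(* For [d <= 1] the three bilinear terms add up to at most [C * (d + d * nm nu + d * nm mu)], hence
   to at most [d * B]; the final 1 keeps [B] positive. *)
pose B := C * (1 + nm mu + nm nu) + 1.
have B0 : 0 < B by rewrite ltr_wpDl// mulr_ge0// !addr_ge0// nm0.
pose d := Num.min 1 (e / 2 / B).
have d0 : 0 < d by rewrite lt_min ltr01 divr_gt0.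
have d1 : d <= 1 by rewrite ge_min lexx.
have dB : d * B <= e / 2 by rewrite -ler_pdivlMr// ge_min lexx orbT.
exists d => //.
have := bracket_kernel_cvg h M1 M2 e20; apply: filterS => h' h'e mu' nu' M3 M4.
have M31 := M_momentB ns M3 M1; have M42 := M_momentB ns M4 M2.
rewrite !nmE// !lte_fin => lt1 lt2.
have f1 := M_moment_mom M1 (ltn0Sn n); have f2 := M_moment_mom M2 (ltn0Sn n).
have f3 := M_moment_mom M3 (ltn0Sn n); have f4 := M_moment_mom M4 (ltn0Sn n).
have -> : br h' mu' nu' - br h mu nu =
    (br h' mu' nu' - br h' mu nu) + (br h' mu nu - br h mu nu).
  by rewrite addrA subrK.
rewrite (conv_diff sigma1 sigma2 ns (gb h') M1.1 M2.1 M3.1 M4.1)//.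
have bd (tau tau' : set (borel E) -> R[i]) : M_moment s (Some n.+1) tau ->
    M_moment s (Some n.+1) tau' -> M_moment s (Some n) (br h' tau tau') /\
    (norm_moment s n (br h' tau tau') <= (C * nm tau * nm tau')%:E)%E.
  move=> T1 T2; have [T3 le] := conv_norm_moment sigma1 sigma2 ns (gb h') T1 T2.
  by split => //; rewrite (le_trans le)// !nmE// -!EFinM.
have [P1 L1] := bd _ _ M31 M42; have [P2 L2] := bd _ _ M31 M2; have [P3 L3] := bd _ _ M1 M42.
have MD (tau tau' : set (borel E) -> R[i]) : M_moment s (Some n) tau ->
    M_moment s (Some n) tau' -> M_moment s (Some n) (tau + tau').
  by move=> T1 T2; rewrite -[tau]scale1r; exact: M_moment_lin.
have P4 : M_moment s (Some n) (br h' mu nu - br h mu nu).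
  exact: (M_momentB ns (bd _ _ M1 M2).1 (conv_norm_moment sigma1 sigma2 ns (gb h) M1 M2).1).
have P23 := MD _ _ P2 P3.
have LL := norm_momentD ns (MD _ _ P1 P23) P4.
apply: (le_lt_trans LL).
have L5 := le_trans (norm_momentD ns P1 P23)
  (leeD L1 (le_trans (norm_momentD ns P2 P3) (leeD L2 L3))).
rewrite -!EFinD in L5.
apply: (@lt_le_trans _ _ ((e / 2)%:E + (e / 2)%:E)%E); last by rewrite -EFinD -splitr.
apply: (le_lt_trans (leeD L5 (lexx _))).
apply: lee_ltD => //; rewrite lee_fin.
have := nm0 _ M31; have := nm0 _ M42; have := nm0 _ M1; have := nm0 _ M2.
move: dB lt1 lt2; rewrite /B.
move: (nm mu) (nm nu) (nm (_ - _)) (nm (_ - _)) => a b y x dB xd yd b0 a0 y0 x0.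
have H1 : x * y <= d by rewrite (le_trans _ (ltW xd))// ler_piMr// (le_trans (ltW yd)).
have H2 : x * b <= d * b by rewrite ler_wpM2r// ltW.
have H3 : a * y <= d * a by rewrite mulrC ler_wpM2r// ltW.
apply: (le_trans _ dB).
have -> : C * x * y + (C * x * b + C * a * y) = C * (x * y + (x * b + a * y)) by ring.
have -> : d * (C * (1 + a + b) + 1) = C * (d + (d * b + d * a)) + d by ring.
apply: (le_trans (ler_wpM2l C0 (lerD H1 (lerD H2 H3)))).
by rewrite lerDl ltW.
Qed.

Lemma M_momentS n (k : nat) mu : admissible n k -> M_moment s n mu -> M_moment s (Some k) mu.
Proof.
move=> nk [N h]; split => // m mk; apply: h.
by case: n nk => // n nk; exact: leq_trans mk nk.
Qed.

(** Here [omap S n] is the order [n + 1], with [oo + 1 = oo], so that finite and infinite orders are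
    covered by one statement. *)
Lemma bracket_moment n h mu nu : M_moment s (omap S n) mu -> M_moment s (omap S n) nu ->
  M_moment s n (br h mu nu).
Proof.
move=> M1 M2; have gb := bkernel_good c0 sigma_bound h.
case: n M1 M2 => [n|] M1 M2.
  by have [] := conv_norm_moment sigma1 sigma2 ns gb M1 M2.
have P k : M_moment s (Some k) (br h mu nu).
  have N1 : M_moment s (Some k.+1) mu by exact: M_momentS M1.
  have N2 : M_moment s (Some k.+1) nu by exact: M_momentS M2.
  by have [] := conv_norm_moment sigma1 sigma2 ns gb N1 N2.
by split=> [|k _]; [exact: (P 0%N).1|exact: M_moment_mom (P k) _].
Qed.

Lemma bracket_moment_nbhs n h mu nu (U : set (set (borel E) -> R[i])) :
  M_moment s (omap S n) mu -> M_moment s (omap S n) nu ->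
  moment_nbhs s n (br h mu nu) U ->
  exists N1 N2 : set (set (borel E) -> R[i]),
    [/\ moment_nbhs s (omap S n) mu N1, moment_nbhs s (omap S n) nu N2,
        forall mu', N1 mu' -> M_moment s (omap S n) mu' &
        \forall h' \near h, forall mu' nu', N1 mu' -> N2 nu' ->
          M_moment s (omap S n) nu' /\ U (br h' mu' nu')].
Proof.
move=> M1 M2 [m [e [nm e0 eU]]].
have adm : admissible (omap S n) m.+1 by case: n nm {M1 M2 eU} => //= n ->.
have L tau : M_moment s (omap S n) tau -> M_moment s (Some m.+1) tau.
  exact: M_momentS.
have [d d0 near_h] := bracket_continuous_at h (L _ M1) (L _ M2) e0.
exists [set tau | M_moment s (omap S n) tau /\
    (norm_moment s m.+1 (tau - mu)%R < d%:E)%E],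
  [set tau | M_moment s (omap S n) tau /\
    (norm_moment s m.+1 (tau - nu)%R < d%:E)%E].
split.
- exists m.+1, d; split => //; first by case: n nm {M1 M2 eU adm L} => //= n ->.
- exists m.+1, d; split => //; first by case: n nm {M1 M2 eU adm L} => //= n ->.
- by move=> mu' [].
apply: filterS near_h => h' h'P mu' nu' [M3 lt1] [M4 lt2]; split => //.
apply: eU; first exact: bracket_moment.
exact: h'P (L _ M3) (L _ M4) lt1 lt2.
Qed.

Lemma bracket_jointly_continuousP n :
  bracket_jointly_continuous sigma s (omap S n) n.
Proof.
move=> h mu nu M1 M2.
have bE tau tau' h' : M_moment s (omap S n) tau -> M_moment s (omap S n) tau' ->
    bracket sigma h' tau tau' = br h' tau tau'.
  by move=> [N1 _] [N2 _]; exact: (bracketE sigma1 sigma2 sigmaA ns).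
rewrite bE//; split; first exact: bracket_moment.
move=> U /(bracket_moment_nbhs M1 M2)[N1 [N2 [n1 n2 N1M near_h]]].
exists ([set h' | forall mu' nu', N1 mu' -> N2 nu' ->
    M_moment s (omap S n) nu' /\ U (br h' mu' nu')], N1 `*` N2).
  by split; [exact: near_h|exists (N1, N2); [split; [exact: n1|exact: n2]|]].
move=> [h' [mu' nu']] /= [P [n1' n2']]; have [M3 +] := P _ _ n1' n2'.
by rewrite bE//; exact: N1M.
Qed.

Lemma bracket0_jointly_continuousP :
  bracket0_jointly_continuous sigma s None None.
Proof.
move=> mu nu M1 M2; rewrite bracket0E.
split; first exact: (@bracket_moment None).
move=> U /(@bracket_moment_nbhs None 0 mu nu U M1 M2)[N1 [N2 [n1 n2 N1M near_h]]].
exists (N1, N2); first by split; [exact: n1|exact: n2].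
move=> [mu' nu'] /= [n1' n2'].
by have [_] := nbhs_singleton near_h _ _ n1' n2'; rewrite -bracket0E.
Qed.

End bracket_continuity.

(** * Haar measure *)

Lemma image_measure_ex d1 d2 (T1 : measurableType d1) (T2 : measurableType d2)
    (R : realType) (m : {measure set T1 -> \bar R}) (f : T1 -> T2) :
  measurable_fun setT f ->
  exists N : {measure set T2 -> \bar R}, forall A, N A = m (f @^-1` A).
Proof.
move=> mf; have [N NE] := density_measure m mf (measurable_cst (1 : R)) (fun _ => ler01).
pose N' (A : set T2) := m (f @^-1` A).
have N0 : N' set0 = 0%E by rewrite /N' preimage_set0 measure0.
have Nge0 A : (0 <= N' A)%E by exact: measure_ge0.
have mfA A : measurable A -> measurable (f @^-1` A).
  by move=> mA; rewrite -[X in measurable X]setTI; exact: mf.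
have Nsa : semi_sigma_additive N'.
  move=> F mF tF mUF; rewrite /N' preimage_bigcup.
  apply: measure_semi_sigma_additive.
  - by move=> n; exact: mfA.
  - apply/trivIsetP => i j _ _ ij; rewrite -preimage_setI.
    by move/trivIsetP : tF => ->//; rewrite preimage_set0.
  - by rewrite -preimage_bigcup; exact: mfA.
pose mN := isMeasure.Build _ _ _ N' N0 Nge0 Nsa.
by exists (HB.pack_for {measure set T2 -> \bar R} N' mN).
Qed.

(** The translated measure agrees with Lebesgue measure on half-open intervals, and these determine
    it. *)
Lemma lebesgue_measure_translate (R : realType) (s : R) (A : set (measurableTypeR R)) :
  measurable A ->
  lebesgue_measure ((fun t : measurableTypeR R => (s + t : R)) @^-1` A) =
  lebesgue_measure A.
Proof.
move=> mA; have ms : measurable_fun setT (fun t : measurableTypeR R => s + t : measurableTypeR R).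
  by apply: measurable_funD; [exact: measurable_cst|exact: measurable_id].
have [N NE] := image_measure_ex (@lebesgue_measure R) ms.
rewrite -NE; apply/esym; apply: lebesgue_measure_unique => // _ [[a b]] _ <-.
rewrite NE /= (_ : _ @^-1` _ = `]a - s, b - s]%classic).
  by rewrite !lebesgue_measure_itv /= !lte_fin ltrD2r -!EFinB opprB addrA subrK.
by apply/seteqP; split=> t /=; rewrite !in_itv /= ltrBlDl lerBrDl.
Qed.

Section haar.
Context {R : realType} {E : lmodType R}.
Implicit Types (F : set E) (A : set (borel E)).

Lemma translate_image x (A : set E) : [set x + y | y in A] = (fun y => - x + y) @^-1` A.
Proof.
apply/seteqP; split=> [_ [y Ay <-]|y Ay]; first by rewrite /= addKr.
by exists (- x + y) => //; rewrite addNKr.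
Qed.

Lemma seminorm_continuous (kappa : E -> R) : seminorm kappa ->
  continuous (kappa : il E -> R^o).
Proof.
move=> nk x; have [k0 kD kZ] := nk; move=> U /nbhs_ballP[e /= e0 eU].
apply/nbhs_ilP; exists (fun y => e^-1 * kappa y).
  by apply: seminormZ => //; rewrite invr_ge0 ltW.
move=> y; rewrite mulrC ltr_pdivrMr// mul1r => ye; apply: eU; apply: le_lt_trans ye.
have h1 := kD (y - x) x; have h2 := kD (x - y) y.
rewrite !subrK -(seminormN (x - y) nk) opprB in h1 h2.
by rewrite ler_norml; lra.
Qed.

Lemma il_opp_continuous : continuous (fun x : il E => (- x : E) : il E).
Proof.
move=> x U /nbhs_ilP[kappa nk kU]; apply/nbhs_ilP; exists kappa => // y yx.
by apply: kU; rewrite -opprD seminormN.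
Qed.

(** A functional with value 1 at [x - y] gives a seminorm in which [x] and [y] are at distance 1, so
    the balls of radius 1/2 around them are disjoint. *)
Lemma il_hausdorff : hausdorff_space (il E).
Proof.
rewrite open_hausdorff => x y xy.
have [|psi lpsi psi1] := @separating_functional R E (x - y); first by rewrite subr_eq0.
have [kappa nk k1] : exists2 kappa : E -> R, seminorm kappa & kappa (x - y) = 1.
  by exists (fun x => `|psi x|); rewrite ?psi1 ?normr1//; exact: seminorm_functional.
have h0 : 0 < 2^-1 :> R by rewrite invr_gt0.
exists ([set z : E | kappa (z - x) < 2^-1], [set z : E | kappa (z - y) < 2^-1]).
  by rewrite !inE /= !subrr seminorm_0.
split; [exact: (il_ball_open nk h0)|exact: (il_ball_open nk h0)|apply/eqP].
apply/seteqP; split=> // z [/= h1 h2].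
have [_ kD _] := nk.
have : kappa (x - y) < 1.
  rewrite -(subrK z x) -addrA (le_lt_trans (kD _ _))// -(seminormN _ nk) opprB.
  by rewrite [ltRHS](splitr 1) mul1r ltrD.
by rewrite k1 ltxx.
Qed.

Lemma compact_measurable (K : set (il E)) : compact K -> measurable (K : set (borel E)).
Proof.
move=> /(compact_closed il_hausdorff) cK; rewrite -[K]setCK.
by apply: measurableC; apply: measurable_open; exact: closed_openC.
Qed.

Lemma seminorm_compact (kappa : E -> R) (K : set (il E)) : seminorm kappa -> compact K ->
  exists r, forall x, K x -> kappa x <= r.
Proof.
move=> nk cK; have ck := continuous_subspaceT (A := K) (seminorm_continuous nk).
have /compact_bounded[M [_ /(_ (M + 1))]] := continuous_compact ck cK.
rewrite ltrDl ltr01 => /(_ isT) h; exists (M + 1) => x Kx.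
by rewrite (le_trans (ler_norm _))//; apply: h; exists x.
Qed.

Section construction.
Variables (n : nat) (b : nat -> E) (phi : nat -> E -> R).
Hypothesis bphi : biorthogonal n b phi.

Let lphi i : scalar (phi i). Proof. by case: bphi. Qed.

(** Finiteness on the balls of this seminorm replaces finiteness on compact sets in the induction; a
    seminorm is bounded on compact sets, so the latter follows at the end. *)
Definition coord_norm k x := \sum_(i < k) `|phi i x|.

Lemma coord_norm_seminorm k : seminorm (coord_norm k).
Proof.
split=> [x|x y|a x]; first by apply: sumr_ge0 => i _; exact: normr_ge0.
  rewrite /coord_norm -big_split /=; apply: ler_sum => i _.
  by rewrite scalarD// ler_normD.
by rewrite /coord_norm mulr_sumr; apply: eq_bigr => i _; rewrite scalarZ// normrM.
Qed.

Let fspan k : fin_dim_subspace (span k b).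
Proof. by apply/fin_dim_spanP; exists k, b. Qed.

Lemma span_recr k x t : span k b x -> span k.+1 b (x + t *: b k).
Proof.
move=> [a _ <-]; exists (fun i => if (i < k)%N then a i else t) => //.
rewrite /lincomb big_ord_recr /= ltnn; congr (_ + _).
by apply: eq_bigr => i _; rewrite ltn_ord.
Qed.

Lemma span_recrP k x : span k.+1 b x -> exists t y, span k b y /\ x = y + t *: b k.
Proof.
move=> [a _ <-]; exists (a k), (lincomb k b a).
by rewrite /lincomb big_ord_recr /=; split => //; exists a.
Qed.

(** The next measure is the image of [lam] times Lebesgue measure under the map sending [(w, t)] to
    [p w + t *: b k]. Invariance is phrased through preimages and local finiteness through balls,
    because both are easy to follow along an image measure. *)
Lemma haar_span k : (k <= n)%N ->
  exists lambda : {measure set (borel E) -> \bar R},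
  [/\ forall A, measurable A -> A `&` span k b = set0 -> lambda A = 0%E,
      forall x A, span k b x -> measurable A ->
        lambda ((fun y : borel E => (x + y : E) : borel E) @^-1` A) = lambda A,
      forall r, (lambda [set x | (coord_norm k x <= r)%R] < +oo)%E &
      (0 < lambda setT)%E].
Proof.
elim: k => [_|k IH kn].
  have s0 : span 0 b = [set 0].
    apply/seteqP; split=> [_ [a _ <-]|_ ->]; rewrite /lincomb ?big_ord0//.
    by exists (fun=> 0) => //; rewrite /lincomb big_ord0.
  (* In dimension 0 the measure is a unit mass at the origin. *)
  have [N dE] : exists N : {measure set (borel E) -> \bar R},
      forall A, N A = ((0 : E) \in A)%:R%:E.
    by exists (@dirac _ (borel E) (0 : E) R) => A; exact: diracE.
  exists N; split.
  - move=> A mA A0; rewrite dE memNset// => A00.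
    by have : (A `&` span 0 b) 0 by [split => //; rewrite s0]; rewrite A0.
  - move=> x A; rewrite s0 => -> mA; congr (N _).
    by apply/seteqP; split=> y /=; rewrite add0r.
  - by move=> r; rewrite dE ltry.
  - by rewrite dE in_setT lte01.
have [lam [lamF lamT lamB lam0]] := IH (ltnW kn).
pose V := span k b; pose W := span k.+1 b.
have tW : tame W := tame_fin_dim (fspan k.+1).
have tV : tame V := tame_fin_dim (fspan k).
have mV : measurable (V : set (borel E)) by exact: tame_measurable.
pose p : borel E -> borel E := retract_to V 0.
have Vp x : V (p x) by exact: (retract_toP (tame0 tV)).
have pV x : V x -> p x = x by move=> Vx; rewrite /p /retract_to mem_set.
have mp : measurable_fun setT p by exact: measurable_retract_to.
have lamV : lam (~` V) = 0%E by apply: lamF; [exact: measurableC|rewrite setICl].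
pose leb : {sigma_finite_measure set (measurableTypeR R) -> \bar R} := @lebesgue_measure R.
have VW x : V x -> W x by move=> Vx; have := span_recr 0 Vx; rewrite scale0r addr0.
have Wb t : W (t *: b k).
  by have := span_recr t (tame0 tV); rewrite add0r.
have mb d (O : measurableType d) (g : O -> measurableTypeR R) : measurable_fun setT g ->
    measurable_fun setT (fun z => g z *: b k : borel E).
  move=> mg; have := @measurable_lincomb R E _ O 1 (fun _ => b k) (fun _ => g) (fun _ _ => mg).
  by congr measurable_fun; apply/funext => z; rewrite /lincomb big_ord1.
have mPhi d (O : measurableType d) (f : O -> borel E) (g : O -> measurableTypeR R) :
    measurable_fun setT f -> measurable_fun setT g -> (forall z, V (f z)) ->
    measurable_fun setT (fun z => (f z + g z *: b k : E) : borel E).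
  move=> mf mg Vf; apply: (tame_measurableD tW mf (mb _ _ _ mg)) => z; last exact: Wb.
  exact: VW.
have mfst : measurable_fun setT (fun z : borel E * measurableTypeR R => p z.1).
  exact: (measurableT_comp mp (@measurable_fst _ _ _ _)).
have msnd : measurable_fun setT (fun z : borel E * measurableTypeR R => z.2).
  exact: measurable_snd.
pose Phi (z : borel E * measurableTypeR R) : borel E := p z.1 + z.2 *: b k.
have mP : measurable_fun setT Phi := mPhi _ _ _ _ mfst msnd (fun z => Vp z.1).
have [lam' lamE] := image_measure_ex (lam \x leb)%E mP.
exists lam'; split.
- move=> A mA AW; rewrite lamE (_ : _ @^-1` A = set0) ?measure0//.
  apply/seteqP; split=> // z /= Az.
  have : (A `&` W) (p z.1 + z.2 *: b k) by split => //; exact: (span_recr _ (Vp z.1)).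
  by rewrite AW.
(* Translation by [y + t *: b k] shifts the section over [w] by [t] and moves [w] to [y + w]; the
   first is absorbed by Lebesgue measure, the second by [lam]. *)
- move=> x A /span_recrP[t [y [Vy ->]]] mA; rewrite !lamE.
  have mpre B : measurable B -> measurable (Phi @^-1` B).
    by move=> mB; rewrite -[X in measurable X]setTI; exact: mP.
  pose h (B : set (borel E)) (w : borel E) := leb (xsection (Phi @^-1` B) w).
  have mh : measurable_fun setT (h A) by apply: measurable_fun_xsection; exact: mpre.
  have h0 w : (0 <= h A w)%E by exact: measure_ge0.
  have mty : measurable_fun setT (fun w : borel E => (y + w : E) : borel E).
    exact: measurable_translate.
  set B := _ @^-1` A.
  have mB : measurable B.
    by rewrite -[B]setTI; apply: (measurable_translate (y + t *: b k)).
  transitivity (\int[lam]_w h A (y + w)%R)%E; last first.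
    have := @ge0_integral_pushforward _ _ (borel E) (borel E) R _ mty lam setT (h A) measurableT mh
      (fun w _ => h0 w).
    rewrite preimage_setT => <-; apply: eq_setfun_integral => C mC.
    exact: lamT.
  rewrite [LHS](_ : _ = \int[lam]_w h B w)%E//.
  rewrite [LHS](conull_integral _ mV lamV) [RHS](conull_integral _ mV lamV).
  apply: eq_integral => w _; rewrite /patch; case: ifPn => // wV.
  have Vw : V w by exact: set_mem.
  rewrite /h /leb /= -[RHS](lebesgue_measure_translate t); last first.
    by apply: measurable_xsection; exact: mpre.
  congr (lebesgue_measure _); apply/seteqP.
  have Vyw : V (y + w) by exact: (tameD tV).
  by split=> q; rewrite /xsection /= !inE /= /B /Phi /= (pV w Vw) (pV (y + w) Vyw)
    scalerDl addrACA.
- move=> r; rewrite lamE.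
  have mN j : measurable [set x : borel E | coord_norm j x <= r].
    rewrite -[X in measurable X]setTI.
    rewrite (_ : [set x : borel E | coord_norm j x <= r] =
      (coord_norm j : borel E -> R) @^-1` `]-oo, r]%classic); last first.
      by apply/seteqP; split => x /=; rewrite in_itv.
    by apply: (seminorm_measurable (coord_norm_seminorm j)).
  pose D := p @^-1` [set x : borel E | coord_norm k x <= r].
  have mD : measurable D by rewrite -[D]setTI; apply: mp => //; exact: mN.
  have mI : measurable (`[- r, r]%classic : set (measurableTypeR R)) by [].
  (* On the ball the first [k] coordinates have norm at most [r] and the last one lies between [- r]
     and [r], so the ball sits in a rectangle of finite measure. *)
  apply: (@le_lt_trans _ _ ((lam \x leb)%E (D `*` `[- r, r]%classic))).
    apply: le_measure; rewrite ?inE.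
    - by rewrite -[X in measurable X]setTI; apply: mP.
    - exact: measurableX.
    move=> z /= zr.
    have ck i : (i < k)%N -> phi i (p z.1 + z.2 *: b k) = phi i (p z.1).
      move=> ik; rewrite scalarD// scalarZ//.
      have [_ ->] := bphi; [|exact: (ltn_trans ik)|exact: kn].
      by rewrite (ltn_eqF ik) mulr0 addr0.
    have cz : phi k (p z.1 + z.2 *: b k) = z.2.
      rewrite scalarD// scalarZ//; have [_ ->//] := bphi; rewrite eqxx mulr1.
      have [a _ <-] := Vp z.1; rewrite /lincomb scalar_sum// big1 ?add0r// => i _.
      have [_ ->] := bphi; [|exact: kn|exact: (ltn_trans (ltn_ord i))].
      by rewrite (gtn_eqF (ltn_ord i)) mulr0.
    move: zr; rewrite /coord_norm big_ord_recr /= cz.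
    under eq_bigr => i _ do rewrite ck//.
    move=> zr; split => /=.
      by rewrite /D /= (le_trans _ zr)// lerDl.
    rewrite in_itv /= -ler_norml (le_trans _ zr)// lerDr.
    by apply: sumr_ge0 => i _; exact: normr_ge0.
  rewrite /= product_measure1E//; apply: lte_mul_pinfty.
  - exact: measure_ge0.
  - rewrite ge0_fin_numE ?measure_ge0//.
    apply: (@le_lt_trans _ _ (lam ([set x | coord_norm k x <= r] `|` ~` V))).
      apply: le_measure; rewrite ?inE//; first by apply: measurableU => //; exact: measurableC.
      move=> w /= wD; have [Vw|nV] := pselect (V w); last by right.
      by left; move: wD; rewrite /D /= pV.
    have := measureU2 lam (mN k) (measurableC mV).
    rewrite [X in (_ + X)%E](lamV : _ = 0%E) adde0 => h; apply: (le_lt_trans h).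
    exact: lamB.
  - rewrite /leb /= lebesgue_measure_itv /=; case: ifP => _ //.
    by rewrite -EFinB ltry.
(* The total mass is infinite, since [lam] is nonzero and the line has infinite length. *)
rewrite lamE preimage_setT -setXTT /= product_measure1E//.
rewrite (_ : leb setT = +oo%E); first by rewrite gt0_muley.
by rewrite /leb /= -set_itvNyy lebesgue_measure_itv.
Qed.

End construction.

Lemma haar_measure_ex F : fin_dim_subspace F ->
  exists lambda : {measure set (borel E) -> \bar R}, haar_measure F lambda.
Proof.
move=> /fin_dimP[n [b [phi [bphi ->]]]].
have [lam [lF lT lB l0]] := haar_span bphi (leqnn n).
have fF : fin_dim_subspace (span n b) by apply/fin_dim_spanP; exists n, b.
exists lam; split => //.
- move=> x A Fx mA; rewrite translate_image; apply: lT => //.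
  by apply: (tameN (tame_fin_dim fF)).
- move=> K cK KF; have nn := coord_norm_seminorm bphi n.
  have [r Kr] := seminorm_compact nn cK.
  apply: le_lt_trans (lB r); apply: le_measure; rewrite ?inE.
  + exact: compact_measurable.
  + rewrite -[X in measurable X]setTI.
    rewrite (_ : [set x : borel E | coord_norm phi n x <= r] =
      (coord_norm phi n : borel E -> R) @^-1` `]-oo, r]%classic); last first.
      by apply/seteqP; split => x /=; rewrite in_itv.
    by apply: (seminorm_measurable nn).
  + exact: Kr.
Qed.

(** [M_fin_a] asks only for some Haar measure. Summands dominated by two different ones are
    dominated by their sum, which is again a Haar measure; this bypasses uniqueness up to a
    factor. *)
Lemma haar_measureD F (l1 l2 : {measure set (borel E) -> \bar R}) :
  haar_measure F l1 -> haar_measure F l2 ->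
  exists2 lambda : {measure set (borel E) -> \bar R}, haar_measure F lambda &
    forall A, lambda A = (l1 A + l2 A)%E.
Proof.
move=> [c1 t1 k1 p1] [c2 t2 k2 p2]; 
have [l lE] : exists l : {measure set (borel E) -> \bar R},
    forall A, l A = (l1 A + l2 A)%E.
  by exists (measure_add l1 l2); exact: measure_addE.
exists l => //; split.
- by move=> A mA AF; rewrite lE c1// c2// adde0.
- by move=> x A Fx mA; rewrite !lE t1// t2.
- by move=> K cK KF; rewrite lE lte_add_pinfty// ?k1// k2.
- by rewrite lE (lt_le_trans p1)// leeDl.
Qed.

(** The reflected Haar measure dominates the adjoint of any measure dominated by the original
    one. *)
Lemma haar_measureN F (l : {measure set (borel E) -> \bar R}) : fin_dim_subspace F ->
  haar_measure F l ->
  exists2 lambda : {measure set (borel E) -> \bar R}, haar_measure F lambda &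
    forall A, lambda A = l [set - x | x in A].
Proof.
move=> fF [c1 t1 k1 p1]; have [lam lamE] := image_measure_ex l (@measurable_opp R E).
have tF := tame_fin_dim fF.
exists lam; last by move=> A; rewrite lamE opp_image.
have mN A : measurable A -> measurable ((fun x : borel E => (- x : E) : borel E) @^-1` A).
  by move=> mA; rewrite -[X in measurable X]setTI; exact: measurable_opp.
split.
- move=> A mA AF; rewrite lamE c1//; first exact: mN.
  apply/seteqP; split=> // x [/= Ax Fx].
  have : (A `&` F) (- x) by split => //; exact: tameN.
  by rewrite AF.
- move=> x A Fx mA; rewrite !lamE -(t1 (- x) _ (tameN tF Fx) (mN _ mA)).
  congr (l _); rewrite !translate_image; apply/seteqP; split=> y /=;
    by rewrite opprD opprK.
- move=> K cK KF; rewrite lamE; apply: k1.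
    rewrite -opp_image; apply: continuous_compact cK.
    by apply: continuous_subspaceT; exact: il_opp_continuous.
  by move=> x /= /KF Fx; rewrite -[x]opprK; exact: tameN.
- by rewrite lamE preimage_setT.
Qed.

End haar.

(** * Stable subspaces *)

Section concentration.
Context {R : realType} {E : lmodType R}.
Implicit Types (mu nu rho : set (borel E) -> R[i]).

Lemma based_ex (D1 D2 : set E) mu nu : complex_measure mu -> complex_measure nu ->
  measurable (D1 : set (borel E)) -> measurable (D2 : set (borel E)) -> concentrated_on D1 mu -> concentrated_on D2 nu ->
  exists m u v, based D1 m u mu /\ based D2 m v nu.
Proof.
move=> c1 c2 mD1 mD2 d1 d2.
have [m1 n1] := complex_measure_dominated c1.
have [m2 n2] := complex_measure_dominated c2.
have [m mE] := finite_measure_add m1 m2.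
have n1' : null_for m mu.
  apply: null_forS n1 => A mA; rewrite mE => /eqP.
  by rewrite padde_eq0 ?measure_ge0// => /andP[/eqP].
have n2' : null_for m nu.
  apply: null_forS n2 => A mA; rewrite mE => /eqP.
  by rewrite padde_eq0 ?measure_ge0// => /andP[_ /eqP].
have [u [u1 u2 u3]] := complex_measure_rep 0 c1 n1' mD1 d1.
have [v [v1 v2 v3]] := complex_measure_rep 0 c2 n2' mD2 d2.
by exists m, u, v.
Qed.

Lemma complex_measureD (A B : set (borel E)) mu : complex_measure mu ->
  measurable A -> measurable B -> A `&` B = set0 -> mu (A `|` B) = mu A + mu B.
Proof.
move=> cmu mA mB AB; have [m nm] := complex_measure_dominated cmu.
have [u [_ L uE _]] := complex_measure_density cmu nm.
rewrite !uE//; last exact: measurableU.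
rewrite -cintD; [|exact: cL1_indic..].
apply: eq_cint => x; rewrite -mulrDl; congr (_ * _).
rewrite !indicE in_setU; have [xA|_] := boolP (x \in A); last by rewrite add0r.
have [xB|_] := boolP (x \in B); last by rewrite addr0.
by have : (A `&` B) x by [split; exact: set_mem]; rewrite AB.
Qed.

Lemma atomless_concentrated_finite (l : seq E) mu : complex_measure mu ->
  concentrated_on [set` l] mu -> (forall x, mu [set x] = 0) -> mu = 0.
Proof.
move=> cmu; elim: l => [|x l IH] cl mu0.
  have [h _ _ _] := cmu.
  apply/funext => A; have [mA|nA] := pselect (measurable A); last by rewrite h.
  by apply: cl => //; rewrite set_nil setI0.
apply: IH => // A mA Al; have m1 := borel_measurable1 x.
have [_ mu00 _ _] := cmu.
rewrite -(setUIDK A [set x]) complex_measureD//; last 3 first.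
- exact: measurableI.
- exact: measurableD.
- by apply/seteqP; split=> // y [[_ yx] [_]].
have -> : mu (A `&` [set x]) = 0.
  have [Ax|nAx] := pselect (A x).
    by rewrite (_ : A `&` _ = [set x])//; apply/setIidPr => _ ->.
  by rewrite (_ : A `&` _ = set0)//; apply/seteqP; split=> // y [Ay yx]; rewrite yx in Ay.
rewrite add0r; apply: cl; first exact: measurableD.
apply/seteqP; split=> // y [[Ay yx]]; rewrite /= inE => /orP[/eqP//|yl].
by have : (A `&` [set` l]) y by []; rewrite Al.
Qed.

End concentration.

(** * Comparison of moments for different seminorms *)

Section moment_comparison.
Context {R : realType} {E : lmodType R}.
Implicit Types (mu nu rho : set (borel E) -> R[i]) (kappa eta : E -> R).

Lemma M_moment_le kappa eta (a : R) mu : seminorm kappa -> seminorm eta ->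
  0 <= a -> (forall x, eta x <= a * kappa x) ->
  M_moment kappa None mu -> M_moment eta None mu.
Proof.
move=> nk ne a0 le [M h]; split => // k _.
have [V [m [u [_ [tV b _]]]]] := base2 M M; have [_ _ r] := b.
have [k0 _ _] := nk; have [e0 _ _] := ne.
rewrite -/(mom eta k mu) (mom_based k b ne).
have mE : measurable_fun setT (fun x : borel E => eta x ^+ k).
  by apply: measurable_funX; exact: seminorm_measurable.
have E0 x : 0 <= eta x ^+ k by rewrite exprn_ge0.
apply/(wmass_integrable r mE E0).
have ik := integrableZr_EFin (a ^+ k) (based_integrable nk b (h k isT)).
apply: le_integrable ik => //.
  apply/measurable_EFinP; apply: measurable_funM.
    by have [mX _ _ _] := r; exact: (measurableT_comp mE mX).
  by apply: measurable_nrm; have [_ [] ] := r.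
move=> x _ /=; rewrite lee_fin !ger0_norm ?mulr_ge0 ?exprn_ge0 ?nrm_ge0//.
by rewrite mulrA ler_wpM2r ?nrm_ge0// -exprMn lerXn2r ?nnegrE ?mulr_ge0.
Qed.

Lemma seminormD kappa eta : seminorm kappa -> seminorm eta ->
  seminorm (fun x => kappa x + eta x).
Proof.
move=> [k0 kD kZ] [e0 eD eZ]; split=> [x|x y|a x]; first by rewrite addr_ge0.
  by rewrite addrACA lerD.
by rewrite kZ eZ mulrDr.
Qed.

(** Comparison with the maximum gives [(a + b) ^+ k <= 2 ^+ k * (a ^+ k + b ^+ k)] for nonnegative
    reals. *)
Lemma M_moment_seminormD kappa eta mu : seminorm kappa -> seminorm eta ->
  M_moment kappa None mu -> M_moment eta None mu ->
  M_moment (fun x => kappa x + eta x) None mu.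
Proof.
move=> nk ne [M h1] [_ h2]; have nke := seminormD nk ne; split => // k _.
have [V [m [u [_ [tV b _]]]]] := base2 M M; have [_ _ r] := b.
have [k0 _ _] := nk; have [e0 _ _] := ne; have [ke0 _ _] := nke.
rewrite -/(mom _ k mu) (mom_based k b nke).
have mE : measurable_fun setT (fun x : borel E => (kappa x + eta x) ^+ k).
  by apply: measurable_funX; exact: (seminorm_measurable nke).
have E0 x : 0 <= (kappa x + eta x) ^+ k by rewrite exprn_ge0.
apply/(wmass_integrable r mE E0).
have i12 := integrableD measurableT (based_integrable nk b (h1 k isT))
  (based_integrable ne b (h2 k isT)).
have ik := integrableZl measurableT (2 ^+ k) i12.
apply: le_integrable ik => //.
  apply/measurable_EFinP; apply: measurable_funM.
    by have [mX _ _ _] := r; exact: (measurableT_comp mE mX).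
  by apply: measurable_nrm; have [_ [] ] := r.
move=> x _ /=; rewrite lee_fin -mulrDl mulrA.
set y := retract_to V 0 x.
rewrite !ger0_norm ?mulr_ge0 ?addr_ge0 ?exprn_ge0 ?nrm_ge0//.
rewrite ler_wpM2r ?nrm_ge0//.
apply: (@le_trans _ _ ((2 * Num.max (kappa y) (eta y)) ^+ k)).
  rewrite lerXn2r ?nnegrE ?mulr_ge0 ?addr_ge0 ?le_max ?k0//.
  by rewrite mulrDl mul1r lerD// le_max lexx ?orbT.
rewrite exprMn ler_wpM2l ?exprn_ge0//.
by case: (leP (kappa y) (eta y)) => _; rewrite ?lerDl ?lerDr exprn_ge0.
Qed.

Lemma M_moment_concentrated (D : set E) kappa (a : R) mu : seminorm kappa ->
  M_E mu -> measurable (D : set (borel E)) -> D 0 -> concentrated_on D mu ->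
  (forall x, D x -> kappa x <= a) -> M_moment kappa None mu.
Proof.
move=> nk M mD D0 cD ka; split => // k _; have c := M_E_complex_measure M.
have [m [u [_ [b _]]]] := based_ex c c mD mD cD cD; have [_ _ r] := b.
have [k0 _ _] := nk.
rewrite -[X in (X < _)%E]/(mom kappa k mu) (mom_based k b nk).
have mE : measurable_fun setT (fun x : borel E => kappa x ^+ k).
  by apply: measurable_funX; exact: seminorm_measurable.
have E0 x : 0 <= kappa x ^+ k by rewrite exprn_ge0.
apply/(wmass_integrable r mE E0).
have [mX [mu' iu] _ _] := r.
apply: le_integrable (integrableZr_EFin (a ^+ k) iu) => //.
  apply/measurable_EFinP; apply: measurable_funM; last exact: measurable_nrm.
  exact: (measurableT_comp mE mX).
have Dr := retract_toP D0.
have a0 : 0 <= a by rewrite (le_trans (k0 0))// ka.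
move=> x _ /=; rewrite lee_fin !ger0_norm ?mulr_ge0 ?exprn_ge0 ?nrm_ge0//.
by rewrite ler_wpM2r ?nrm_ge0// lerXn2r ?nnegrE// ka.
Qed.

End moment_comparison.

Section convolution_supports.
Context {R : realType} {E : lmodType R}.
Variables (sigma : E -> E -> R) (s : E -> R).
Hypotheses (sigma1 : forall f, scalar (sigma f))
  (sigma2 : forall g, scalar (sigma ^~ g)) (ns : seminorm s).
Implicit Types (mu nu rho : set (borel E) -> R[i]).
Variables (psi : measurableTypeR R -> R[i]) (K : R) (j : nat).
Hypothesis gk : good_kernel sigma s psi K j.

(** The factors are represented by retractions onto [D1] and [D2], so sums of their values lie in
    the sum of these sets. Both contain 0 because it is the default value of the retractions. *)
Lemma conv_concentrated V (D1 D2 : set E) mu nu : tame V -> D1 `<=` V -> D2 `<=` V ->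
  measurable (D1 : set (borel E)) -> measurable (D2 : set (borel E)) -> D1 0 -> D2 0 ->
  concentrated_on D1 mu -> concentrated_on D2 nu -> M_E mu -> M_E nu ->
  (mom s j mu < +oo)%E -> (mom s j nu < +oo)%E ->
  concentrated_on [set x + y | x in D1 & y in D2] (conv sigma psi mu nu).
Proof.
move=> tV DV1 DV2 mD1 mD2 D10 D20 d1 d2 M1 M2 f1 f2.
have c1 := M_E_complex_measure M1; have c2 := M_E_complex_measure M2.
have [m [u [v [b1 b2]]]] := based_ex c1 c2 mD1 mD2 d1 d2.
have [mpsi K0 psiK] := gk; have [_ _ r1] := b1; have [_ _ r2] := b2.
have Dr1 := retract_toP D10; have Dr2 := retract_toP D20.
apply: (rep_concentrated_on (conv_rep sigma1 sigma2 mpsi psiK r1 r2 tV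
  (fun x => DV1 _ (Dr1 x)) (fun x => DV2 _ (Dr2 x))
  (based_integrable ns b1 f1) (based_integrable ns b2 f2))) => z.
by exists (retract_to D1 0 z.1) => //; exists (retract_to D2 0 z.2).
Qed.

Lemma cvariation_null (A : set (borel E)) mu :
  (forall B, measurable B -> B `<=` A -> mu B = 0) -> (cvariation mu A <= 0)%E.
Proof.
move=> h; apply: ge_ereal_sup => _ /= [n [F [mF tF FA ->]]].
rewrite big1// => i _; rewrite h; [exact: nrm0|exact: mF|].
by rewrite -FA => x Fx; exists i.
Qed.

(* The values of [conv] on [A] only involve those of [nu] on subsets of the
   translates of [A]. *)
Lemma conv_null_set V (A : set (borel E)) mu nu : tame V -> measurable A ->
  concentrated_on V mu -> concentrated_on V nu -> M_E mu -> M_E nu ->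
  (mom s j mu < +oo)%E -> (mom s j nu < +oo)%E ->
  (forall f B, V f -> measurable B ->
    B `<=` (fun g : borel E => (f + g : E) : borel E) @^-1` A -> nu B = 0) ->
  conv sigma psi mu nu A = 0.
Proof.
move=> tV mA d1 d2 M1 M2 f1 f2 nuA.
have c1 := M_E_complex_measure M1; have c2 := M_E_complex_measure M2.
have mV := tame_measurable tV.
have [m [u [v [b1 b2]]]] := based_ex c1 c2 mV mV d1 d2.
have [mpsi K0 psiK] := gk.
have r := conv_based sigma1 sigma2 ns gk tV b1 b2 f1 f2.
have [mX [md _] rE _] := r; rewrite (rE _ mA).
pose p : borel E -> borel E := retract_to V 0.
have Vp := retract_toP (tame0 tV) : forall x, V (p x).
pose G (z : borel E * borel E) := \1_A (p z.1 + p z.2 : E) *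
  conv_density sigma psi p p u v z.
have ia := based_integrable ns b1 f1; have ib := based_integrable ns b2 f2.
have iKa : m.-integrable setT (EFin \o (fun x => K * (s (p x) ^+ j * nrm (u x)))).
  exact: integrableZr_EFin.
have mG : cmeasurable G.
  apply: cmeasurableM => //.
  have mA' : measurable ((fun z : borel E * borel E => (p z.1 + p z.2 : E) : borel E) @^-1` A).
    by rewrite -[X in measurable X]setTI; exact: mX.
  exact: (cmeasurable_indic mA').
have GB x y : nrm (G (x, y)) <= K * (s (p x) ^+ j * nrm (u x)) * (s (p y) ^+ j * nrm (v y)).
  rewrite /G nrmM nrm_indic (le_trans _ (conv_density_bound psiK p p u v x y))//.
  by rewrite ler_piMl ?nrm_ge0// indicE; case: (_ \in _).
rewrite -/(cint _ G) -(cint_fubini1 iKa ib mG GB) -[RHS](cint0 m).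
apply: eq_cint => x.
pose B : set (borel E) := (fun g : borel E => (p x + g : E) : borel E) @^-1` A.
have mB : measurable B by rewrite -[B]setTI; apply: (measurable_translate (p x)).
(* The hypothesis on subsets of the translate makes the variation of [nu] vanish on [B], so [v] is
   zero almost everywhere there; outside [B] either the indicator of [A] or the density [v] is
   zero. *)
have v0 : (\int[m]_(y in B) (nrm (v y))%:E = 0)%E.
  rewrite -(cvariation_based b2 mB); apply/eqP; rewrite eq_le.
  rewrite cvariation_null /=; last by move=> C mC CB; exact: (nuA _ _ (Vp x) mC CB).
  by rewrite (cvariation_based b2 mB) integral_ge0// => y _; rewrite lee_fin nrm_ge0.
have [v0V [_ [mv _] _ _] _] := b2.
have mnv : measurable_fun B (fun y => (nrm (v y))%:E).
  by apply: measurable_funTS; apply/measurable_EFinP; exact: measurable_nrm.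
have ae0 : ae_eq m B (fun y => (nrm (v y))%:E) (cst 0%E).
  apply/ae_eq_integral_abs => //; rewrite -[RHS]v0; apply: eq_integral => y _.
  by rewrite gee0_abs// lee_fin nrm_ge0.
have aeG (q : R[i] -> R) : q 0 = 0 ->
    ae_eq m setT (fun y => (q (G (x, y)))%:E) (cst 0%E).
  move=> q0; apply: filterS ae0 => y h _ /=.
  have [By|nB] := pselect (B y); last first.
    have [Vy|nV] := pselect (V y).
      rewrite /G /= indicE memNset ?mul0r ?q0//.
      by rewrite {2}/p /retract_to (mem_set Vy).
    by rewrite /G /conv_density /= v0V// !mulr0 q0.
  have [/nrm_eq0 vy] := h By.
  by rewrite /G /conv_density /= vy !mulr0 q0.
have mGx := cmeasurable_pair1 mG x.
by apply: complex_eqP; rewrite /= /Rintegral -[RHS]/(fine 0%E); congr fine;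
  rewrite -(integral0 m setT); apply: ae_eq_integral => //;
  [apply/measurable_EFinP; case: mGx|exact: aeG|apply/measurable_EFinP; case: mGx|exact: aeG].
Qed.

End convolution_supports.

(** * Continuous, discrete and finitely supported measures *)

Section families.
Context {R : realType} {E : lmodType R}.
Implicit Types (mu nu rho : set (borel E) -> R[i]).

(** Point masses are continuous for [norm1], so the closure creates no atoms; conversely, the
    restrictions of an atomless measure to subspaces are atomless. *)
Lemma M_E_cP mu : M_E_c mu <-> M_E mu /\ forall x, mu [set x] = 0.
Proof.
split=> [[cmu app]|[M mu0]].
  split.
    split => // e /app[F [nu [fF [nuF _] lt]]].
    by exists F, nu.
  move=> x; apply: nrm_eq0; apply/eqP; rewrite eq_le nrm_ge0 andbT.
  apply/ler_addgt0Pl => e e0; rewrite addr0.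
  have [F [nu [fF [nuF nu0] lt]]] := app e e0.
  have -> : mu [set x] = (mu - nu) [set x].
    by rewrite [RHS](_ : _ = mu [set x] - nu [set x])// nu0 subr0.
  have mx := borel_measurable1 x.
  rewrite -lee_fin; apply: (le_trans (nrm_cvariation (mu - nu) mx)).
  apply: (le_trans _ (ltW lt)); apply: le_cvariation => //.
have [cmu [V [F [fF ndF VE]] cV]] := (M_EP mu).1 M.
split => // e e0; have mF n := fin_dim_measurable (fF n).
rewrite VE in cV; have [n ne] := crestrict_approx cmu mF ndF cV e0.
exists (F n), (crestrict (F n) mu); split => //.
have [m mmu] := complex_measure_dominated cmu.
have [u r] := complex_measure_density cmu mmu.
split; first split.
- exact: rep_complex_measure (crestrict_rep (mF n) r).
- exact: concentrated_crestrict.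
move=> x; rewrite /crestrict /on_measurable asboolT; last exact: borel_measurable1.
have [Fx|nFx] := pselect (F n x).
  by rewrite (_ : _ `&` _ = [set x])//; apply/setIidPl => _ ->.
have [_ mu00 _ _] := cmu.
by rewrite (_ : _ `&` _ = set0)//; apply/seteqP; split=> // y [yx Fy]; rewrite yx in Fy.
Qed.

(** The union of the countable carriers of an approximating sequence carries the limit. Conversely,
    a countable carrier meets an exhausting sequence of subspaces in countable sets, to which [mu]
    can be restricted. *)
Lemma M_E_dP mu : M_E_d mu <->
  complex_measure mu /\ exists2 D : set E, countable D & concentrated_on D mu.
Proof.
split=> [Md|[cmu [D cD dD]]].
  have [cmu _] := Md; split => //.
  have [F [nu [fF Fnu lim]]] := norm1_closure_approx Md.
  have /choice[D DP] n : exists D : set E, countable D /\ concentrated_on D (nu n).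
    by have [_ [D [cD _ dD]]] := Fnu n; exists D.
  exists (\bigcup_n D n).
    by apply: bigcup_countable => // n _; case: (DP n).
  apply: (norm1_lim_concentrated (nu := nu)) => //.
  - by apply: borel_countable; apply: bigcup_countable => // n _; case: (DP n).
  - by move=> n; case: (Fnu n) => -[].
  - move=> n; have [_ dn] := DP n; apply: concentratedS dn.
    by move=> x Dx; exists n.
split => // e e0; have [V [F [fF ndF VE]] DV] := tame_countable cD.
have cDF n : countable (D `&` F n).
  by apply: sub_countable cD; apply: subset_card_le; exact: subIsetl.
have dU : concentrated_on (\bigcup_n (D `&` F n)) mu.
  apply: concentratedS dD => x Dx; have := DV _ Dx; rewrite VE => -[n _ Fx].
  by exists n.
have mD n : measurable (D `&` F n : set (borel E)) by exact: borel_countable.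
have [n ne] := crestrict_approx cmu mD (fun i j ij => setIS (ndF i j ij)) dU e0.
exists (F n), (crestrict (D `&` F n : set (borel E)) mu); split => //.
have [m mmu] := complex_measure_dominated cmu.
have [u r] := complex_measure_density cmu mmu.
have cr : concentrated_on (D `&` F n) (crestrict (D `&` F n : set (borel E)) mu).
  exact: concentrated_crestrict.
split; first split.
- exact: rep_complex_measure (crestrict_rep (mD n) r).
- by apply: concentratedS cr; exact: subIsetr.
- by exists (D `&` F n); split => //; exact: subIsetr.
Qed.

Definition point_masses (l : seq (R[i] * E)) : set (borel E) -> R[i] :=
  on_measurable (fun A => \sum_(p <- l) p.1 * \1_A p.2).

Lemma point_masses_cons p l :
  point_masses (p :: l) = p.1 *: point_masses [:: (1, p.2)] + point_masses l.
Proof.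
apply/funext => A; rewrite [RHS](_ : _ = p.1 * point_masses [:: (1, p.2)] A + point_masses l A)//.
rewrite /point_masses /on_measurable; case: asboolP => _; last by rewrite mulr0 addr0.
by rewrite big_cons big_seq1 mul1r.
Qed.

Lemma point_masses_complex_measure l : complex_measure (point_masses l).
Proof.
elim: l => [|p l IH].
  rewrite (_ : point_masses [::] = 0); first exact: complex_measure0.
  by apply/funext => A; rewrite /point_masses /on_measurable big_nil; case: asboolP.
rewrite point_masses_cons; apply: complex_measure_lin => //.
pose m := @dirac _ (borel E) (p.2 : E) R.
apply: (@rep_complex_measure _ _ _ (borel E) m (fun x => x) (fun=> 1)).
split => //; first exact: cL1_cst.
- move=> A mA; rewrite /point_masses /on_measurable asboolT// big_seq1 mul1r /cint.
  have ic (q : borel E -> R) : measurable_fun setT q -> \int[m]_x q x = q p.2.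
    by move=> mq; rewrite /Rintegral integral_dirac// ?diracT ?mul1e//; exact/measurable_EFinP.
  have mI := measurable_indic mA : measurable_fun setT (\1_A : borel E -> R).
  under eq_Rintegral do rewrite mulr1 Re_indic.
  rewrite (ic _ mI); under eq_Rintegral do rewrite mulr1 Im_indic.
  rewrite (ic (fun=> 0)) ?measurable_cst//.
  by apply: complex_eqP; rewrite ?Re_indic ?Im_indic.
- by move=> A nA; rewrite /point_masses /on_measurable asboolF.
Qed.

Lemma point_masses_concentrated l : concentrated_on [set` map snd l] (point_masses l).
Proof.
move=> A mA Al; rewrite /point_masses /on_measurable asboolT//.
rewrite big1_seq// => p /andP[_ pl]; rewrite indicE memNset ?mulr0// => Ap.
have : (A `&` [set` map snd l]) p.2 by split => //=; apply: map_f.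
by rewrite Al.
Qed.

(** Subtracting the point masses with weights [mu [set x]] leaves a measure without atoms on a
    finite carrier, which is zero. *)
Lemma M_E_dfP mu : M_E_df mu <->
  complex_measure mu /\ exists l : seq E, concentrated_on [set` l] mu.
Proof.
split=> [[l ->]|[cmu [l cl]]].
  split; first exact: point_masses_complex_measure.
  by exists (map snd l); exact: point_masses_concentrated.
(* Repetitions are removed, because each would count the mass of its point again. *)
pose l' := [seq (mu [set x], x) | x <- undup l].
exists l'; rewrite -/(point_masses l').
have cp := point_masses_complex_measure l'.
apply: subr0_eq; apply: (atomless_concentrated_finite (l := l)).
- exact: complex_measureB.
- apply: concentratedB => //; apply: concentratedS (point_masses_concentrated (l := l')).
  by move=> x; rewrite /= /l' -map_comp map_id mem_undup.
move=> x; rewrite [LHS](_ : _ = mu [set x] - point_masses l' [set x])//.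
rewrite /point_masses /on_measurable asboolT; last exact: borel_measurable1.
rewrite /l' big_map /=.
have [xl|xl] := boolP (x \in undup l).
  rewrite (bigD1_seq x)//= ?undup_uniq// indicE mem_set// mulr1 big1 ?addr0 ?subrr//.
  by move=> y yx; rewrite indicE memNset ?mulr0// => yx'; rewrite yx' eqxx in yx.
rewrite big1_seq ?subr0//; last first.
  move=> y /andP[_ yl]; rewrite indicE memNset ?mulr0// => yx.
  by rewrite -yx yl in xl.
apply: cl; first exact: borel_measurable1.
by apply/seteqP; split=> // y [-> /=]; rewrite -mem_undup (negbTE xl).
Qed.

End families.

Lemma countable_setU T (A B : set T) : countable A -> countable B -> countable (A `|` B).
Proof.
move=> cA cB; rewrite -bigcup2E; apply: bigcup_countable => //.
by move=> [|[|i]] _ //=; exact: countable0.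
Qed.

Lemma countable_setD (E : zmodType) (A B : set E) : countable A -> countable B ->
  countable [set x + y | x in A & y in B].
Proof.
move=> cA cB; rewrite image2E; apply: sub_countable (countableX cA cB).
exact: card_image_le.
Qed.

(** * Poisson algebras from stability under convolutions *)

Section closed_families.
Context {R : realType} {E : lmodType R}.
Variables (sigma : E -> E -> R) (s : E -> R) (c : R).
Hypotheses (sigma1 : forall f, scalar (sigma f))
  (sigma2 : forall g, scalar (sigma ^~ g)) (sigmaA : forall f g, sigma f g = - sigma g f)
  (ns : seminorm s) (c0 : 0 < c)
  (sigma_bound : forall f g, `|sigma f g| <= c * s f * s g).
Implicit Types (mu nu rho : set (borel E) -> R[i]) (P Q : set (set (borel E) -> R[i])).

Local Notation M := (M_moment (R := R) (E := E) s None).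

(* The closure properties of a subspace [Q], as long as all moments exist, that
   make it a Poisson algebra invariant under the twisted products. *)
Definition conv_stable Q :=
  [/\ Q 0, forall (a : R[i]) mu nu, Q mu -> Q nu -> Q (a *: mu + nu),
      forall mu, Q mu -> Q (adjoint mu) &
      forall psi K j mu nu, good_kernel sigma s psi K j ->
        M mu -> M nu -> Q mu -> Q nu -> Q (conv sigma psi mu nu)].

Let fin mu j : M mu -> (mom s j mu < +oo)%E.
Proof. by case=> _; exact. Qed.

Lemma conv_stableI P Q : conv_stable P -> conv_stable Q -> conv_stable (P `&` Q).
Proof.
move=> [p0 pl pa pc] [q0 ql qa qc]; split=> //.
- by move=> a mu nu [? ?] [? ?]; split; [exact: pl|exact: ql].
- by move=> mu [? ?]; split; [exact: pa|exact: qa].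
- by move=> psi K j mu nu g M1 M2 [? ?] [? ?]; split; [exact: pc g _ _ _ _|exact: qc g _ _ _ _].
Qed.

Lemma conv_stable_bigcap I (P : I -> set (set (borel E) -> R[i])) :
  (forall i, conv_stable (P i)) -> conv_stable (\bigcap_i P i).
Proof.
move=> h; split.
- by move=> i _; case: (h i).
- by move=> a mu nu P1 P2 i _; case: (h i) => _ + _ _; apply; [exact: P1|exact: P2].
- by move=> mu P1 i _; case: (h i) => _ _ + _; apply; exact: P1.
- move=> psi K j mu nu g M1 M2 P1 P2 i _; case: (h i) => _ _ _.
  by apply; [exact: g| | |exact: P1|exact: P2].
Qed.

Lemma conv_stable_moment kappa : seminorm kappa -> conv_stable (M_moment kappa None).
Proof.
move=> nk; split=> [|a mu nu|mu|psi K j mu nu g M1 M2 N1 N2].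
- exact: M_moment0.
- exact: M_moment_lin.
- exact: adjoint_M_moment.
- exact: (conv_moment sigma1 sigma2 ns g).
Qed.

Lemma conv_stable_d : conv_stable (M_E_d (E := E)).
Proof.
have dE mu : M_E_d mu -> M_E mu.
  by case=> cmu app; split=> // e /app[F [nu [fF [nuF _] lt]]]; exists F, nu.
split.
- apply/M_E_dP; split; first exact: complex_measure0.
  by exists set0; [exact: countable0|].
- move=> a mu nu /M_E_dP[c1 [D1 cD1 d1]] /M_E_dP[c2 [D2 cD2 d2]].
  apply/M_E_dP; split; first exact: complex_measure_lin.
  exists (D1 `|` D2); first by apply: countable_setU.
  apply: concentrated_lin.
    by apply: concentratedS d1; exact: subsetUl.
  by apply: concentratedS d2; exact: subsetUr.
- move=> mu Qmu; have Mmu := adjoint_M_E (dE _ Qmu); move/M_E_dP : Qmu => [_ [D cD d1]].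
  apply/M_E_dP; split; first exact: M_E_complex_measure.
  exists [set - x | x in D]; last exact: adjoint_concentrated.
  by apply: sub_countable cD; exact: card_image_le.
move=> psi K j mu nu g M1 M2 /M_E_dP[c1 [D1 cD1 d1]] /M_E_dP[c2 [D2 cD2 d2]].
apply/M_E_dP; split.
  apply: M_E_complex_measure.
  exact: (conv_M_E sigma1 sigma2 ns g (proj1 M1) (proj1 M2) (fin j M1) (fin j M2)).
(* The origin is adjoined because the retractions take it as their default value. *)
pose D1' := 0 |` D1; pose D2' := 0 |` D2.
have cD1' : countable D1' by apply: countable_setU.
have cD2' : countable D2' by apply: countable_setU.
have [V tV DV] := tame_countable (countable_setU cD1' cD2').
exists [set x + y | x in D1' & y in D2'].
  exact: countable_setD.
apply: (conv_concentrated sigma1 sigma2 ns g tV).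
- by move=> x Dx; apply: DV; left.
- by move=> x Dx; apply: DV; right.
- exact: borel_countable.
- exact: borel_countable.
- by left.
- by left.
- by apply: concentratedS d1; exact: subsetUr.
- by apply: concentratedS d2; exact: subsetUr.
- by case: M1.
- by case: M2.
- exact: fin.
- exact: fin.
Qed.

Lemma conv_stable_c : conv_stable (M_E_c (E := E)).
Proof.
split.
- by apply/M_E_cP; split => //; exact: M_E0.
- move=> a mu nu /M_E_cP[M1 mu0] /M_E_cP[M2 nu0]; apply/M_E_cP.
  split=> [|x]; first exact: M_E_lin.
  by rewrite [LHS](_ : _ = a * mu [set x] + nu [set x])// mu0 nu0 mulr0 addr0.
- move=> mu /M_E_cP[M1 mu0]; apply/M_E_cP; split=> [|x]; first exact: adjoint_M_E.
  by rewrite /adjoint image_set1 mu0 conjc0.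
move=> psi K j mu nu g M1 M2 /M_E_cP[N1 _] /M_E_cP[N2 nu0]; apply/M_E_cP; split.
  exact: (conv_M_E sigma1 sigma2 ns g N1 N2 (fin j M1) (fin j M2)).
move=> x; have [_ [V1 tV1 d1]] := (M_EP mu).1 N1; have [c2 [V2 tV2 d2]] := (M_EP nu).1 N2.
have [V [tV VV1 VV2]] := tame_join tV1 tV2.
apply: (conv_null_set sigma1 sigma2 ns g tV (borel_measurable1 x)
  (concentratedS VV1 d1) (concentratedS VV2 d2) N1 N2 (fin j M1) (fin j M2)) => f B Vf mB Bx.
(* The translate of a point is a point, so a nonempty [B] is a single point, which [nu] does not
   charge. *)
have Bs : B `<=` [set x - f] by move=> y /Bx /= <-; rewrite addrC addKr.
have [_ nu00 _ _] := c2.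
have [->|Bn0] := pselect (B = set0); first exact: nu00.
suff -> : B = [set x - f] by [].
apply/seteqP; split=> // _ ->; have /set0P[y By] : B != set0 by apply/eqP.
by have <- := Bs _ By.
Qed.

Lemma conv_stable_a F : fin_dim_subspace F -> conv_stable (M_fin_a F).
Proof.
move=> fF; have tF := tame_fin_dim fF; split.
- have [l hl] := haar_measure_ex fF; split; last by exists l.
  by split; first exact: complex_measure0.
- move=> a mu nu [[c1 d1] [l1 h1 n1]] [[c2 d2] [l2 h2 n2]]; split.
    by split; [exact: complex_measure_lin|exact: concentrated_lin].
  have [l hl lE] := haar_measureD h1 h2; exists l => // A mA.
  rewrite lE => /eqP; rewrite padde_eq0 ?measure_ge0// => /andP[/eqP A1 /eqP A2].
  by rewrite [LHS](_ : _ = a * mu A + nu A)// n1// n2// mulr0 addr0.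
- move=> mu [Fmu [l hl n]]; have M1 := M_fin_M_E fF Fmu; have [_ d1] := Fmu; split.
    split; first exact/M_E_complex_measure/adjoint_M_E.
    apply: concentratedS (adjoint_concentrated d1) => _ [x Fx <-].
    exact: tameN.
  have [l' hl' lE] := haar_measureN fF hl; exists l' => // A mA.
  rewrite lE /adjoint => l0; rewrite n ?conjc0//.
  exact/measurable_opp_image.
move=> psi K j mu nu g M1 M2 [Fmu _] [Fnu [l hl n]].
have N1 := M_fin_M_E fF Fmu; have N2 := M_fin_M_E fF Fnu.
have [_ d1] := Fmu; have [_ d2] := Fnu; split; first split.
- apply: M_E_complex_measure.
  exact: (conv_M_E sigma1 sigma2 ns g N1 N2 (fin j M1) (fin j M2)).
- have mF := fin_dim_measurable fF; have F0 := tame0 tF.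
  apply: concentratedS (conv_concentrated sigma1 sigma2 ns g tF (@subset_refl _ F)
    (@subset_refl _ F) mF mF F0 F0 d1 d2 N1 N2 (fin j M1) (fin j M2)).
  by move=> _ [x Fx [y Fy <-]]; exact: tameD.
exists l => // A mA lA0.
apply: (conv_null_set sigma1 sigma2 ns g tF mA d1 d2 N1 N2 (fin j M1) (fin j M2)) => f B Ff mB BA.
apply: n => //; have [_ lT _ _] := hl.
have mT : measurable ((fun y : borel E => (f + y : E) : borel E) @^-1` A).
  by rewrite -[X in measurable X]setTI; exact: (measurable_translate f).
(* [B] lies in a translate of [A] by an element of [F], which is null for the Haar measure because
   [A] is. *)
apply/eqP; rewrite eq_le measure_ge0 andbT -lA0 -(lT (- f) A (tameN tF Ff) mA).
apply: le_measure; rewrite ?inE//; last by rewrite translate_image opprK.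
by rewrite translate_image opprK.
Qed.

Lemma M_E_df_moment mu : M_E_df mu -> M mu.
Proof.
move=> /M_E_dfP[cmu [l cl]].
have fl : countable [set` (0 : E) :: l] by apply: finite_set_countable; exact: finite_seq.
have cl' : concentrated_on [set` (0 : E) :: l] mu.
  by apply: concentratedS cl => x; rewrite /= inE => ->; rewrite orbT.
have Mmu : M_E mu.
  apply/M_EP; split => //; have [V tV lV] := tame_countable fl.
  by exists V => //; exact: concentratedS cl'.
have [s0 _ _] := ns.
(* The sum of [s] over the list bounds [s] at each of its points. *)
apply: (M_moment_concentrated (D := [set` (0 : E) :: l]) (a := \sum_(x <- l) s x) ns Mmu) => //.
- exact: borel_countable.
- by rewrite /= inE eqxx.
move=> x; rewrite /= inE => /orP[/eqP ->|xl].
  by rewrite seminorm_0// sumr_ge0.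
by rewrite (big_rem x)//= lerDl sumr_ge0.
Qed.

Lemma conv_stable_df : conv_stable (M_E_df (E := E)).
Proof.
split.
- apply/M_E_dfP; split; first exact: complex_measure0.
  by exists [::].
- move=> a mu nu /M_E_dfP[c1 [l1 d1]] /M_E_dfP[c2 [l2 d2]].
  apply/M_E_dfP; split; first exact: complex_measure_lin.
  exists (l1 ++ l2); apply: concentrated_lin.
    by apply: concentratedS d1 => x; rewrite /= mem_cat => ->.
  by apply: concentratedS d2 => x; rewrite /= mem_cat => ->; rewrite orbT.
- move=> mu Qmu; have [Mmu _] := M_E_df_moment Qmu; move/M_E_dfP : Qmu => [_ [l d1]].
  apply/M_E_dfP; split; first exact/M_E_complex_measure/adjoint_M_E.
  exists (map -%R l); apply: concentratedS (adjoint_concentrated d1).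
  by move=> _ [x xl <-]; exact: map_f.
move=> psi K j mu nu g M1 M2 /M_E_dfP[c1 [l1 d1]] /M_E_dfP[c2 [l2 d2]].
apply/M_E_dfP; split.
  apply: M_E_complex_measure.
  exact: (conv_M_E sigma1 sigma2 ns g (proj1 M1) (proj1 M2) (fin j M1) (fin j M2)).
have cl (l : seq E) : countable [set` 0 :: l].
  by apply: finite_set_countable; exact: finite_seq.
have [V tV lV] := tame_countable (countable_setU (cl l1) (cl l2)).
exists [seq x + y | x <- 0 :: l1, y <- 0 :: l2].
have := @conv_concentrated _ _ _ _ sigma1 sigma2 ns _ _ _ g V [set` 0 :: l1] [set` 0 :: l2]
  mu nu tV.
move=> /(_ _ _ _ _ _ _ _ _ (proj1 M1) (proj1 M2) (fin j M1) (fin j M2)) h.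
apply: concentratedS (h _ _ _ _ _ _ _ _).
- by move=> _ [x xl [y yl <-]]; apply/allpairsP; exists (x, y).
- by move=> x lx; apply: lV; left.
- by move=> x lx; apply: lV; right.
- exact: borel_countable.
- exact: borel_countable.
- by rewrite /= inE eqxx.
- by rewrite /= inE eqxx.
- by apply: concentratedS d1 => x; rewrite /= inE => ->; rewrite orbT.
- by apply: concentratedS d2 => x; rewrite /= inE => ->; rewrite orbT.
Qed.

(** On [P] both operations are convolutions, whose identities hold on all of [M_moment s None]; what
    [P] has to supply is closure. *)
Lemma poisson_algebra_stable P : P `<=` M -> conv_stable P ->
  poisson_algebra P (star sigma 0) adjoint (bracket0 sigma) /\
  forall h mu nu, P mu -> P nu -> P (star sigma h mu nu).
Proof.
move=> PM [P0 Pl Pa Pc].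
have ge h := ekernel_good sigma s h; have gb := bkernel_good c0 sigma_bound 0.
have PE mu : P mu -> M_E mu by move=> /PM[].
have sE h mu nu : P mu -> P nu -> star sigma h mu nu = conv sigma (ekernel h) mu nu.
  by move=> /PE ? /PE ?; exact: (starE sigma1 sigma2 ns).
have Pstar h mu nu : P mu -> P nu -> P (conv sigma (ekernel h) mu nu).
  by move=> P1 P2; apply: (Pc _ _ _ _ _ (ge h)) => //; exact: PM.
have Pbr mu nu : P mu -> P nu -> P (conv sigma (bkernel 0) mu nu).
  by move=> P1 P2; apply: (Pc _ _ _ _ _ gb) => //; exact: PM.
have mulC := mul_comm sigma1 sigma2 sigmaA ns.
(* At [h = 0] both kernels are real, so conjugation does not alter them and the adjoint respects
   product and bracket. *)
have ek t : ((ekernel 0 t : R[i])^*)%C = ekernel 0 t.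
  by rewrite /ekernel mulr0 mul0r oppr0 /expi cos0 sin0 /= oppr0.
have bk t : ((bkernel 0 t : R[i])^*)%C = bkernel 0 t by exact: conjc_real.
split; last by move=> h mu nu P1 P2; rewrite (sE _ _ _ P1 P2); exact: Pstar.
split.
- split; [exact: P0|exact: Pl| |exact: Pa|].
  + by move=> mu nu P1 P2; rewrite (sE _ _ _ P1 P2); exact: Pstar.
  + by move=> mu nu P1 P2; rewrite bracket0E; exact: Pbr.
- split.
  + by move=> mu nu P1 P2; rewrite !sE//; apply: mulC; exact: PM.
  + move=> mu nu rho P1 P2 P3; rewrite (sE _ nu rho P2 P3) (sE _ mu nu P1 P2).
    rewrite !sE//; [|exact: Pstar..].
    by apply: (mul_assoc sigma1 sigma2 sigmaA ns); exact: PM.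
  + move=> a mu nu rho P1 P2 P3; rewrite !sE//; last exact: Pl.
    exact: (convZl_D sigma1 sigma2 ns (ge 0) a (PE _ P1) (PE _ P2) (PE _ P3)
      (fin 0 (PM _ P1)) (fin 0 (PM _ P2)) (fin 0 (PM _ P3))).
  + move=> a mu nu rho P1 P2 P3; rewrite !sE//; last exact: Pl.
    exact: (convZr_D sigma1 sigma2 ns (ge 0) a (PE _ P3) (PE _ P1) (PE _ P2)
      (fin 0 (PM _ P3)) (fin 0 (PM _ P1)) (fin 0 (PM _ P2))).
- split.
  + by move=> a mu nu _ _; exact: adjoint_lin.
  + by move=> mu _; exact: adjointK.
  + move=> mu nu P1 P2; rewrite !sE//; [|exact: Pa..].
    rewrite (mulC _ _ (PM _ (Pa _ P2)) (PM _ (Pa _ P1))).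
    rewrite -(conv_adjoint sigma1 sigma2 ns (ge 0) (PE _ P1) (PE _ P2));
      [|exact/fin/PM|exact/fin/PM].
    exact: eq_conv.
split; first split.
- move=> a mu nu rho P1 P2 P3; rewrite !bracket0E.
  exact: (convZl_D sigma1 sigma2 ns gb a (PE _ P1) (PE _ P2) (PE _ P3)
    (fin 1 (PM _ P1)) (fin 1 (PM _ P2)) (fin 1 (PM _ P3))).
- move=> a mu nu rho P1 P2 P3; rewrite !bracket0E.
  exact: (convZr_D sigma1 sigma2 ns gb a (PE _ P3) (PE _ P1) (PE _ P2)
    (fin 1 (PM _ P3)) (fin 1 (PM _ P1)) (fin 1 (PM _ P2))).
- move=> mu nu P1 P2; rewrite !bracket0E.
  by apply: (br_anticomm sigma1 sigma2 sigmaA ns c0 sigma_bound); exact: PM.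
- move=> mu nu P1 P2; rewrite !bracket0E.
  rewrite -(conv_adjoint sigma1 sigma2 ns gb (PE _ P1) (PE _ P2)); [|exact/fin/PM|exact/fin/PM].
  exact: eq_conv.
- move=> mu nu rho P1 P2 P3; rewrite !bracket0E.
  by apply: (br_jacobi sigma1 sigma2 sigmaA ns c0 sigma_bound); exact: PM.
- move=> mu nu rho P1 P2 P3; rewrite !bracket0E (sE _ nu rho P2 P3).
  rewrite !sE//; [|exact: Pbr..].
  by apply: (br_mul sigma1 sigma2 sigmaA ns c0 sigma_bound); exact: PM.
Qed.

Lemma family_I_stable P : family_I s P -> P `<=` M /\ conv_stable P.
Proof.
move=> [kappa [nk rel ->]]; split; last exact: conv_stable_moment.
have [k k0 le] : exists2 k : R, 0 <= k & forall x, s x <= k * kappa x.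
  case: rel => [//|[k1 [k2 [k10 k12 h]]]].
  exists k1^-1; first by rewrite invr_ge0 ltW.
  by move=> x; rewrite ler_pdivlMl//; have /andP[] := h x.
by move=> mu; exact: (M_moment_le nk ns k0 le).
Qed.

Lemma family_II_stable P : (exists f g, sigma f g != 0) -> family_II s P ->
  P `<=` M /\ conv_stable P.
Proof.
move=> [f0 [g0 fg0]] [B [kappa [G [d [nk d0 le ->]]]]]; split; last first.
  by apply: conv_stable_bigcap => b; exact: conv_stable_moment.
move=> mu Pmu; have [s0 _ _] := ns.
(* If [G] were empty, [s] and with it [sigma] would vanish. A member of [G] supplies an index,
   through which the intersection defining [P] yields [M_E mu]. *)
have [b0 _] : exists b0 : B, b0 \in (G : seq B).
  case: (boolP ((G : seq B) == [::])) => [/eqP G0|].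
    exfalso; move/negP : fg0; apply; rewrite -normr_eq0 eq_le normr_ge0 andbT.
    rewrite (le_trans (sigma_bound _ _))//.
    have := le f0; rewrite G0 big_nil => sf.
    have -> : s f0 = 0 by apply/eqP; rewrite eq_le sf s0.
    by rewrite mulr0 mul0r.
  by case: (G : seq B) => // b l _; exists b; rewrite inE eqxx.
have [Mmu _] := Pmu b0 I.
have key (l : seq B) : {subset l <= (G : seq B)} ->
    seminorm (fun x => \sum_(b <- l) d b * kappa b x) /\
    M_moment (fun x => \sum_(b <- l) d b * kappa b x) None mu.
  elim: l => [_|b l IH lG].
    (* The empty sum is the zero seminorm, whose moments are compared with those of [kappa b0] with
       the constant 0. *)
    under eq_fun do rewrite big_nil; split; first exact: seminorm0.
    apply: (M_moment_le (kappa := kappa b0) (a := 0)) => //; last exact: Pmu.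
      exact: seminorm0.
    by move=> x; rewrite mul0r.
  have [|n1 m1] := IH; first by move=> y yl; apply: lG; rewrite inE yl orbT.
  have db : 0 <= d b by rewrite ltW// d0// lG// inE eqxx.
  have n2 := seminormZ db (nk b).
  under eq_fun do rewrite big_cons.
  split; first exact: seminormD.
  apply: M_moment_seminormD => //.
  by apply: (M_moment_le (kappa := kappa b) (a := d b)) => //; exact: Pmu.
have [n1 m1] := key G (fun _ => id).
apply: (M_moment_le n1 ns ler01 _ m1) => x.
by rewrite mul1r.
Qed.

End closed_families.

Theorem theorem3 (R : realType) (E : lmodType R)
  (E_infinite : @infinite_dimensional R E)
  (sigma : E -> E -> R) (sigma_presymplectic : pre_symplectic sigma)
  (s : E -> R) (s_seminorm : seminorm s)
  (c : R) (c_gt0 : 0 < c)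
  (sigma_bound : forall f g, `|sigma f g| <= c * s f * s g) :
  [/\ (* (1) *)
      (forall mu nu, M_moment s (Some 1%N) mu -> M_moment s (Some 1%N) nu ->
         bracket0_integrable sigma mu nu /\ M_E (bracket0 sigma mu nu)) /\
      (forall (n : nat) mu nu,
         M_moment s (Some n.+1) mu -> M_moment s (Some n.+1) nu ->
         M_moment s (Some n) (bracket0 sigma mu nu) /\
         (norm_moment s n (bracket0 sigma mu nu) <=
            (c * (max_bin n)%:R)%:E *
              norm_moment s n.+1 mu * norm_moment s n.+1 nu)%E),
      (* (2) *)
      (forall n : nat,
         bracket_jointly_continuous sigma s (Some n.+1) (Some n)) /\
      bracket_jointly_continuous sigma s None None,
      (* (3) *)
      bracket0_jointly_continuous sigma s None None /\
      poisson_algebra (M_moment s None) (star sigma 0) adjoint (bracket0 sigma) &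
      (* (4) *)
      forall P : set (set (borel E) -> R[i]),
        family_I s P \/ family_II s P \/ family_III s P \/ family_IV P ->
        [/\ P `<=` M_moment s None,
            poisson_algebra P (star sigma 0) adjoint (bracket0 sigma) &
            forall (h : R) mu nu, P mu -> P nu -> P (star sigma h mu nu)]].
Proof.
have [sigma1 sigma2 sigmaA sigma0] := sigma_presymplectic.
have MM : conv_stable sigma s (M_moment s None).
  exact: (conv_stable_moment sigma1 sigma2 s_seminorm).
have stable P := @poisson_algebra_stable R E sigma s c sigma1 sigma2 sigmaA s_seminorm c_gt0
  sigma_bound P.
have families P : family_I s P \/ family_II s P ->
    P `<=` M_moment s None /\ conv_stable sigma s P.
  case; first exact: (family_I_stable sigma1 sigma2 s_seminorm).
  exact: (family_II_stable sigma1 sigma2 s_seminorm sigma_bound sigma0).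
split.
- have gb := bkernel_good c_gt0 sigma_bound 0; split=> [mu nu M1 M2|n mu nu M1 M2].
    split; first exact: (bracket0_integrableP sigma1 sigma2 s_seminorm sigma_bound).
    have [[]] := conv_norm_moment sigma1 sigma2 s_seminorm gb M1 M2.
    by rewrite -bracket0E.
  by rewrite bracket0E; exact: (conv_norm_moment sigma1 sigma2 s_seminorm gb M1 M2).
- split=> [n|].
    exact: (@bracket_jointly_continuousP R E sigma s c sigma1 sigma2 sigmaA s_seminorm c_gt0
      sigma_bound (Some n)).
  exact: (@bracket_jointly_continuousP R E sigma s c sigma1 sigma2 sigmaA s_seminorm c_gt0
    sigma_bound None).
- split.
    exact: (bracket0_jointly_continuousP sigma1 sigma2 s_seminorm c_gt0 sigma_bound).
  by have [] := stable _ (@subset_refl _ _) MM.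
move=> P fP.
suff [PM sP] : P `<=` M_moment s None /\ conv_stable sigma s P.
  by have [pP hP] := stable P PM sP.
case: fP => [fI|[fII|[[Q [P' [QE fP' ->]]]|->]]].
- by apply: families; left.
- by apply: families; right.
- have [PM sP] := families P' fP'; split; first by move=> mu [_ /PM].
  apply: conv_stableI => //; case: QE => [->|[->|[F fF ->]]].
  + exact: (conv_stable_d sigma1 sigma2 s_seminorm).
  + exact: (conv_stable_c sigma1 sigma2 s_seminorm).
  + exact: (conv_stable_a sigma1 sigma2 s_seminorm fF).
- split; first by move=> mu; exact: M_E_df_moment.
  exact: (conv_stable_df sigma1 sigma2 s_seminorm).
Qed.
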